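(* Let $G$ be a two-player ($I=\{1,2\}$) zero-sum ($u_1+u_2\equiv0$ on $H_\infty$) dynamic game with perfect information, with or without Nature. Then $G$ possesses a pure-strategy subgame-perfect equilibrium.
   Context: **Dynamic game with perfect information.** The set of active players is $I=\{1,\dots,n\}$; player $0$ is Nature and $I_0=I\cup\{0\}$. Stages are $t=0,1,2,\dots$. The set of starting points is $H_0=X_0\times S_0$, with $X_0$ a compact metric space and $S_0$ a Polish space. For $t\ge1$ let $X_{ti}$ ($i\in I$) and $S_t$ be Polish spaces, $X_t=\prod_{i\in I}X_{ti}$, $X^t=\prod_{0\le k\le t}X_k$, $S^t=\prod_{0\le k\le t}S_k$. The sets of histories $H_t\subseteq X^t\times S^t$ are defined recursively, together with the following data for $t\ge 1$: - for each $i\in I$, a continuous (upper and lower hemicontinuous), nonempty compact valued action correspondence $A_{ti}$ from $H_{t-1}$ to $X_{ti}$; put $A_t=\prod_{i\in I}A_{ti}$; - Nature's move $f_{t0}:H_{t-1}\to\mathcal{M}(S_t)$, continuous, where $\mathcal{M}(\cdot)$ denotes the set of Borel probability measures with the topology of weak convergence; - $H_t=\mathrm{Gr}(A_t)\times S_t$, where $\mathrm{Gr}(A_t)$ is the graph of $A_t$ (coordinates are reordered so that $H_t\subseteq X^t\times S^t$). Perfect information: at each stage $t\ge1$ there is only one mover, who may depend on the history $h_{t-1}$. That is, if $A_{ti}(h_{t-1})$ is not a single point for some $i\in I$ (player $i$ is the mover), then $A_{tj}(h_{t-1})$ is a single point for all $j\in I$, $j\ne i$, and $f_{t0}(h_{t-1})=\delta_{s_t}$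 for some $s_t\in S_t$. If $f_{t0}(h_{t-1})$ is not a Dirac measure (Nature is the mover), then $A_{ti}(h_{t-1})$ is a single point for every $i\in I$. ''Without Nature'' means that Nature has no nontrivial move ($S_t$ is a singleton for all $t\ge1$). $H_\infty$ is the set of $(x,s)\in X^\infty\times S^\infty$ whose truncations satisfy $(x^t,s^t)\in H_t$ for all $t\ge0$, with the product topology. Each payoff function $u_i:H_\infty\to\mathbb{R}$ ($i\in I$) is bounded and continuous, and the game is continuous at infinity: $w^T\to0$ as $T\to\infty$, where $w^T=\sup|u_i(x,s)-u_i(\bar x,\bar s)|$ over all $i\in I$ and $(x,s),(\bar x,\bar s)\in H_\infty$ with $x^{T-1}=\bar x^{T-1}$, $s^{T-1}=\bar s^{T-1}$. **Strategies.** A mixed strategy of player $i\in I$ is a sequence $f_i=\{f_{ti}\}_{t\ge1}$ of Borel measurable maps $f_{ti}:H_{t-1}\to\mathcal{M}(X_{ti})$ with $\operatorname{support}(f_{ti}(\cdot|h_{t-1}))\subseteq A_{ti}(h_{t-1})$ for all $h_{t-1}\in H_{t-1}$, where the support of a measure is the smallest closed set of measure $1$. It is a pure strategy if all $f_{ti}(\cdot|h_{t-1})$ are Dirac measures. A strategy profile is $f=\{f_i\}_{i\in I}$. **Payoffs.** Given a profile $f$ and $h_t\in H_t$ ($t\ge0$), let $\tau_t=\delta_{h_t}$ and, for $t'\ge t$, $\tau_{t'+1}=\tau_{t'}\diamond(\otimes_{i\in I_0}f_{(t'+1)i})$, where $\lambda\diamond\nu(A\times B)=\int_A\nu(B|x)\,\lambda(dx)$.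 Let $\tau\in\mathcal{M}(H_\infty)$ be the unique measure with marginal $\tau_{t'}$ on $H_{t'}$ for all $t'\ge t$. Player $i$'s payoff from $f$ in the subgame beginning at $h_t$ is $\int_{H_\infty}u_i\,d\tau$. **Subgame-perfect equilibrium.** A profile $f$ such that for all $i\in I$, $t\ge0$ and $h_t\in H_t$, player $i$ cannot improve his payoff in the subgame beginning at $h_t$ by a unilateral change of his (mixed) strategy. It is a pure-strategy subgame-perfect equilibrium if, in addition, every $f_i$ is a pure strategy. *)

(* Defs.v *)
From HB Require Import structures.
From mathcomp Require Import all_boot all_order all_algebra.
From mathcomp Require Import all_classical all_reals all_analysis.

Set Implicit Arguments.
Unset Strict Implicit.
Unset Printing Implicit Defensive.

Import Order.TTheory GRing.Theory Num.Theory.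
Import numFieldTopology.Exports numFieldNormedType.Exports.

Local Open Scope classical_set_scope.
Local Open Scope ring_scope.

Section Metrizable.
Context (R : realType) (T : topologicalType).

Definition compatible_metric (d : T -> T -> R) : Prop :=
  [/\ forall x y, d x y = 0 <-> x = y,
      forall x y, d x y = d y x,
      forall x y z, d x z <= d x y + d y z
    & forall x, nbhs x =
        filter_from [set e : R | 0 < e] (fun e => [set y | d x y < e])].

Definition metrizable : Prop := exists d, compatible_metric d.

Definition complete_metric (d : T -> T -> R) : Prop :=
  forall v : nat -> T,
    (forall e, 0 < e -> exists N, forall m k,
       (N <= m)%N -> (N <= k)%N -> d (v m) (v k) < e) ->
    exists l : T, v @ \oo --> l.

Definition polish : Prop :=
  (exists d, compatible_metric d /\ complete_metric d) /\
  (exists D : set T, countable D /\ dense D).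

End Metrizable.

Definition borel (T : ptopologicalType) := g_sigma_algebraType (@open T).
HB.instance Definition _ (T : ptopologicalType) :=
  Measurable.copy (borel T) (g_sigma_algebraType (@open T)).

Definition borel_prob (R : realType) (T : ptopologicalType) :=
  probability (borel T) R.

Definition bounded_continuous (R : realType) (T : topologicalType) :=
  {phi : T -> R | continuous phi /\ bounded_fun phi}.

(* The coarsest topology making every mu |-> \int phi dmu continuous,
   for phi bounded and continuous. *)
Definition weak_prob_topology (R : realType) (T : ptopologicalType) :=
  sup_topology (fun phi : bounded_continuous R T =>
    Topological.class (initial_topology
      (fun mu : borel_prob R T => (\int[mu]_x (sval phi x) : R)))).

(* [weak_prob R T] is [borel_prob R T] with its weak topology. *)
Definition weak_prob (R : realType) (T : ptopologicalType) : Type :=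
  borel_prob R T.
HB.instance Definition _ (R : realType) (T : ptopologicalType) :=
  Topological.copy (weak_prob R T) (@weak_prob_topology R T).
HB.instance Definition _ (R : realType) (T : ptopologicalType) :=
  Pointed.copy (weak_prob R T) (@weak_prob_topology R T).

Section Measures.
Context (R : realType) (T : ptopologicalType).

(* Measures are compared on Borel sets only: the values of a measure on
   non-measurable sets carry no information. *)
Definition is_dirac (mu : borel_prob R T) : Prop :=
  exists x : T, forall B : set (borel T), measurable B ->
    mu B = dirac (x : borel T) B.

Definition msupport (mu : borel_prob R T) : set T :=
  \bigcap_(C in [set C : set T | closed C /\ mu C = 1%E]) C.

End Measures.

(* Hemicontinuity on D, for the subspace topology of D. *)

Section Correspondences.
Context (T U : topologicalType).

Definition upper_hemicontinuous (D : set T) (F : T -> set U) : Prop :=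
  forall x, D x -> forall V : set U, open V -> F x `<=` V ->
    \forall y \near within D (nbhs x), F y `<=` V.

Definition lower_hemicontinuous (D : set T) (F : T -> set U) : Prop :=
  forall x, D x -> forall V : set U, open V -> F x `&` V !=set0 ->
    \forall y \near within D (nbhs x), F y `&` V !=set0.

End Correspondences.

Definition is_singleton (U : Type) (A : set U) : Prop :=
  exists x, A = [set x].

HB.instance Definition _ (I : Type) (T : I -> ptopologicalType) :=
  isPointed.Build (prod_topology T) (fun=> point).
HB.instance Definition _ (T U : ptopologicalType) := Pointed.on (T * U)%type.

(* The players are the elements of ['I_n]; Nature is kept apart.  Stages are
   shifted: [act t i] and [chance t] are the spaces X_{(t+1)i} and S_{t+1} of
   moves made at stage t+1, after a history h_t.  Measurable types are pointed in the
   library, so all the spaces are nonempty; only X_0 * S_0 empty is lost. *)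
Record game_spaces (n : nat) := GameSpaces {
  act0 : ptopologicalType ;
  chance0 : ptopologicalType ;
  act : nat -> 'I_n -> ptopologicalType ;
  chance : nat -> ptopologicalType
}.

Section Plays.
Context (n : nat) (E : game_spaces n).

Definition stage (t : nat) : ptopologicalType :=
  (prod_topology (act E t) * chance E t)%type.

(* X^t * S^t, with the coordinates grouped by stage. *)
Fixpoint hist (t : nat) : ptopologicalType :=
  match t with
  | 0 => (act0 E * chance0 E)%type : ptopologicalType
  | t'.+1 => (hist t' * stage t')%type : ptopologicalType
  end.

(* X^oo * S^oo, with the coordinates grouped by stage. *)
Definition play : ptopologicalType :=
  ((act0 E * chance0 E) * prod_topology stage)%type.

Fixpoint trunc (t : nat) (w : play) : hist t :=
  match t return hist t with
  | 0 => w.1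
  | t'.+1 => (trunc t' w, w.2 t')
  end.

End Plays.

(* [action t i], [nature t] and [payoff_fun i] stand for A_{(t+1)i}, f_{(t+1)0}
   and u_i; they are meaningful on [Hist t], [Hist t] and [Hinf] only. *)
Record game (R : realType) (n : nat) := Game {
  spaces :> game_spaces n ;
  action : forall (t : nat) (i : 'I_n), hist spaces t -> set (act spaces t i) ;
  nature : forall t : nat, hist spaces t -> borel_prob R (chance spaces t) ;
  payoff_fun : 'I_n -> play spaces -> R
}.

Arguments action {R n g t} i h.
Arguments nature {R n g t} h.
Arguments payoff_fun {R n} g i w.

Section Game.
Context (R : realType) (n : nat) (G : game R n).

Fixpoint Hist (t : nat) : set (hist G t) :=
  match t return set (hist G t) with
  | 0 => setT
  | t'.+1 => [set h : hist G t'.+1 | Hist h.1 /\ forall i, action i h.1 (h.2.1 i)]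
  end.

Definition Hinf : set (play G) := [set w | forall t, Hist (trunc t w)].

(* w^T; agreement of the truncations of all orders k < T is agreement up to
   T - 1. *)
Definition tail_oscillation (T : nat) : R :=
  sup [set r | exists i w w', [/\ Hinf w, Hinf w',
    forall k, (k < T)%N -> trunc k w = trunc k w'
    & r = `|payoff_fun G i w - payoff_fun G i w'| ] ].

Definition continuous_at_infinity : Prop :=
  tail_oscillation @ \oo --> (0 : R).

Definition perfect_information : Prop :=
  forall t (h : hist G t), Hist h ->
    (forall i, ~ is_singleton (action i h) ->
       (forall j, j != i -> is_singleton (action j h)) /\
       is_dirac (nature h)) /\
    (~ is_dirac (nature h) -> forall i, is_singleton (action i h)).

Record is_dynamic_game : Prop := IsDynamicGame {
  act0_metrizable : metrizable R (act0 G) ;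
  act0_compact : compact [set: act0 G] ;
  chance0_polish : polish R (chance0 G) ;
  act_polish : forall t i, polish R (act G t i) ;
  chance_polish : forall t, polish R (chance G t) ;
  action_uhc : forall t i, upper_hemicontinuous (@Hist t) (action i) ;
  action_lhc : forall t i, lower_hemicontinuous (@Hist t) (action i) ;
  action_nonempty : forall t i (h : hist G t), Hist h -> action i h !=set0 ;
  action_compact : forall t i (h : hist G t), Hist h -> compact (action i h) ;
  nature_continuous : forall t,
    {within @Hist t, continuous
      (nature : hist G t -> weak_prob R (chance G t))} ;
  payoff_bounded : forall i, [bounded payoff_fun G i w | w in Hinf] ;
  payoff_continuous : forall i, {within Hinf, continuous (payoff_fun G i)} ;
  game_continuous_at_infinity : continuous_at_infinity
}.

(* [f t] is f_{(t+1)i}, meaningful on [Hist t] only. *)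
Definition strategy (i : 'I_n) : Type :=
  forall t : nat, hist G t -> borel_prob R (act G t i).

Definition is_mixed_strategy (i : 'I_n) (f : strategy i) : Prop :=
  forall t,
    measurable_fun (@Hist t : set (borel (hist G t)))
      (@f t : borel (hist G t) -> borel (weak_prob R (act G t i))) /\
    forall h : hist G t, Hist h -> msupport (f t h) `<=` action i h.

Definition is_pure_strategy (i : 'I_n) (f : strategy i) : Prop :=
  is_mixed_strategy f /\ forall t (h : hist G t), Hist h -> is_dirac (f t h).

Definition profile : Type := forall i : 'I_n, strategy i.

Definition deviate (f : profile) (i : 'I_n) (g : strategy i) : profile :=
  @dfwith 'I_n strategy f i g.

Definition marginal (tau : borel_prob R (play G)) (t : nat) :
    set (borel (hist G t)) -> \bar R :=
  pushforward tau (@trunc n G t : borel (play G) -> borel (hist G t)).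

(* The measure tau on H_oo induced by f from h onwards.  The last clause says
   tau_{k+1} = tau_k <> (\otimes_i f_{(k+1)i}), i ranging over the players and
   Nature: by definition of <> and of the product measure, this is the equality
   on the measurable boxes B * (\prod_i C_i * D). *)
Definition is_outcome (f : profile) (t : nat) (h : hist G t)
    (tau : borel_prob R (play G)) : Prop :=
  [/\ tau Hinf = 1%E,
      forall B : set (borel (hist G t)), measurable B ->
        marginal tau B = dirac (h : borel (hist G t)) B
    & forall k, (t <= k)%N ->
        forall (B : set (borel (hist G k)))
               (C : forall i, set (borel (act G k i)))
               (D : set (borel (chance G k))),
        measurable B -> (forall i, measurable (C i)) -> measurable D ->
        @marginal tau k.+1 (B `*` ([set x | forall i, C i (x i)] `*` D)) =
        (\int[@marginal tau k]_(h' in B `&` @Hist k)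
          ((\prod_(i < n) fine (f i k h' (C i))) * fine (nature h' D))%:E)%E].

(* The outcome exists by the Ionescu-Tulcea theorem, and is unique up to its
   values on non-measurable sets. *)
Definition outcome (f : profile) (t : nat) (h : hist G t) :
    borel_prob R (play G) :=
  get (is_outcome f h).

Definition payoff (i : 'I_n) (f : profile) (t : nat) (h : hist G t) : R :=
  \int[outcome f h]_(w in Hinf) payoff_fun G i w.

Definition subgame_perfect (f : profile) : Prop :=
  (forall i, is_mixed_strategy (f i)) /\
  forall i t (h : hist G t), Hist h ->
  forall g : strategy i, is_mixed_strategy g ->
    payoff i (deviate f g) h <= payoff i f h.

Definition pure_subgame_perfect (f : profile) : Prop :=
  subgame_perfect f /\ forall i, is_pure_strategy (f i).

End Game.

Definition zero_sum (R : realType) (G : game R 2) : Prop :=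
  forall w, Hinf w -> payoff_fun G ord0 w + payoff_fun G ord_max w = 0.

(* Main.v *)
(* By perfect information a single mover chooses at each stage, so at every
   stage the maxmin and the minmax of the expected continuation value coincide.
   Truncate the game m stages after the history h, and let the tail be settled
   in favour of player i: the resulting value U_m(h) is lower semicontinuous in
   h (suprema over lower hemicontinuous correspondences, infima over compact
   upper hemicontinuous ones and integrals against weakly continuous kernels
   preserve lower semicontinuity), it decreases with m, and the two players'
   versions add up to at most the oscillation of the tail.  Continuity at
   infinity gives values v_1 = - v_2, both lower semicontinuous, hence
   continuous, which solve the stage equations.  Measurable selections s_i of
   the maximizers of the guaranteed stage value form the equilibrium: if the
   opponent of i plays s, the values v_i along the play are a supermartingale
   whatever i does, and they converge uniformly to the payoff of i, which is
   therefore at most v_i(h) in the subgame at h.  For the profile s itself the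
   two payoffs add up to 0 = v_1(h) + v_2(h), so these bounds are equalities.

   The measure of a subgame is only specified by its finite-dimensional
   transitions; it exists by the Ionescu-Tulcea theorem. *)

From HB Require Import structures.
From mathcomp Require Import all_boot all_order all_algebra.
From mathcomp Require Import all_classical all_reals all_analysis.
From mathcomp Require Import measurable_realfun kernel.
From mathcomp Require Import ring lra zify.
Require Import Defs.

Set Implicit Arguments.
Unset Strict Implicit.
Unset Printing Implicit Defensive.

Import Order.TTheory GRing.Theory Num.Theory.
Import numFieldTopology.Exports numFieldNormedType.Exports.

Local Open Scope classical_set_scope.
Local Open Scope ring_scope.

(** * Countable subbases and Borel sets *)

(** The obstacle is measurability rather than optimization. Strategies must be Borel maps into
    spaces of measures, histories carry the Borel sets of a product topology, and correspondences
    are continuous only relative to [Hist]. Second countability, kept as a countable subbase,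
    reconciles these Borel sets with coordinatewise measurability. Selections come from minimizing
    one injective lower semicontinuous function: injectivity makes the minimizer unique, and
    rational levels describe its preimages of open sets. Semicontinuity of integrals under weak
    convergence uses Lipschitz minorants that are uniform over a neighbourhood of the parameter.
    Since only one player deviates from a pure profile, a transition is an integral over the
    deviator's action and one over Nature's move, all other actions being fixed by the history. The
    payoff bound holds for every measure satisfying [is_outcome], so it applies to the one that
    [outcome] picks once existence is known. *)

Definition subbase (T : topologicalType) (u : nat -> set T) : Prop :=
  (forall n, open (u n)) /\
  forall x A, nbhs x A -> exists s : seq nat,
    (forall n, n \in s -> u n x) /\
    forall y, (forall n, n \in s -> u n y) -> A y.

(** Second countability in a form that passes to countable products. It makes a map into a product
    Borel measurable as soon as its coordinates are. *)
Definition countable_subbase (T : topologicalType) : Prop :=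
  exists u : nat -> set T, subbase u.

(** The index set [seq nat] is countable, so this presents an open set as a countable union of
    finite intersections of members of the subbase. *)
Lemma subbase_open (T : topologicalType) (u : nat -> set T) (O : set T) :
  subbase u -> open O ->
  O = \bigcup_(s in [set s : seq nat |
         forall y, (forall n, n \in s -> u n y) -> O y])
        [set y | forall n, n \in s -> u n y].
Proof.
move=> [_ uO] oO; apply/seteqP; split=> [x Ox|x [s /= sO /sO]//].
have [s [sx sO]] := uO x O (open_nbhs_nbhs (conj oO Ox)).
by exists s.
Qed.

Lemma bigcup_countable_nat (W : Type) (I : countType) (P : set I) (F : I -> set W) :
  \bigcup_(i in P) F i =
  \bigcup_n (if @unpickle I n is Some i then [set x | P i /\ F i x] else set0).
Proof.
apply/seteqP; split=> [x [i Pi Fx]|x [n _]]; last first.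
  by case: unpickle => // i [Pi Fx]; exists i.
by exists (pickle i) => //; rewrite pickleK.
Qed.

Lemma bigcup_countable_measurable d (W : sigmaRingType d) (I : countType)
    (P : set I) (F : I -> set W) :
  (forall i, P i -> measurable (F i)) -> measurable (\bigcup_(i in P) F i).
Proof.
move=> mF; rewrite bigcup_countable_nat.
apply: bigcup_measurable => n _; case: unpickle => // i.
have [Pi|nPi] := pselect (P i).
  by rewrite (_ : [set _ | _] = F i)//; [exact: mF|apply/seteqP; split=> x // []].
by rewrite (_ : [set _ | _] = set0)//; apply/seteqP; split=> x // [].
Qed.

Lemma subbase_measurable_fun d (W : measurableType d) (T : ptopologicalType)
    (u : nat -> set T) (D : set W) (f : W -> borel T) :
  subbase u -> (forall n, measurable (D `&` f @^-1` u n)) ->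
  measurable_fun D f.
Proof.
move=> us mu mD; apply: (measurability (@open T : set (set (borel T)))) => //.
move=> _ [V oV <-].
rewrite (subbase_open us oV) preimage_bigcup setI_bigcupr.
apply: bigcup_countable_measurable => s _; elim: s => [|n s IH].
  rewrite (_ : _ `&` _ = D)//.
  by apply/seteqP; split=> [x []//|x Dx]; split.
rewrite (_ : _ `&` _ = (D `&` f @^-1` u n) `&`
   (D `&` f @^-1` [set y | forall n, n \in s -> u n y])).
  exact: measurableI.
apply/seteqP; split=> [x [Dx /= H]|x [[Dx /= H1] [_ H2]]].
  split; split=> //=; first by apply: H; rewrite mem_head.
  by move=> m ms; apply: H; rewrite inE ms orbT.
by split=> // m; rewrite inE => /orP[/eqP->//|/H2].
Qed.

Lemma borel_open (T : ptopologicalType) (O : set T) :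
  open O -> measurable (O : set (borel T)).
Proof. exact: sub_sigma_algebra. Qed.

Lemma borel_closed (T : ptopologicalType) (C : set T) :
  closed C -> measurable (C : set (borel T)).
Proof.
move=> /closed_openC/borel_open/measurableC; rewrite setCK; exact.
Qed.

Lemma continuous_borel_measurable (T U : ptopologicalType) (f : T -> U) :
  continuous f -> measurable_fun setT (f : borel T -> borel U).
Proof.
move=> /continuousP cf; apply: (measurability (@open U : set (set (borel U)))) => //.
by move=> _ [V oV <-]; rewrite setTI; exact: borel_open (cf _ oV).
Qed.

Lemma subbase_pair (T U : topologicalType) (u : nat -> set T) (v : nat -> set U) :
  subbase u -> subbase v ->
  subbase (fun n => if odd n then fst @^-1` u n./2 else snd @^-1` v n./2 :
                    set (T * U)).
Proof.
move=> [uo ub] [vo vb]; split=> [n|[x y] A [[P Q] /= [xP yQ] PQA]].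
  by case: ifP => _; apply: open_comp => // z _; [exact: cvg_fst|exact: cvg_snd].
have [s [sx sP]] := ub _ _ xP; have [t [ty tQ]] := vb _ _ yQ.
exists ([seq n.*2.+1 | n <- s] ++ [seq n.*2 | n <- t]); split=> [n|[x' y'] H].
  rewrite mem_cat => /orP[/mapP[m ms ->]|/mapP[m mt ->]] /=.
    by rewrite odd_double /= uphalf_double; exact: sx.
  by rewrite odd_double doubleK; exact: ty.
apply: PQA; split=> /=; [apply: sP|apply: tQ] => n ns.
  have /= := H n.*2.+1; rewrite odd_double /= uphalf_double; apply.
  by rewrite mem_cat map_f.
have /= := H n.*2; rewrite odd_double doubleK; apply.
by rewrite mem_cat map_f ?orbT.
Qed.

Lemma measurable_fun_borel_pair d (W : measurableType d) (T U : ptopologicalType)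
    (D : set W) (f : W -> borel T) (g : W -> borel U) :
  countable_subbase T -> countable_subbase U ->
  measurable_fun D f -> measurable_fun D g ->
  measurable_fun D (fun w => (f w, g w) : borel (T * U)%type).
Proof.
move=> [u us] [v vs] mf mg mD.
apply: (subbase_measurable_fun (subbase_pair us vs)) => // n.
case: ifP => _; [apply: mf|apply: mg] => //; apply: borel_open.
- by case: us.
- by case: vs.
Qed.

Definition prod_subbase (I : countType) (T : I -> topologicalType)
    (u : forall i, nat -> set (T i)) (n : nat) : set (prod_topology T) :=
  if unpickle n is Some im then [set f : prod_topology T | u im.1 im.2 (f im.1)] else setT.

Lemma subbase_prod_topology (I : countType) (T : I -> topologicalType)
    (u : forall i, nat -> set (T i)) :
  (forall i, subbase (u i)) -> subbase (prod_subbase u).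
Proof.
move=> us; split=> [n|f A].
  rewrite /prod_subbase; case: unpickle => [[i m]|]; last exact: openT.
  have -> : [set g : prod_topology T | u (i, m).1 (i, m).2 (g (i, m).1)] =
     (@proj I T i) @^-1` u i m by [].
  by apply: open_comp => [z _|]; [exact: proj_continuous|case: (us i)].
(* The product topology is the supremum of the topologies induced by the coordinates. Once [F] is
   known to be a filter, [cvg_sup] leaves only neighbourhoods that constrain a single coordinate. *)
pose F := [set A : set (prod_topology T) | exists s : seq nat,
  (forall n, n \in s -> prod_subbase u n f) /\
  forall y, (forall n, n \in s -> prod_subbase u n y) -> A y].
suff FP : F `=>` nbhs f by apply: FP.
have FF : Filter F.
  split; first by exists [::].
    move=> P Q [s [sf sP]] [t [tf tQ]]; exists (s ++ t); split=> [n|y H].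
      by rewrite mem_cat => /orP[/sf|/tf].
    by split; [apply: sP|apply: tQ] => n ns; apply: H; rewrite mem_cat ns ?orbT.
  by move=> P Q PQ [s [sf sP]]; exists s; split=> // y /sP /PQ.
apply/cvg_sup => i P; rewrite nbhsE /= => -[Q [[V oV VQ] Qf] QP].
have Vf : V (f i) by rewrite -VQ in Qf.
have [s [sf sV]] := (us i).2 (f i) V (open_nbhs_nbhs (conj oV Vf)).
exists [seq pickle (i, m) | m <- s]; split=> [n /mapP[m ms ->]|y H].
  by rewrite /prod_subbase pickleK; exact: sf.
apply: QP; rewrite -VQ; apply: sV => m ms.
by have := H (pickle (i, m)); rewrite /prod_subbase pickleK; apply; exact: map_f.
Qed.

Lemma measurable_fun_borel_prod_topology d (W : measurableType d) (I : countType)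
    (T : I -> ptopologicalType) (D : set W) (f : W -> borel (prod_topology T)) :
  (forall i, countable_subbase (T i)) ->
  (forall i, measurable_fun D (fun w => f w i : borel (T i))) ->
  measurable_fun D f.
Proof.
move=> cT mf mD; pose u i := sval (cid (cT i)).
have us i : subbase (u i) := svalP (cid (cT i)).
apply: (subbase_measurable_fun (subbase_prod_topology us)) => // n.
rewrite /prod_subbase; case: unpickle => [[i m]|]; last by rewrite setIT.
exact: mf (borel_open ((us i).1 m)).
Qed.

Lemma countable_subbase_pair (T U : topologicalType) :
  countable_subbase T -> countable_subbase U -> countable_subbase (T * U)%type.
Proof. by move=> [u us] [v vs]; eexists; exact: subbase_pair us vs. Qed.

Lemma countable_subbase_prod_topology (I : countType) (T : I -> topologicalType) :
  (forall i, countable_subbase (T i)) -> countable_subbase (prod_topology T).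
Proof.
move=> cT; pose u i := sval (cid (cT i)).
have us i : subbase (u i) := svalP (cid (cT i)).
by exists (prod_subbase u); exact: subbase_prod_topology.
Qed.

(** Supplies the decreasing sequence of neighbourhoods along which the envelopes of
    [integral_lsc_at] increase; sequences are what dominated convergence can handle. *)
Lemma subbase_nbhs_basis (T : topologicalType) (x : T) :
  countable_subbase T -> exists O : nat -> set T,
  [/\ forall k, nbhs x (O k), forall k, O k.+1 `<=` O k &
      forall A, nbhs x A -> exists k, O k `<=` A].
Proof.
move=> [u [uo ub]].
exists (fun k => [set y | forall n, (n < k)%N -> u n x -> u n y]); split.
- elim=> [|k IH]; first by apply: filterE => y n; rewrite ltn0.
  have : nbhs x [set y | u k x -> u k y].
    have [ukx|nukx] := pselect (u k x); last by apply: filterE => y /= /nukx.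
    by apply: filterS _ (open_nbhs_nbhs (conj (uo k) ukx)) => y uky _.
  move: IH; apply: filterS2 => y H Hk n; rewrite ltnS leq_eqVlt => /orP[/eqP->//|nk unx].
  exact: H nk unx.
- by move=> k y H n nk; apply: H; exact: ltnW.
- move=> A /ub[s [sx sA]]; exists (\max_(n <- s) n).+1 => y H.
  by apply: sA => n ns; apply: H (sx _ ns); rewrite ltnS; exact: leq_bigmax_seq.
Qed.

(** * Metric spaces and second countability *)

Section Metric.
Context (R : realType) (T : topologicalType) (d : T -> T -> R).
Hypothesis dT : compatible_metric d.

Lemma metric_refl x : d x x = 0.
Proof. by have [/(_ x x)[_ ->]] := dT. Qed.

Lemma metric_sym x y : d x y = d y x.
Proof. by case: dT. Qed.

Lemma metric_triangle x y z : d x z <= d x y + d y z.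
Proof. by case: dT. Qed.

Lemma metric_ge0 x y : 0 <= d x y.
Proof.
have := metric_triangle x y x; rewrite metric_refl (metric_sym y x) -mulr2n.
by rewrite pmulrn_lge0.
Qed.

Lemma metric_nbhsP x A : nbhs x A <-> exists2 e, 0 < e & forall y, d x y < e -> A y.
Proof. by case: dT => _ _ _ ->; split=> -[e e0 H]; exists e. Qed.

Lemma metric_ball_open x e : open [set y | d x y < e].
Proof.
rewrite openE => y /= xy; apply/metric_nbhsP; exists (e - d x y).
  by rewrite subr_gt0.
by move=> z yz /=; rewrite (le_lt_trans (metric_triangle x y z))// -ltrBrDl.
Qed.

Lemma metric_hausdorff : hausdorff_space T.
Proof.
move=> x y xy; have [/(_ x y)[+ _] _ _ _] := dT; apply.
apply/eqP; apply: contrapT => /negP dxy.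
have dxy0 : 0 < d x y by rewrite lt_neqAle eq_sym dxy metric_ge0.
have nb z : nbhs z [set t | d z t < d x y / 2].
  by apply/metric_nbhsP; exists (d x y / 2) => //; rewrite divr_gt0.
have [z [/= zx zy]] := xy _ _ (nb x) (nb y).
have := metric_triangle x z y; rewrite (metric_sym z y) leNgt => /negP; apply.
by rewrite [ltRHS]splitr ltrD.
Qed.

Lemma dense_countable_subbase (D : set T) :
  countable D -> dense D -> countable_subbase T.
Proof.
move=> /countable_injP[f finj] dD.
(* Balls of radius 1/(m+1) around points of [D], whose centres are named by their image [a] under
   the injection [f]. *)
exists (fun n => if unpickle n is Some (a, m) then
  [set y | exists x, [/\ D x, f x = a & d x y < (m : nat).+1%:R^-1]] else setT).
split=> [n|x A].
  case: unpickle => [[a m]|]; last exact: openT.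
  rewrite openE => y [x [Dx fx xy]].
  apply: filterS _ (open_nbhs_nbhs (conj (metric_ball_open x _) xy)) => z /= xz.
  by exists x.
move=> /metric_nbhsP[e e0 eA].
have [m me] : exists m : nat, m.+1%:R^-1 < e / 2.
  have e20 : 0 < e / 2 by rewrite divr_gt0.
  have [m _ mP] := near_infty_natSinv_lt (PosNum e20).
  by exists m; exact: mP (leqnn m).
have [|z [/= xz Dz]] := dD [set y | d x y < m.+1%:R^-1] _ (metric_ball_open x _).
  by exists x => /=; rewrite metric_refl invr_gt0.
exists [:: pickle (f z, m)]; split=> [n|y /(_ _ (mem_head _ _))].
  rewrite inE => /eqP ->; rewrite pickleK; exists z; split=> //.
  by rewrite metric_sym.
rewrite pickleK => -[z' [Dz' fz' z'y]].
have zz' : z' = z by apply: finj; rewrite ?inE.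
apply: eA; rewrite zz' in z'y; apply: le_lt_trans (metric_triangle x z y) _.
by rewrite (splitr e) ltrD// (lt_trans _ me).
Qed.

End Metric.

(** Finite nets of mesh 1/(m+1), taken together over all m, form a countable dense set. This covers
    [act0], which is given as compact metrizable rather than Polish. *)
Lemma compact_countable_subbase (R : realType) (T : ptopologicalType)
    (d : T -> T -> R) :
  compatible_metric d -> compact [set: T] -> countable_subbase T.
Proof.
move=> dT; rewrite compact_cover => cT.
have fin m : exists D : seq T, forall x, exists2 a, a \in D & d a x < m.+1%:R^-1.
  have [||D _ DT] := cT T setT (fun a => [set y | d a y < m.+1%:R^-1]).
  - by move=> a _; exact: (metric_ball_open dT).
  - by move=> x _; exists x => //=; rewrite (metric_refl dT) invr_gt0.
  by exists (finmap.enum_fset D) => x; have [a aD ax] := DT x I; exists a.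
have [D DP] := boolp.choice fin.
apply: (dense_countable_subbase dT (D := \bigcup_m [set` D m])).
  by apply: bigcup_countable => // m _; exact: finite_set_countable (finite_seq _).
move=> V [x Vx] oV.
have /(metric_nbhsP dT)[e e0 eV] := open_nbhs_nbhs (conj oV Vx).
have [m _ mP] := near_infty_natSinv_lt (PosNum e0).
have [a aD ax] := DP m x; exists a; split; last by exists m.
by apply: eV; rewrite (metric_sym dT) (lt_trans ax)// mP /=.
Qed.

(** The support is an intersection of possibly uncountably many closed sets, but its complement is
    the union of the null sets among countably many basic open sets. *)
Lemma msupport_full (R : realType) (T : ptopologicalType) (mu : borel_prob R T) :
  countable_subbase T -> mu (msupport mu) = 1%E.
Proof.
move=> [u [uo ub]]; pose B (s : seq nat) := [set y | forall n, n \in s -> u n y].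
have oB s : open (B s).
  rewrite /B; elim: s => [|n s IH].
    by rewrite [X in open X](_ : _ = setT)//; [exact: openT|apply/seteqP; split].
  rewrite [X in open X](_ : _ = u n `&` [set y | forall m, m \in s -> u m y]).
    exact: openI.
  apply/seteqP; split=> [y /= H|y [uny H] m].
    by split=> [|m ms]; apply: H; rewrite inE ?eqxx// ms orbT.
  by rewrite inE => /orP[/eqP->//|/H].
have mB s : measurable (B s : set (borel T)) by exact: borel_open.
have E : ~` msupport mu = \bigcup_(s in [set s | mu (B s) = 0%E]) B s.
  apply/seteqP; split=> [x|x [s /= Bs0 Bsx]].
    rewrite /msupport setC_bigcap => -[C /= [cC muC] nCx].
    have [s [sx sC]] := ub x (~` C) (open_nbhs_nbhs (conj (closed_openC cC) nCx)).
    exists s => //=; apply/eqP; rewrite eq_le measure_ge0 andbT.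
    have <- : mu (~` C) = 0%E.
      by rewrite probability_setC ?muC ?subee//; exact: (borel_closed cC).
    by apply: le_measure; rewrite ?inE//; exact: measurableC (borel_closed cC).
  move=> /(_ (~` B s)) /=; apply=> //; split; first exact: open_closedC.
  by rewrite probability_setC// Bs0 sube0.
rewrite -(setCK (msupport mu)) probability_setC E.
  rewrite (_ : mu _ = 0%E) ?sube0//.
  apply/negligibleP; first exact: bigcup_countable_measurable.
  rewrite bigcup_countable_nat; apply: negligible_bigcup => n.
set s := pmap _ _.
  have [Bs0|Bs0] := pselect (mu (B s) = 0%E).
    by apply: (negligibleS (mu := mu) (A := B s)); [move=> x []|exact/negligibleP].
  by apply: (negligibleS (mu := mu) (A := set0)); [move=> x []|exact: negligible_set0].
exact: bigcup_countable_measurable.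
Qed.

(** * Lower semicontinuity and measurable selection *)

Definition lsc_on (R : realType) (T : topologicalType) (D : set T) (V : T -> R) :=
  forall x, D x -> forall a, a < V x -> \forall y \near within D (nbhs x), a < V y.

Definition graph_on (Z X : Type) (D : set Z) (F : Z -> set X) : set (Z * X) :=
  [set p | D p.1 /\ F p.1 p.2].

(** A tube lemma for correspondences: compactness of [F z] yields one neighbourhood of [z] and one
    open set around [F z] on which [P] holds, and upper hemicontinuity keeps the nearby values
    inside that open set. *)
Lemma uhc_tube (Z X : topologicalType) (D : set Z) (F : Z -> set X) (z : Z)
    (P : set (Z * X)) :
  upper_hemicontinuous D F -> D z -> compact (F z) ->
  (forall x, F z x ->
    \forall p \near within (graph_on D F) (nbhs (z, x)), P p) ->
  \forall z' \near within D (nbhs z), forall x, F z' x -> P (z', x).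
Proof.
move=> uF Dz /compact_near_coveringP cF FP.
pose good (O : set Z) (x : X) := \forall x' \near x,
  forall z', O z' -> graph_on D F (z', x') -> P (z', x').
have : \forall O \near powerset_filter_from (nbhs z), F z `<=` good O.
  apply: cF => x /FP; rewrite near_withinE => -[[B N] /= [Bz Nx] BNP].
  exists (N^°, [set Q | Q `<=` B]) => /=.
    by split; [exact: nbhs_interior|exact: small_set_sub].
  move=> [x' Q] [/= Nx' QB]; rewrite /good.
  apply: filterS _ Nx' => x'' Nx'' z' /QB Bz'; exact: (BNP (z', x'')).
rewrite near_powerset_filter_fromP; last first.
  move=> A B AB Bg x /Bg; apply: filterS => x' H z' /AB; exact: H.
move=> [B Bz Bg].
have gB : F z `<=` (good B)^° by move=> x /Bg; exact: nbhs_interior.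
have := uF z Dz _ (open_interior _) gB.
rewrite !near_withinE; move: Bz; apply: filterS2 => z' Bz' FV Dz' x Fx.
have /nbhs_singleton := interior_subset (FV Dz' x Fx).
by apply.
Qed.

Section Optimum.
Context (R : realType) (Z X : topologicalType) (D : set Z) (F : Z -> set X).
Context (W : Z * X -> R).
Hypothesis lscW : lsc_on (graph_on D F) W.

Lemma sup_lsc (M : R) : lower_hemicontinuous D F ->
  (forall z, D z -> F z !=set0) ->
  (forall z x, D z -> F z x -> W (z, x) <= M) ->
  lsc_on D (fun z => sup [set W (z, x) | x in F z]).
Proof.
move=> lF F0 WM z Dz a /sup_gt[|_ [x Fx <-] aW].
  by have [x Fx] := F0 _ Dz; exists (W (z, x)); exists x.
have := lscW (conj Dz Fx : graph_on D F (z, x)) aW.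
rewrite near_withinE => -[[B N] /= [Bz Nx] BN].
have := lF z Dz N^° (open_interior _) (ex_intro _ x (conj Fx Nx)).
rewrite !near_withinE; move: Bz; apply: filterS2 => z' Bz' + Dz' => /(_ Dz')[x' [Fx' Nx']].
apply: (@lt_le_trans _ _ (W (z', x'))).
  by apply: BN; [split=> //; exact: interior_subset|split].
by apply: ub_le_sup; [exists M => _ [y Fy <-]; exact: WM|exists x'].
Qed.

Lemma inf_lsc : upper_hemicontinuous D F ->
  (forall z, D z -> F z !=set0) -> (forall z, D z -> compact (F z)) ->
  (forall z, D z -> has_lbound [set W (z, x) | x in F z]) ->
  lsc_on D (fun z => inf [set W (z, x) | x in F z]).
Proof.
(* The midpoint [b] leaves room: values above [b] only give an infimum that is at least [b], and the
   conclusion is strict. *)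
move=> uF F0 cF Wlb z Dz a /midf_lt[]; set b := (X in a < X) => ab bi.
have near_b x : F z x ->
    \forall p \near within (graph_on D F) (nbhs (z, x)), b < W p.
  move=> Fx; apply: lscW => //; apply: lt_le_trans bi _.
  by apply: ge_inf; [exact: Wlb|exists x].
have := uhc_tube uF Dz (cF _ Dz) near_b.
rewrite !near_withinE; apply: filterS => z' bW Dz'; apply: lt_le_trans ab _.
apply: lb_le_inf; first by have [x Fx] := F0 _ Dz'; exists (W (z', x)); exists x.
by move=> _ [x Fx <-]; exact/ltW/(bW Dz').
Qed.

End Optimum.

(** Without a minimizer, the sublevel sets generate a filter for which compactness produces a point
    [i] of [K] with [V i] below every value of [V] on [K], its own included. *)
Lemma lsc_attains_min (R : realType) (X : topologicalType) (K : set X) (V : X -> R) :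
  compact K -> K !=set0 -> lsc_on K V ->
  exists2 x, K x & forall y, K y -> V x <= V y.
Proof.
move=> /compact_near_coveringP/near_covering_withinP cK [x0 Kx0] lV.
apply: contrapT => noMin.
have lower x : K x -> exists2 y, K y & V y < V x.
  move=> Kx; apply: contrapT => H; apply: noMin; exists x => // y Ky.
  by rewrite leNgt; apply/negP => yx; apply: H; exists y.
pose F := filter_from K (fun y0 => [set y | K y /\ V y <= V y0]).
have FF : ProperFilter F.
  apply: filter_from_proper; last by move=> y Ky; exists y.
  apply: filter_from_filter; first by exists x0.
  move=> i j Ki Kj; have [ij|/ltW ji] := leP (V i) (V j); [exists i|exists j] => //.
    by move=> y [Ky yi]; split; split => //; exact: le_trans ij.
  by move=> y [Ky yi]; split; split => //; exact: le_trans ji.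
have /cK : forall x, K x -> \forall x' \near x & i \near F, K x' -> V i < V x'.
  move=> x Kx; have [y Ky yx] := lower x Kx.
  have := lV x Kx _ yx; rewrite near_withinE => H.
  exists ([set x' | K x' -> V y < V x'], [set i | K i /\ V i <= V y]) => /=.
    by split=> //; exists y.
  by move=> [x' i] [/= H1 [_ iy]] /H1; exact: le_lt_trans.
case=> [i Ki iP]; have := iP i (conj Ki (lexx _)) i Ki.
by rewrite ltxx.
Qed.

Lemma lsc_closed (R : realType) (X : topologicalType) (V : X -> R) (a : R) :
  lsc_on setT V -> closed [set x | V x <= a].
Proof.
move=> lV; rewrite -openC openE => x /= /negP; rewrite -ltNge => ax.
have := lV x I _ ax; rewrite near_withinE; apply: filterS => y /(_ I) ay.
by apply/negP; rewrite -ltNge.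
Qed.

Lemma lsc_onS (R : realType) (T : topologicalType) (D D' : set T) (V : T -> R) :
  D' `<=` D -> lsc_on D V -> lsc_on D' V.
Proof.
move=> DD lV x /DD Dx a /(lV x Dx); rewrite !near_withinE.
by apply: filterS => y H /DD.
Qed.

(** * An injective lower semicontinuous function *)

Section Separation.
Context (R : realType) (X : topologicalType) (u : nat -> set X).

(* The base is 3 so that a digit outweighs all the following ones. *)
Definition digit_sum (n : nat) (x : X) : R :=
  \sum_(k < n) (if `[< u k x >] then 3^-1 ^+ k else 0).

(** The sum of the series, as a supremum of partial sums: each partial sum is lower semicontinuous
    because the members of the subbase are open, and a supremum preserves this. *)
Definition separating (x : X) : R := sup (range (digit_sum^~ x)).

Let digit_ge0 k x : 0 <= (if `[< u k x >] then 3^-1 ^+ k else 0 : R).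
Proof. by case: ifP => // _; rewrite exprn_ge0// invr_ge0. Qed.

(** The term [3^-1 ^+ n * (3 / 2)] is the sum of all powers of 1/3 from exponent n on, that is, the
    most that the remaining digits can add. *)
Let digit_sum_tail n m x : digit_sum (n + m) x + 3^-1 ^+ (n + m) * (3 / 2) <=
  digit_sum n x + 3^-1 ^+ n * (3 / 2).
Proof.
elim: m => [|m IH]; first by rewrite addn0.
apply: le_trans IH; rewrite addnS /digit_sum big_ord_recr/= -addrA lerD2l.
have : 0 <= (3^-1 : R) ^+ (n + m) by rewrite exprn_ge0// invr_ge0.
by rewrite exprS; case: ifP => _; set e := _ ^+ _; lra.
Qed.

Let digit_sum_le n m x : digit_sum n x <= digit_sum (n + m) x.
Proof.
elim: m => [|m IH]; first by rewrite addn0.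
by apply: le_trans IH _; rewrite addnS /digit_sum [leRHS]big_ord_recr/= lerDl.
Qed.

Let digit_sum_ub n x : ubound (range (digit_sum^~ x)) (digit_sum n x + 3^-1 ^+ n * (3 / 2)).
Proof.
move=> _ [k _ <-]; have p m : 0 <= (3^-1 : R) ^+ m * (3 / 2).
  by rewrite mulr_ge0// exprn_ge0// invr_ge0.
have [kn|/ltnW nk] := leqP k n.
  by rewrite -(subnKC kn) (le_trans (digit_sum_le k (n - k) x))// lerDl.
by apply: le_trans (digit_sum_tail n (k - n) x); rewrite subnKC// lerDl.
Qed.

Lemma separating_lsc : (forall n, open (u n)) -> lsc_on setT separating.
Proof.
move=> uo x _ a /sup_gt[|_ [n _ <-] an]; first by exists (digit_sum 0 x); exists 0.
rewrite near_withinE.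
have : \forall y \near x, digit_sum n x <= digit_sum n y.
  elim: {an}n => [|n IH]; first by apply: nearW => y; rewrite /digit_sum !big_ord0.
  have uy : \forall y \near x, u n x -> u n y.
    have [unx|nunx] := pselect (u n x); last by apply: nearW => y /nunx.
    by apply: filterS _ (open_nbhs_nbhs (conj (uo n) unx)) => y uny _.
  move: IH uy; apply: filterS2 => y xy uxy.
  rewrite /digit_sum big_ord_recr/= [leRHS]big_ord_recr/= lerD//.
  by case: ifPn => [/asboolP/uxy uny|_]; [rewrite asboolT|].
apply: filterS => y xy _; apply: lt_le_trans an (le_trans xy _).
by apply: ub_le_sup; [exists (digit_sum 0 y + 3^-1 ^+ 0 * (3 / 2))|exists n].
Qed.

Lemma separating_inj : subbase u -> hausdorff_space X -> injective separating.
Proof.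
move=> [uo ub] hX x y xy; apply: contrapT => nxy.
have /ex_minnP[k] : exists k, `[< u k x >] != `[< u k y >].
  apply: contrapT => /forallNP H; apply: nxy; apply: hX => A B xA yB.
  have [s [sx sA]] := ub _ _ xA; exists y; split; last exact: nbhs_singleton.
  apply: sA => n /sx unx; have /negP := H n; rewrite negbK => /eqP.
  by rewrite (asboolT unx) => /esym/asboolP.
wlog : x y xy nxy / `[< u k x >].
  move=> wl; have [/asboolT ukx|nukx] := pselect (u k x); first exact: (wl x y).
  move=> ne kmin; apply: (wl y x) => //.
  - by move=> yx; exact: nxy.
  - by move: ne; rewrite (asboolF nukx); case: `[< _ >].
  - by rewrite eq_sym.
  - by move=> n; rewrite eq_sym; exact: kmin.
move=> ukx; rewrite ukx => nuky kmin.
have agree : digit_sum k x = digit_sum k y.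
  apply: eq_bigr => i _; suff -> : `[< u i x >] = `[< u i y >] by [].
  by apply/eqP; apply: contraT => /kmin; rewrite leqNgt ltn_ord.
have : separating y < separating x.
  apply: (@lt_le_trans _ _ (digit_sum k.+1 x)); last first.
    by apply: ub_le_sup; [exists (digit_sum 0 x + 3^-1 ^+ 0 * (3 / 2))|exists k.+1].
  (* At the first index [k] where memberships differ, [x] gains a full digit, while all later digits
     of [y] together are worth at most half of it. *)
  apply: (@le_lt_trans _ _ (digit_sum k.+1 y + 3^-1 ^+ k.+1 * (3 / 2))).
    by apply: ge_sup => //; exists (digit_sum 0 y); exists 0.
  rewrite /digit_sum !big_ord_recr/= ukx -/(digit_sum k x) -/(digit_sum k y) agree.
  move: nuky; case: `[< _ >] => // _; rewrite addr0 ltrD2l exprS.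
  have : 0 < (3^-1 : R) ^+ k by rewrite exprn_gt0// invr_gt0.
  by set e := _ ^+ _; lra.
by rewrite xy ltxx.
Qed.

End Separation.

(* The selection minimizes the injective lower semicontinuous function
   [separating] on each value of [F]. *)
Lemma measurable_selection (R : realType) d (W : measurableType d)
    (X : ptopologicalType) (D : set W) (F : W -> set X) :
  hausdorff_space X -> countable_subbase X ->
  (forall w, D w -> F w !=set0) -> (forall w, D w -> compact (F w)) ->
  (forall C, closed C -> measurable (D `&` [set w | F w `&` C !=set0])) ->
  exists s : W -> X, measurable_fun D (s : W -> borel X) /\
    forall w, D w -> F w (s w).
Proof.
move=> hX [u us] F0 cF mF; pose g : X -> R := separating R u.
have lg : lsc_on setT g := separating_lsc us.1.
have min w C : D w -> closed C -> F w `&` C !=set0 ->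
    exists2 x, (F w `&` C) x & forall y, (F w `&` C) y -> g x <= g y.
  move=> Dw cC FC; apply: lsc_attains_min FC _ => //; last exact: lsc_onS lg.
  exact: compact_closedI (cF w Dw) cC.
have [s sP] : exists s : W -> X, forall w, D w ->
    F w (s w) /\ forall y, F w y -> g (s w) <= g y.
  suff : forall w, exists x, D w -> F w x /\ forall y, F w y -> g x <= g y.
    by move=> H; have [s sP] := boolp.choice H; exists s.
  move=> w; have [Dw|nDw] := pselect (D w); last by exists point => /nDw.
  have [|x [Fx _] gx] := min w setT Dw closedT; first by rewrite setIT; exact: F0.
  by exists x => _; split=> // y Fy; apply: gx.
exists s; split=> [mD|w Dw]; last by have [] := sP w Dw.
apply: (measurability (@open X : set (set (borel X)))) => // _ [V oV <-].
have cV : closed (~` V) by exact: open_closedC.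
(* The minimizer lies in [V] exactly when a rational [q] fits between the minimum of [g] on [F w]
   and all its values on [F w] outside [V]. Injectivity of [g] makes the gap strict, and attainment
   of the second minimum keeps it uniform. *)
have -> : D `&` s @^-1` V = \bigcup_(q in [set: rat])
   ((D `&` [set w | F w `&` [set x | g x <= ratr q] !=set0]) `\`
    (D `&` [set w | F w `&` (~` V `&` [set x | g x <= ratr q]) !=set0])).
  apply/seteqP; split=> [w [Dw Vs]|w [q _ [[Dw [x [Fx xq]]] nV]]].
    have [Fs gs] := sP w Dw.
    suff [q sq qP] : exists2 q : rat, g (s w) <= ratr q &
        forall x, F w x -> ~ V x -> ratr q < g x.
      exists q => //; split; first by split=> //; exists (s w).
      by move=> [_ [x [Fx [/= /(qP x Fx) + ]]]]; rewrite leNgt => ->.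
    suff [b sb bP] : exists2 b, g (s w) < b & forall x, F w x -> ~ V x -> b <= g x.
      have [q] := rat_in_itvoo sb; rewrite in_itv/= => /andP[sq qb].
      by exists q => [|x Fx nVx]; [exact: ltW|exact: lt_le_trans qb (bP _ Fx nVx)].
    have [/(min w _ Dw cV)[x [Fx Vx] gx]|FV] := pselect (F w `&` ~` V !=set0).
      exists (g x) => [|y Fy nVy]; last exact: gx.
      rewrite lt_neqAle gs// andbT; apply/eqP => /(separating_inj us hX) sx.
      by apply: Vx; rewrite -sx.
    exists (g (s w) + 1) => [|x Fx nVx]; first by rewrite ltrDl.
    by exfalso; apply: FV; exists x.
  split=> //=; have [Fs gs] := sP w Dw; apply: contrapT => nVs.
  by apply: nV; split=> //; exists (s w); split=> //; split=> //=; apply: le_trans xq; exact: gs.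
apply: bigcup_countable_measurable => q _; apply: measurableD; apply: mF.
  exact: lsc_closed.
by apply: closedI => //; exact: lsc_closed.
Qed.

(** * Weak convergence of probability measures *)

Lemma lsc_measurable (R : realType) (T : ptopologicalType) (D : set T) (V : T -> R) :
  lsc_on D V -> measurable_fun (D : set (borel T)) (V : borel T -> R).
Proof.
move=> lV mD; apply: (measurability _ (RGenOInfty.measurableE R)) => //.
move=> _ [_ [a ->] <-]; rewrite preimage_itvoy.
rewrite (_ : _ `&` _ = D `&` [set x | D x -> a < V x]^°).
  exact: measurableI mD (borel_open (open_interior _)).
apply/seteqP; split=> x [Dx]; last by move=> /interior_subset /(_ Dx).
by move=> aV; split=> //; have := lV x Dx a aV; rewrite near_withinE.
Qed.

Lemma continuous_lsc (R : realType) (T : topologicalType) (D : set T) (V : T -> R) :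
  {within D, continuous V} -> lsc_on D V.
Proof.
move=> cV x Dx a aV; have := cV x; rewrite /continuous_at nbhs_subspace_in// => cVx.
exact: (cVx _ (lt_nbhsr aV)).
Qed.

Lemma bounded_integrable d (T : measurableType d) (R : realType)
    (mu : probability T R) (D : set T) (f : T -> R) (M : R) :
  measurable D -> measurable_fun D f -> (forall x, D x -> `|f x| <= M) ->
  mu.-integrable D (EFin \o f).
Proof.
move=> mD mf fM; apply: measurable_bounded_integrable => //.
  by rewrite (le_lt_trans (probability_le1 mu mD))// ltry.
by exists M; split; [exact: num_real|move=> y My x Dx; exact: le_trans (fM x Dx) (ltW My)].
Qed.

Lemma bounded_convergence d (T : measurableType d) (R : realType)
    (mu : probability T R) (f_ : nat -> T -> R) (f : T -> R) (M : R) :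
  (forall n, measurable_fun setT (f_ n)) -> (forall n x, `|f_ n x| <= M) ->
  (forall x, f_ ^~ x @ \oo --> f x) ->
  (\int[mu]_x f_ n x) @[n --> \oo] --> \int[mu]_x f x.
Proof.
move=> mf_ fM f_f.
have int_ n : mu.-integrable setT (EFin \o f_ n).
  by apply: (@bounded_integrable _ _ _ _ _ _ M).
have mf : measurable_fun setT f.
  apply/measurable_EFinP; apply: (emeasurable_fun_cvg (fun n => EFin \o f_ n)).
    by move=> n; exact/measurable_EFinP.
  by move=> x _; apply: cvg_EFin; [exact: nearW|exact: f_f].
have Mf x : `|f x| <= M.
  by apply: (cvgr_to_le (cvg_norm (f_f x))); exact: nearW.
have intf : mu.-integrable setT (EFin \o f).
  by apply: (@bounded_integrable _ _ _ _ _ _ M).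
have [] := @dominated_convergence _ _ _ mu setT measurableT
   (fun n => EFin \o f_ n) (EFin \o f) (cst M%:E).
- by move=> n; exact/measurable_EFinP.
- exact/measurable_EFinP.
- by apply: aeW => x _; apply: cvg_EFin; [exact: nearW|exact: f_f].
- by apply: (@bounded_integrable _ _ _ _ _ (cst M) `|M|).
- by apply: aeW => x n _; rewrite lee_fin.
move=> _ _ /=; rewrite /Rintegral -(fineK (integrable_fin_num measurableT intf)).
exact: fine_cvg.
Qed.

Lemma weak_integral_continuous (R : realType) (T : ptopologicalType) (phi : T -> R) :
  continuous phi -> bounded_fun phi ->
  continuous (fun mu : weak_prob R T => \int[mu]_x phi x : R).
Proof.
move=> cphi bphi mu.
pose Phi : bounded_continuous R T := exist _ phi (conj cphi bphi).
have /cvg_sup/(_ Phi) muP : nbhs (mu : weak_prob_topology R T) --> (mu : weak_prob_topology R T)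
    by [].
move=> A /= nA; apply: muP.
exact: (@initial_continuous _ _ (fun mu : borel_prob R T => \int[mu]_x phi x : R) mu A nA).
Qed.

(** * Lower semicontinuity of integrals in the measure and the integrand *)

Section LscIntegral.
Context (R : realType) (Z : topologicalType) (S : ptopologicalType).
Context (d : S -> S -> R) (D : set Z) (nu : Z -> borel_prob R S) (V : Z * S -> R).
Context (M : R).
Hypothesis dS : compatible_metric d.
Hypothesis nu_continuous : {within D, continuous (nu : Z -> weak_prob R S)}.
Hypothesis V_bound : forall z s, D z -> `|V (z, s)| <= M.
Hypothesis V_measurable :
  forall z, D z -> measurable_fun setT (fun s : borel S => V (z, s)).

(* Lipschitz in [s], hence testable against weak convergence; it increases to
   [V (z0, s)] as [k] grows and [G] shrinks to [z0]. *)
Let envelope (k : nat) (G : set Z) (s : S) : R :=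
  inf [set r | exists z s', G z /\ r = V (z, s') + k%:R * d s s'].

Let envelope_lb k G s : G `<=` D ->
  lbound [set r | exists z s', G z /\ r = V (z, s') + k%:R * d s s'] (- M).
Proof.
move=> GD _ [z [s' [Gz ->]]]; rewrite -[leLHS]addr0 lerD//.
  by have := V_bound s' (GD z Gz); rewrite ler_norml => /andP[].
by rewrite mulr_ge0// (metric_ge0 dS).
Qed.

Let envelope_le k G s z : G `<=` D -> G z -> envelope k G s <= V (z, s).
Proof.
move=> GD Gz; apply: ge_inf; first by exists (- M); exact: envelope_lb.
by exists z, s; split=> //; rewrite (metric_refl dS) mulr0 addr0.
Qed.

Let envelope_bound k G s : G `<=` D -> G !=set0 -> `|envelope k G s| <= M.
Proof.
move=> GD [z Gz]; rewrite ler_norml; apply/andP; split.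
  by apply: lb_le_inf; [exists (V (z, s) + k%:R * d s s), z, s|exact: envelope_lb].
apply: (le_trans (envelope_le k s GD Gz)).
by have := V_bound s (GD z Gz); rewrite ler_norml => /andP[].
Qed.

Let envelope_lip k G s t : G `<=` D -> G !=set0 ->
  envelope k G s <= envelope k G t + k%:R * d s t.
Proof.
move=> GD [z Gz]; rewrite -lerBlDr; apply: lb_le_inf.
  by exists (V (z, t) + k%:R * d t t), z, t.
move=> _ [z' [s' [Gz' ->]]]; rewrite lerBlDr -addrA -mulrDr.
apply: (@le_trans _ _ (V (z', s') + k%:R * d s s')).
  by apply: ge_inf; [exists (- M); exact: envelope_lb|exists z', s'].
by rewrite lerD2l ler_wpM2l// addrC (metric_triangle dS).
Qed.

Let envelope_continuous k G : G `<=` D -> G !=set0 -> continuous (envelope k G).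
Proof.
move=> GD G0 s; apply/cvgrPdist_lt => e e0.
(* The Lipschitz constant is [k]; dividing by [k.+1] also covers [k = 0]. *)
apply/(metric_nbhsP dS); exists (e / k.+1%:R); first by rewrite divr_gt0.
move=> t; rewrite ltr_pdivlMr// => st.
have ke : k%:R * d s t < e.
  apply: le_lt_trans st; rewrite mulrC ler_wpM2l ?(metric_ge0 dS)//.
  by rewrite ler_nat.
have := envelope_lip k s t GD G0; have := envelope_lip k t s GD G0.
rewrite (metric_sym dS t s) => ts st'; rewrite ltr_norml; apply/andP; split; lra.
Qed.

(** For fixed k the envelope is bounded and continuous, so weak continuity controls its integral
    near [z0], and it minorizes [V (z, _)] for all [z] in [G k]; bounded convergence at [z0] makes
    the loss arbitrarily small. The sequence [G] stays abstract because one use takes a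
    neighbourhood basis and another, where [V] ignores [z], a constant sequence. *)
Lemma integral_lsc_at (z0 : Z) (G : nat -> set Z) :
  D z0 -> (forall k, G k z0) -> (forall k, G k.+1 `<=` G k) ->
  (forall k, \forall z \near within D (nbhs z0), G k z) ->
  (forall s a, a < V (z0, s) -> exists k, \forall s' \near s,
     forall z, D z -> G k z -> a < V (z, s')) ->
  forall a, a < \int[nu z0]_s V (z0, s) ->
  \forall z \near within D (nbhs z0), a < \int[nu z]_s V (z, s).
Proof.
move=> Dz0 Gz0 Gdec Gnear GV a aV.
pose h k := envelope k (D `&` G k).
have GD k : D `&` G k `<=` D by move=> z [].
have G0 k : D `&` G k !=set0 by exists z0.
have Gmono m k : (m <= k)%N -> G k `<=` G m.
  move=> /subnKC <-; elim: (k - m)%N => [|j IH]; first by rewrite addn0.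
  by rewrite addnS; apply: subset_trans IH; exact: Gdec.
have h_cvg s : h ^~ s @ \oo --> V (z0, s).
  apply/cvgrPdist_le => e e0.
  have [k /(metric_nbhsP dS)[r r0 kr]] : exists k, \forall s' \near s,
      forall z, D z -> G k z -> V (z0, s) - e < V (z, s').
    by apply: GV; rewrite ltrBlDr ltrDl.
  (* Beyond distance [r] there is no control on [V] but [V >= - M]; [N] makes the penalty [N * r]
     alone compensate for this. *)
  have [N NP] : exists N : nat, (V (z0, s) - e + M) / r <= N%:R.
    exists (Num.truncn `|(V (z0, s) - e + M) / r|).+1.
    by rewrite (le_trans (ler_norm _))// ltW// truncnS_gt.
  exists (maxn k N) => // m /=; rewrite geq_max => /andP[km Nm].
  rewrite ger0_norm ?subr_ge0; last exact: envelope_le.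
  rewrite lerBlDr -lerBlDl; apply: lb_le_inf.
    by exists (V (z0, s) + m%:R * d s s), z0, s.
  move=> _ [z [s' [[Dz Gz] ->]]]; have [ss'|ss'] := ltP (d s s') r.
    apply: (@le_trans _ _ (V (z, s'))); first exact/ltW/kr/(Gmono _ _ km).
    by rewrite lerDl mulr_ge0// (metric_ge0 dS).
  have Vl : - M <= V (z, s') by have := V_bound s' Dz; rewrite ler_norml => /andP[].
  have : V (z0, s) - e + M <= m%:R * d s s'.
    rewrite ler_pdivrMr// in NP; apply: le_trans NP _.
    by rewrite ler_pM ?ler_nat// ltW.
  by lra.
have h_meas k : measurable_fun setT (h k : borel S -> R).
  apply: lsc_measurable; apply: continuous_lsc.
  by apply: continuous_subspaceT; exact: envelope_continuous.
have intV z : D z -> (nu z).-integrable setT (EFin \o (fun s => V (z, s))).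
  by move=> Dz; apply: (@bounded_integrable _ _ _ _ _ _ M) => // [|s _]; [exact:
      V_measurable|exact: V_bound].
have inth z k : (nu z).-integrable setT (EFin \o h k).
  by apply: (@bounded_integrable _ _ _ _ _ _ M) => // s _; exact: envelope_bound.
have := @bounded_convergence _ (borel S) R (nu z0) _ _ _ h_meas (fun k s => envelope_bound k s
    (GD k) (G0 k)) h_cvg.
move=> /cvgr_gt /(_ _ aV)[k _ /(_ k (leqnn k)) ak].
have bh : bounded_fun (h k).
  exists M; split; [exact: num_real|move=> y My s _].
  exact: le_trans (envelope_bound _ _ (GD k) (G0 k)) (ltW My).
have ch : continuous (h k) by exact: envelope_continuous.
have near_h : \forall z \near within D (nbhs z0), a < \int[nu z]_s h k s.
  have := @nu_continuous z0; rewrite /continuous_at nbhs_subspace_in// => nuz0.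
  have := weak_integral_continuous ch bh (lt_nbhsr ak); exact: nuz0.
move: (Gnear k) near_h; rewrite !near_withinE; apply: filterS2 => z Gz ah Dz.
apply: (lt_le_trans (ah Dz)); apply: le_Rintegral => //; [exact: inth|exact: intV|].
by move=> s _; apply: envelope_le => //; split=> //; exact: Gz.
Qed.

End LscIntegral.

Lemma integral_lsc (R : realType) (Z : topologicalType) (S : ptopologicalType)
    (D : set Z) (nu : Z -> borel_prob R S) (V : Z * S -> R) (M : R) :
  metrizable R S -> countable_subbase Z ->
  {within D, continuous (nu : Z -> weak_prob R S)} ->
  (forall z s, D z -> `|V (z, s)| <= M) ->
  lsc_on (D `*` setT) V ->
  lsc_on D (fun z => \int[nu z]_s V (z, s)).
Proof.
move=> [d dS] cZ cnu VM lV z0 Dz0.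
have [B [Bz0 Bdec Bnbhs]] := subbase_nbhs_basis z0 cZ.
have mV z : D z -> measurable_fun setT (fun s : borel S => V (z, s)).
  move=> Dz; apply: lsc_measurable => s _ a aV.
  have := lV (z, s) (conj Dz I) a aV; rewrite !near_withinE => -[[P Q] /= [Pz Qs] PQ].
  apply: filterS _ Qs => s' Qs' _; apply: (PQ (z, s')); split=> //=.
  exact: nbhs_singleton Pz.
apply: (integral_lsc_at dS cnu VM mV (G := B)) => //.
- by move=> k; exact: nbhs_singleton (Bz0 k).
- by move=> k; apply: cvg_within; exact: Bz0.
move=> s a aV; have := lV (z0, s) (conj Dz0 I) a aV.
rewrite near_withinE => -[[P Q] /= [Pz Qs] PQ].
have [k kP] := Bnbhs P Pz; exists k; apply: filterS _ Qs => s' Qs' z Dz Bz.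
by apply: (PQ (z, s')) => //; split=> //=; exact: kP.
Qed.

(** The open-set half of the portmanteau theorem: [integral_lsc_at] is applied with the space of
    measures itself as parameter space, the identity as kernel and the indicator of [O] as
    integrand. *)
Lemma weak_measure_open_measurable (R : realType) (S : ptopologicalType) (O : set S) :
  metrizable R S -> open O ->
  measurable_fun setT (fun mu : borel (weak_prob R S) => fine (mu O)).
Proof.
move=> [d dS] oV; apply: lsc_measurable.
have int1 (mu : borel_prob R S) : \int[mu]_s \1_O s = fine (mu O).
  rewrite /Rintegral integral_indic//; last exact: borel_open.
  by rewrite setIT.
pose V (z : weak_prob R S * S) : R := \1_O z.2.
have lV s a : a < \1_O s -> \forall s' \near s, a < (\1_O s' : R).
  rewrite indicE; case: (boolP (s \in O)) => [|_ a0].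
    rewrite inE => Os a1; apply: filterS _ (open_nbhs_nbhs (conj oV Os)) => s' Os'.
    by rewrite indicE mem_set.
  by apply: nearW => s'; rewrite (lt_le_trans a0)// indicE ler0n.
move=> mu _ a; rewrite -int1 => amu.
under eq_near do rewrite -int1.
apply: (@integral_lsc_at R _ S d setT (id : weak_prob R S -> borel_prob R S)
  V 1 dS _ _ _ mu (fun=> setT)) => //.
- by apply: continuous_subspaceT => nu; exact: cvg_id.
- by move=> z s _; rewrite /V ger0_norm ?indicE ?ler0n// lern1 leq_b1.
- by move=> z _; rewrite /V/=; apply: measurable_indic; exact: borel_open.
- by move=> k; exact: nearW.
- move=> s b /lV bs; exists 0; apply: filterS _ bs => s' bs' z _ _; exact: bs'.
Qed.

(** Turns Borel maps into the weak topology into kernels: open sets are stable under intersection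
    and generate the Borel sets, so Dynkin induction extends the case of open [C]. *)
Lemma weak_measure_measurable (R : realType) (S : ptopologicalType)
    d (W : measurableType d) (D : set W) (f : W -> weak_prob R S)
    (C : set (borel S)) :
  metrizable R S -> measurable C -> measurable D ->
  measurable_fun D (f : W -> borel (weak_prob R S)) ->
  measurable_fun D (fun w => (f w : borel_prob R S) C).
Proof.
move=> mS mC mD mf; move: C mC.
apply: (@dynkin_induction _ (borel S) (@open S : set (set (borel S)))) => //.
- by move=> A B; exact: openI.
- by apply: (eq_measurable_fun (cst 1%E)) => [w _|]; [rewrite /= probability_setT|exact:
    measurable_cst].
- move=> V oV.
  apply: (eq_measurable_fun (fun w => (fine ((f w : borel_prob R S) V))%:E)).
    by move=> w _; rewrite fineK// fin_num_measure//; exact: borel_open.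
  apply/measurable_EFinP.
  exact: (measurableT_comp (weak_measure_open_measurable mS oV) mf).
- move=> V mV mfV; apply: (eq_measurable_fun (fun w => 1 - (f w : borel_prob R S) V)%E).
    by move=> w _; rewrite probability_setC.
  by apply: emeasurable_funB.
- move=> F mF tF mfF.
  apply: (eq_measurable_fun (fun w => \sum_(0 <= k <oo) (f w : borel_prob R S) (F k))%E).
    by move=> w _; rewrite measure_bigcup//; apply: eq_eseriesl => k; rewrite in_setT.
  by apply: ge0_emeasurable_sum.
Qed.

(** * The Ionescu-Tulcea theorem *)

Local Open Scope ereal_scope.

Lemma measure0_of_full d (T : measurableType d) (R : realType)
    (m : {measure set T -> \bar R}) (A : set T) :
  measurable A -> m setT = 1 -> m (~` A) = 1 -> m A = 0.
Proof.
move=> mA mT mCA; have : m setT = m A + m (~` A).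
  by rewrite -measureU ?setUv ?setICr//; exact: measurableC.
rewrite mT mCA; case: (m A) => [r| |]//= [] /(congr1 (fun t => t - 1)%R).
by rewrite subrr addrK => <-.
Qed.

Section MeasureProbability.
Context d (T : measurableType d) (R : realType) (m : {measure set T -> \bar R}).
Hypothesis mT : m setT = 1.

(** The discarded argument keeps the proof [mT] in the term, so that a probability structure can be
    attached to it. *)
Definition unit_measure of m setT = 1 : set T -> \bar R := m.

HB.instance Definition _ := Measure.on (unit_measure mT).

HB.instance Definition _ := Measure_isProbability.Build _ _ _ (unit_measure mT) mT.

Lemma measure_probability : exists P : probability T R, (P : set T -> \bar R) = m.
Proof. by exists (unit_measure mT). Qed.

End MeasureProbability.

Lemma pushforward_measure d d' (T : measurableType d) (U : measurableType d')
    (R : realType) (m : {measure set T -> \bar R}) (f : T -> U) :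
  measurable_fun setT f ->
  exists m' : {measure set U -> \bar R}, (m' : set U -> \bar R) = pushforward m f.
Proof.
by move=> mf; unshelve eexists (pushforward m f).
Qed.

Section Mixture.
Import HBNNSimple.

(** The identity on sets extends to simple functions by linearity and to nonnegative ones by
    monotone convergence, used at both levels of integration. *)
Lemma integral_mixture d d' (X : measurableType d) (Z : measurableType d')
    (R : realType) (m1 : {measure set X -> \bar R}) (m2 : {measure set Z -> \bar R})
    (k : R.-ker X ~> Z) :
  (forall B, measurable B -> m2 B = \int[m1]_x k x B) ->
  forall f : Z -> \bar R, (forall z, 0 <= f z) -> measurable_fun setT f ->
  \int[m2]_z f z = \int[m1]_x \int[k x]_z f z.
Proof.
move=> m2E f f0 mf; pose g := nnsfun_approx measurableT mf.
have mg n : measurable_fun setT (fun z => (g n z)%:E) by exact/measurable_EFinP.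
have g0 n z : 0 <= (g n z)%:E by rewrite lee_fin.
have g_nd z : {homo (fun n => (g n z)%:E) : n m / (n <= m)%N >-> n <= m}.
  by move=> n m nm; rewrite lee_fin; exact/lefP/nd_nnsfun_approx.
have gf z : (g n z)%:E @[n --> \oo] --> f z by exact: cvg_nnsfun_approx.
have mk n : measurable_fun setT (fun x => \int[k x]_z (g n z)%:E).
  by apply: measurable_fun_integral_kernel => [U mU||]; [exact: (measurable_kernel k)|exact:
      g0|exact: mg].
have simple n : \int[m2]_z (g n z)%:E = \int[m1]_x \int[k x]_z (g n z)%:E.
  rewrite integralT_nnsfun sintegralE.
  transitivity (\int[m1]_x (\sum_(r \in range (g n)) r%:E * k x (g n @^-1` [set r]))).
    rewrite ge0_integral_fsum//.
    - apply: eq_fsbigr => r /set_mem[z _ <-]; rewrite m2E// ge0_integralZl//.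
      exact: (measurable_kernel k).
    - by move=> r; apply: measurable_funeM; exact: (measurable_kernel k).
    - by move=> r x _; exact: nnsfun_mulemu_ge0.
  by apply: eq_integral => x _; rewrite integralT_nnsfun sintegralE.
transitivity (limn (fun n => \int[m2]_z (g n z)%:E)).
  rewrite -monotone_convergence//; apply: eq_integral => z _.
  by apply/esym/cvg_lim => //; exact: gf.
rewrite (funext simple).
rewrite -monotone_convergence//.
- apply: eq_integral => x _; rewrite -monotone_convergence//.
  by apply: eq_integral => z _; apply/cvg_lim => //; exact: gf.
- by move=> n x _; exact: integral_ge0.
- by move=> x _ n m nm; apply: ge0_le_integral => // z _; exact: (g_nd z n m nm).
Qed.

End Mixture.

Section IonescuTulcea.
Context (R : realType) (d : measure_display) (Omega : measurableType d).
Context (dX : nat -> measure_display).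
Context (X : forall n, measurableType (dX n)).
Context (p : forall n, Omega -> X n) (q : forall n, X n.+1 -> X n).
Context (k : forall n, R.-pker X n ~> X n.+1) (x0 : X 0%N).
Hypothesis q_measurable : forall n, measurable_fun setT (@q n).
Hypothesis qp : forall n w, q (p n.+1 w) = p n w.
Hypothesis p_surj : forall n x, exists w, p n w = x.
Hypothesis p_lim : forall x : (forall n, X n), (forall n, q (x n.+1) = x n) ->
  exists w, forall n, p n w = x n.
Hypothesis k_fiber : forall n x (B : set (X n.+1)), measurable B ->
  (forall z, q z = x -> B z) -> k n x B = 1.

Definition cylinder : set (set Omega) :=
  [set A | exists n (B : set (X n)), measurable B /\ A = p n @^-1` B].

Lemma cylinder_lift n (B : set (X n)) m : measurable B -> (n <= m)%N ->
  exists B' : set (X m), measurable B' /\ p n @^-1` B = p m @^-1` B'.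
Proof.
move=> mB /subnKC <-; elim: (m - n)%N => [|j [B' [mB' E]]].
  by rewrite addn0; exists B.
rewrite addnS; exists (@q (n + j)%N @^-1` B'); split.
  by rewrite -[X in measurable X]setTI; exact: q_measurable.
by rewrite E; apply/seteqP; split=> w /=; rewrite qp.
Qed.

Lemma cylinder_common A A' : cylinder A -> cylinder A' -> exists n (B B' : set (X n)),
  [/\ measurable B, measurable B', A = p n @^-1` B & A' = p n @^-1` B'].
Proof.
move=> [n [B [mB ->]]] [n' [B' [mB' ->]]]; exists (maxn n n').
have [C [mC ->]] := cylinder_lift mB (leq_maxl n n').
by have [C' [mC' ->]] := cylinder_lift mB' (leq_maxr n n'); exists C, C'.
Qed.

Lemma cylinder0 : cylinder set0.
Proof. by exists 0%N, set0; rewrite preimage_set0. Qed.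

Lemma cylinderU : setU_closed cylinder.
Proof.
move=> A A' cA cA'; have [n [B [B' [mB mB' -> ->]]]] := cylinder_common cA cA'.
by exists n, (B `|` B'); rewrite preimage_setU; split=> //; exact: measurableU.
Qed.

Lemma cylinderC : setC_closed cylinder.
Proof.
by move=> _ [n [B [mB ->]]]; exists n, (~` B); rewrite preimage_setC; split=> //; exact:
    measurableC.
Qed.

(** Working with these functions instead of finite-dimensional laws gives conditional probabilities
    from every history at once, which the continuity argument at the empty set requires. *)
Definition martingale (g : forall n, X n -> \bar R) : Prop :=
  [/\ forall n, measurable_fun setT (g n), forall n x, 0 <= g n x &
      forall n x, g n x = \int[k n x]_z g n.+1 z].

(** Late inequalities suffice: integrating against the kernels carries them back one stage at a
    time. *)
Lemma martingale_le (g g' : forall n, X n -> \bar R) N :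
  martingale g -> martingale g' ->
  (forall n w, (N <= n)%N -> g n (p n w) <= g' n (p n w)) ->
  forall n x, g n x <= g' n x.
Proof.
move=> [mg g0 gk] [mg' g'0 g'k] gg' n.
suff H m n' : (N <= n' + m)%N -> forall x, g n' x <= g' n' x.
  by apply: (H N); exact: leq_addl.
elim: m n' => [|m IH] {}n Nn x.
  by have [w <-] := p_surj x; apply: gg'; rewrite addn0 in Nn.
rewrite gk g'k; apply: ge0_le_integral => // z _.
by apply: IH; rewrite addSnnS.
Qed.

Lemma martingaleD g g' : martingale g -> martingale g' ->
  martingale (fun n x => g n x + g' n x).
Proof.
move=> [mg g0 gk] [mg' g'0 g'k]; split=> [n|n x|n x].
- exact: emeasurable_funD.
- exact: adde_ge0.
- by rewrite gk g'k ge0_integralD.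
Qed.

(* [g n] is the conditional probability of [A] given the first [n] stages. *)
Definition predicts (A : set Omega) (g : forall n, X n -> \bar R) : Prop :=
  martingale g /\
  exists N, forall n w, (N <= n)%N -> g n (p n w) = (\1_A w)%:E.

Lemma predicts_preimage N (B : set (X N)) : measurable B -> exists g, martingale g /\
  forall n w, (N <= n)%N -> g n (p n w) = (\1_(p N @^-1` B) w)%:E.
Proof.
move=> mB; set A := p N @^-1` B; have AE : A = p N @^-1` B by [].
have lift n : exists C : set (X n), measurable C /\ ((N <= n)%N -> A = p n @^-1` C).
  have [Nn|_] := leqP N n; last by exists setT.
  by rewrite AE; have [C [mC E]] := cylinder_lift mB Nn; exists C.
pose C n := sval (cid (lift n)).
have mC n : measurable (C n) := (svalP (cid (lift n))).1.
have AC n : (N <= n)%N -> A = p n @^-1` (C n) := (svalP (cid (lift n))).2.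
(* Backward construction: [j] counts the stages before [N] at which the martingale equation already
   holds. With [j = N] it holds everywhere. *)
suff H j : exists g : forall n, X n -> \bar R,
  [/\ forall n, measurable_fun setT (g n), forall n x, 0 <= g n x,
      forall n w, (N <= n)%N -> g n (p n w) = (\1_A w)%:E &
      forall n x, (N <= n + j)%N -> g n x = \int[k n x]_z g n.+1 z].
  have [g [mg g0 gA gk]] := H N; exists g; split=> //.
  by split=> // n x; apply: gk; exact: leq_addl.
elim: j => [|j [g [mg g0 gA gk]]].
  exists (fun n x => (\1_(C n) x)%:E); split.
  - by move=> n; apply/measurable_EFinP; exact: measurable_indic.
  - by move=> n x; rewrite lee_fin.
  - by move=> n w Nn; rewrite (AC n Nn) !indicE.
  move=> n x; rewrite addn0 => Nn; rewrite integral_indic// setIT.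
  (* From stage [N] on, membership in the event is already decided, so a fibre lies inside [C n.+1]
     or misses it, and [k_fiber] gives it mass 1 or 0. *)
  have fiber z : q z = x -> (z \in C n.+1) = (x \in C n).
    have [w <-] := p_surj z; rewrite qp => <-.
    have := AC n Nn; rewrite {1}(AC n.+1 (leqW Nn)) => E.
    have Ew : (p n.+1 @^-1` C n.+1) w = (p n @^-1` C n) w by rewrite E.
    by apply/idP/idP => /set_mem H; apply/mem_set; move: H; rewrite /preimage/= in Ew; rewrite Ew.
  rewrite indicE; case: (boolP (x \in C n)) => xC.
    by rewrite k_fiber// => z /fiber; rewrite xC => /set_mem.
  rewrite /= (@measure0_of_full _ _ _ (k n x) (C n.+1))//; first exact: prob_kernel.
  apply: k_fiber; first exact: measurableC.
  by move=> z /fiber; rewrite (negbTE xC) => /negbT; rewrite notin_setE.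
have [jN|Nj] := leqP N j.
  by exists g; split=> // n x Nn; apply: gk; rewrite (leq_trans jN)// leq_addl.
(* The only stage to redefine: there [g] becomes the average of its values at the next stage. *)
pose K := (N - j.+1)%N.
exists (dfwith g K (fun x => \int[k K x]_z g K.+1 z)).
have dfK f : dfwith g K f K = f by rewrite dfwithin.
have dfN f n : n != K -> dfwith g K f n = g n by move=> nK; rewrite dfwithout// eq_sym.
have gK_ge0 x : 0 <= \int[k K x]_z g K.+1 z by exact: integral_ge0.
split=> [n|n x|n w Nn|n x Nn].
- have [->|nK] := eqVneq n K; last by rewrite dfN.
  rewrite dfK; apply: measurable_fun_integral_kernel => // U mU.
  exact: (measurable_kernel (k K)).
- by move: x; have [->|nK] := eqVneq n K => x; [rewrite dfK|rewrite dfN].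
- by rewrite dfN ?gA//; apply: contraTneq Nn => ->; rewrite -ltnNge /K; lia.
- move: x Nn; have [->|nK] := eqVneq n K => x Nn.
    by rewrite dfK dfN// neq_ltn ltnSn orbT.
  rewrite !dfN//; last by rewrite /K in nK *; lia.
  by apply: gk; move: nK; rewrite /K => /eqP; lia.
Qed.

Lemma predicts_cylinder A : cylinder A -> exists g, predicts A g.
Proof.
move=> [N [B [mB ->]]]; have [g [mg gA]] := predicts_preimage mB.
by exists g; split=> //; exists N.
Qed.

Lemma predicts_le A A' g g' : A `<=` A' -> predicts A g -> predicts A' g' ->
  forall n x, g n x <= g' n x.
Proof.
move=> AA' [mg [N gA]] [mg' [N' g'A]].
apply: (@martingale_le _ _ (maxn N N')) => // n w; rewrite geq_max => /andP[Nn N'n].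
rewrite gA// g'A// lee_fin !indicE.
by case: (boolP (w \in A)) => [/set_mem/AA'/mem_set ->//|_]; rewrite ler0n.
Qed.

Lemma predicts_unique A g g' n x : predicts A g -> predicts A g' -> g n x = g' n x.
Proof. by move=> gA g'A; apply/eqP; rewrite eq_le !(@predicts_le A A). Qed.

Lemma predictsT : predicts setT (fun _ _ => 1).
Proof.
split; last by exists 0%N => n w _; rewrite indicT.
split=> // n x; rewrite integral_cst// mul1e.
by apply/esym; exact: prob_kernel.
Qed.

Lemma predicts_le1 A g n x : predicts A g -> g n x <= 1.
Proof. by move=> gA; exact: (predicts_le (@subsetT _ A) gA predictsT). Qed.

Lemma predictsU A A' g g' : [disjoint A & A'] -> predicts A g -> predicts A' g' ->
  predicts (A `|` A') (fun n x => g n x + g' n x).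
Proof.
move=> AA' [mg [N gA]] [mg' [N' g'A]]; split; first exact: martingaleD.
exists (maxn N N') => n w; rewrite geq_max => /andP[Nn N'n].
rewrite gA// g'A// -EFinD; congr EFin; rewrite !indicE in_setU.
have [wA|_] := boolP (w \in A); have [wA'|_] := boolP (w \in A'); rewrite ?addr0 ?add0r//.
by move/disj_setPS : AA' => /(_ w)[]; split; exact: set_mem.
Qed.

(** The conditional probability at the starting point [x0], which does not depend on the chosen
    martingale by [predicts_unique]; 0 is a default value off the cylinders. *)
Definition premeasure (A : set Omega) : \bar R :=
  if pselect (cylinder A) is left cA
  then sval (cid (predicts_cylinder cA)) 0%N x0 else 0.

Lemma premeasureE A g : cylinder A -> predicts A g -> premeasure A = g 0%N x0.
Proof.
move=> cA gA; rewrite /premeasure; case: pselect => // cA'.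
exact: predicts_unique (svalP (cid (predicts_cylinder cA'))) gA.
Qed.

Lemma premeasure_ge0 A : 0 <= premeasure A.
Proof.
rewrite /premeasure; case: pselect => // cA.
by have [[_ g0 _] _] := svalP (cid (predicts_cylinder cA)); exact: g0.
Qed.

Lemma premeasure0 : premeasure set0 = 0.
Proof.
rewrite (premeasureE (g := fun _ _ => 0)) ?cylinder0//; first exact: cylinder0.
split; last by exists 0%N => n w _; rewrite indic0.
by split=> // n x; rewrite integral0.
Qed.

Lemma premeasureT : premeasure setT = 1.
Proof.
rewrite (premeasureE (g := fun _ _ => 1))//; last exact: predictsT.
by rewrite -setC0; apply: cylinderC; exact: cylinder0.
Qed.

Lemma premeasureU A A' : cylinder A -> cylinder A' -> [disjoint A & A'] ->
  premeasure (A `|` A') = premeasure A + premeasure A'.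
Proof.
move=> cA cA' AA'.
have [g gA] := predicts_cylinder cA; have [g' gA'] := predicts_cylinder cA'.
by rewrite (premeasureE cA gA) (premeasureE cA' gA') (premeasureE _ (predictsU AA' gA gA'))//;
    exact: cylinderU.
Qed.

Lemma premeasure_fin A : cylinder A -> premeasure A \is a fin_num.
Proof.
move=> cA; have [g gA] := predicts_cylinder cA.
rewrite (premeasureE cA gA) ge0_fin_numE; last by case: gA => -[_ g0 _] _; exact: g0.
by rewrite (le_lt_trans (predicts_le1 _ gA))// ltry.
Qed.

(* A history is live if its conditional probabilities of the [C m] stay away
   from 0.  Were the limit positive, live histories could be extended forever,
   and the resulting path would lie in every [C m]. *)
Lemma premeasure_continuous (C : nat -> set Omega) :
  (forall n, cylinder (C n)) -> (forall n, C n.+1 `<=` C n) ->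
  \bigcap_n C n = set0 -> premeasure (C n) @[n --> \oo] --> 0.
Proof.
move=> cC Cdec C0.
pose g m := sval (cid (predicts_cylinder (cC m))).
have gC m : predicts (C m) (g m) := svalP (cid (predicts_cylinder (cC m))).
have g_ge0 m n x : 0 <= g m n x by have [[_ g0 _] _] := gC m; exact: g0.
have g_dec n x : nonincreasing_seq (fun m => g m n x).
  by apply/nonincreasing_seqP => m; exact: predicts_le (Cdec m) (gC m.+1) (gC m) n x.
pose live n x := 0 < ereal_inf (range (fun m => g m n x)).
have cvg_g n x : g m n x @[m --> \oo] --> ereal_inf (range (fun m => g m n x)).
  exact: ereal_nonincreasing_cvgn.
have inf_ge0 n x : 0 <= ereal_inf (range (fun m => g m n x)).
  by apply/ereal_infP => _ [m _ <-].
have dead n x : ~ live n x -> g m n x @[m --> \oo] --> 0.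
  move=> /negP; rewrite -leNgt => le0.
  by have := cvg_g n x; have -> : ereal_inf (range (fun m => g m n x)) = 0 by apply/eqP; rewrite
      eq_le le0 inf_ge0.
(* Otherwise the limit [L] vanishes on the fibre over [x], which carries the whole kernel, and
   dominated convergence forces [g m n x] to tend to 0. *)
have live_step n x : live n x -> exists z, q z = x /\ live n.+1 z.
  move=> xl; apply: contrapT => nz.
  pose L z := ereal_inf (range (fun m => g m n.+1 z)).
  have mg m : measurable_fun setT (g m n.+1) by have [[mg _ _] _] := gC m; exact: mg.
  have mL : measurable_fun setT L.
    by apply: (emeasurable_fun_cvg (fun m => g m n.+1)) => // z _; exact: cvg_g.
  have L_fiber : k n x (L @^-1` [set 0]) = 1.
    apply: k_fiber => [|z zx]; first by rewrite -[X in measurable X]setTI; exact: mL.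
    apply/eqP; rewrite eq_le inf_ge0 andbT leNgt; apply/negP => zl.
    by apply: nz; exists z.
  have kT : k n x setT = 1 by exact: prob_kernel.
  have L0 : \int[k n x]_z L z = 0.
    transitivity (\int[k n x]_z cst 0 z); last exact: integral0.
    apply: ae_eq_integral => //; exists (~` (L @^-1` [set 0])); split.
    - by apply: measurableC; rewrite -[X in measurable X]setTI; exact: mL.
    - apply: measure0_of_full => //; last by rewrite setCK.
      by apply: measurableC; rewrite -[X in measurable X]setTI; exact: mL.
    - by move=> z /= H Lz; apply: H.
  have [] := @dominated_convergence _ _ _ (k n x) setT measurableT
     (fun m => g m n.+1) L (cst 1) mg mL.
  - by apply: aeW => z _; exact: cvg_g.
  - apply/integrableP; split; first exact: measurable_cst.
    by rewrite (eq_integral (cst 1)) ?integral_cst ?mul1e ?kT ?ltry// => z _; rewrite /= normr1.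
  - by apply: aeW => z m _; rewrite gee0_abs//; exact: predicts_le1 (gC m).
  move=> _ _; rewrite L0.
  rewrite (_ : (fun _ => _) = (fun m => g m n x)); last first.
    by apply/funext => m; have [[_ _ ->] _] := gC m.
  move=> g0; have : 0 < ereal_inf (range (fun m => g m n x)) by [].
  by rewrite (cvg_unique _ (cvg_g n x) g0)// ltxx.
apply: contrapT => /= nC0.
have live0 : live 0%N x0.
  apply: contrapT => /dead g0; apply: nC0.
  by under eq_fun do rewrite (premeasureE (cC _) (gC _)).
pose next n (z : {x : X n | live n x}) : {x : X n.+1 | live n.+1 x} :=
  let s := cid (live_step n (sval z) (svalP z)) in exist _ (sval s) (svalP s).2.
pose path := fix path n : {x : X n | live n x} :=
  if n is n'.+1 then next n' (path n') else exist _ x0 live0.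
have [|w wP] := @p_lim (fun n => sval (path n)).
  by move=> n /=; exact: (svalP (cid (live_step n _ (svalP (path n))))).1.
suff : (\bigcap_n C n) w by rewrite C0.
move=> m _; have [_ [N gN]] := gC m.
(* At stage [N] the function [g m] is the indicator of [C m], so being positive there means that [w]
   lies in [C m]. *)
have : 0 < g m N (p N w).
  by rewrite wP; apply: (lt_le_trans (svalP (path N))); apply: ereal_inf_lbound; exists m.
by rewrite gN// lte_fin indicE ltr0n lt0b => /set_mem.
Qed.

(** A copy of [Omega] that carries the algebra of cylinders, as [Omega] already has its own
    sigma-algebra. *)
Definition cylinder_type : Type := Omega.

HB.instance Definition _ := Pointed.on cylinder_type.

HB.instance Definition _ := isAlgebraOfSets.Build default_measure_display
  cylinder_type cylinder0 cylinderU cylinderC.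

(** By finite additivity the partial sums miss the total by the mass of the remaining union, and
    these remainders decrease to the empty set. *)
Lemma premeasure_sigma_additive :
  semi_sigma_additive (premeasure : set cylinder_type -> \bar R).
Proof.
move=> F cF tF cUF; pose rest n := (\bigcup_n F n) `\` \big[setU/set0]_(i < n) F i.
have cbig n : cylinder (\big[setU/set0]_(i < n) F i).
  by apply: (@bigsetU_measurable _ cylinder_type) => i _; exact: cF.
have crest n : cylinder (rest n).
  by apply: (@measurableD _ cylinder_type) => //; exact: cbig.
have split_rest n : premeasure (\bigcup_n F n) =
    \sum_(0 <= i < n) premeasure (F i) + premeasure (rest n).
  have sub : \big[setU/set0]_(i < n) F i `<=` \bigcup_n F n.
    by rewrite -bigcup_mkord; apply: bigcup_sub => i _; exact: bigcup_sup.
  rewrite big_mkord; have <- : premeasure (\big[setU/set0]_(i < n) F i) =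
      \sum_(i < n) premeasure (F i).
    elim: n {sub} => [|n IH]; first by rewrite !big_ord0 premeasure0.
    rewrite !big_ord_recr/= premeasureU; [by rewrite IH|exact: cbig|exact: (cF n)|].
    apply/disj_setPS => w [/=]; rewrite -bigcup_mkord => -[i /= ni Fi] Fn.
    have := tF i n I I (ex_intro _ w (conj Fi Fn)) => ni'.
    by rewrite ni' ltnn in ni.
  rewrite -premeasureU; [by rewrite setDUK|exact: cbig|exact: crest|].
  by apply/disj_setPS => w [/= H [_]]; apply.
have rest0 : premeasure (rest n) @[n --> \oo] --> 0.
  apply: premeasure_continuous => // [n w [Uw nw]|].
    by split=> // H; apply: nw; rewrite big_ord_recr/=; left.
  apply/seteqP; split=> // w H; have [[n _ Fn] _] := H 0%N I.
  by have [_] := H n.+1 I; apply; rewrite big_ord_recr/=; right.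
have -> : (fun n => \sum_(0 <= i < n) premeasure (F i)) =
    (fun n => premeasure (\bigcup_n F n) - premeasure (rest n)).
  by apply/funext => n; rewrite (split_rest n) addeK// premeasure_fin.
rewrite -[X in _ --> X]sube0; apply: cvgeB => //; last exact: cvg_cst.
exact: fin_num_adde_defr (premeasure_fin cUF).
Qed.

Definition cylinder_measure : set cylinder_type -> \bar R := premeasure.

HB.instance Definition _ := isMeasure.Build default_measure_display cylinder_type R
  cylinder_measure premeasure0 premeasure_ge0 premeasure_sigma_additive.

Definition ionescu_tulcea_measure :
    set (g_sigma_algebraType (@measurable _ cylinder_type)) -> \bar R :=
  measure_extension cylinder_measure.

HB.instance Definition _ := Measure.on ionescu_tulcea_measure.

Lemma ionescu_tulcea_measureE A :
  cylinder A -> ionescu_tulcea_measure A = premeasure A.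
Proof. by move=> cA; exact: measurable_mu_extE. Qed.

Lemma ionescu_tulcea_measureT : ionescu_tulcea_measure setT = 1.
Proof.
by rewrite ionescu_tulcea_measureE ?premeasureT// -setC0; exact/cylinderC/cylinder0.
Qed.

Theorem ionescu_tulcea :
  (forall n, measurable_fun setT (p n)) ->
  (forall A, measurable A -> <<s cylinder >> A) ->
  exists mu : probability Omega R,
    (forall B, measurable B -> mu (p 0%N @^-1` B) = \d_x0 B) /\
    forall n (B : set (X n.+1)), measurable B ->
      mu (p n.+1 @^-1` B) = \int[pushforward mu (p n)]_x k n x B.
Proof.
move=> mp gen.
have mid : measurable_fun setT (id : g_sigma_algebraType (@measurable _ cylinder_type) -> Omega).
  by move=> _ A mA; rewrite setTI; exact: gen.
have [m mE] := pushforward_measure ionescu_tulcea_measure mid.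
have mT : m setT = 1 by rewrite mE; exact: ionescu_tulcea_measureT.
have [mu muE'] := measure_probability mT.
exists mu.
have cp n (B : set (X n)) : measurable B -> cylinder (p n @^-1` B) by exists n, B.
have muE n (B : set (X n)) g : measurable B -> predicts (p n @^-1` B) g ->
    mu (p n @^-1` B) = g 0%N x0.
  move=> mB gB; rewrite muE' mE.
  transitivity (premeasure (p n @^-1` B)); last exact: premeasureE (cp n B mB) gB.
  exact: ionescu_tulcea_measureE (cp n B mB).
have mu0 B : measurable B -> mu (p 0%N @^-1` B) = \d_x0 B.
  move=> mB; have [g [mg gB]] := predicts_preimage mB.
  rewrite (@muE _ _ g)//; last by split=> //; exists 0%N.
  by have [w <-] := p_surj x0; rewrite gB// diracE indicE.
pose law n := sval (cid (pushforward_measure mu (mp n))).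
have lawE n : (law n : set (X n) -> \bar R) = pushforward mu (p n).
  exact: svalP (cid (pushforward_measure mu (mp n))).
(* This and [martingale_law] feed each other: constancy of martingale integrals at stage [n] makes
   the next law a mixture of kernels, which in turn gives constancy at stage [n.+1]. *)
have law_martingale n : (forall g, martingale g -> g 0%N x0 = \int[law n]_x g n x) ->
    forall B : set (X n.+1), measurable B ->
    law n.+1 B = \int[law n]_x k n x B.
  move=> IH B mB; rewrite lawE /pushforward.
  have [g [mg gB]] := predicts_preimage mB.
  rewrite (@muE _ _ g)//; last by split=> //; exists n.+1.
  rewrite IH//; apply: eq_integral => x _; have [_ _ ->] := mg.
  transitivity (\int[k n x]_z (\1_B z)%:E); last by rewrite integral_indic// setIT.
  apply: eq_integral => z _.
  by have [w <-] := p_surj z; rewrite gB.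
have martingale_law n g : martingale g -> g 0%N x0 = \int[law n]_x g n x.
  elim: n g => [|n IH] g mg.
    rewrite (eq_measure_integral \d_x0); last first.
      by move=> B mB _; rewrite lawE; exact: mu0.
    by have [mg0 _ _] := mg; rewrite integral_dirac// diracT mul1e.
  have [mgn g0 gk] := mg.
  rewrite (integral_mixture (law_martingale n IH))//.
  by rewrite IH//; apply: eq_integral => x _; rewrite gk.
split=> // n B mB; rewrite -lawE -(law_martingale n (martingale_law n) B mB).
by rewrite lawE.
Qed.

End IonescuTulcea.

Local Close Scope ereal_scope.

(** * Histories and continuations *)

Lemma polish_countable_subbase (R : realType) (T : topologicalType) :
  polish R T -> countable_subbase T.
Proof. by move=> [[d [dT _]] [D [cD dD]]]; have := dense_countable_subbase dT cD dD. Qed.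

Lemma polish_metrizable (R : realType) (T : topologicalType) :
  polish R T -> metrizable R T.
Proof. by move=> [[d [dT _]] _]; exists d. Qed.

Lemma metrizable_hausdorff (R : realType) (T : topologicalType) :
  metrizable R T -> hausdorff_space T.
Proof. by move=> [d dT]; exact: metric_hausdorff dT. Qed.

Section Truncation.
Context (n : nat) (E : game_spaces n).

Lemma eq_trunc t (w w' : play E) : w.1 = w'.1 ->
  (forall k, (k < t)%N -> w.2 k = w'.2 k) -> trunc t w = trunc t w'.
Proof.
move=> w1; elim: t => //= t IH w2; rewrite w2// IH// => k kt.
by apply: w2; exact: ltnW.
Qed.

Lemma trunc_le s t (w w' : play E) : (s <= t)%N ->
  trunc t w = trunc t w' -> trunc s w = trunc s w'.
Proof.
move=> /subnKC <-; elim: (t - s)%N => [|k IH]; first by rewrite addn0.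
by rewrite addnS => -[/IH].
Qed.

Lemma trunc_surj t (h : hist E t) : exists w, trunc t w = h.
Proof.
elim: t h => [h|t IH [h y]]; first by exists (h, point).
have [w <-] := IH h; exists (w.1, dfwith w.2 t y) => /=; congr pair.
  by apply: eq_trunc => // k kt /=; rewrite dfwithout// gtn_eqF.
by rewrite dfwithin.
Qed.

Lemma trunc_lim (h : forall t, hist E t) :
  (forall t, (h t.+1).1 = h t) -> exists w, forall t, trunc t w = h t.
Proof.
move=> hE; exists (h 0, fun t => (h t.+1).2); elim=> //= t ->.
by rewrite -(hE t); case: (h t.+1).
Qed.

Lemma trunc_continuous t : continuous (@trunc n E t).
Proof.
elim: t => [w|t IH w] /=; first exact: cvg_fst.
have snd_w : snd @ nbhs w --> w.2 by case: w => w1 w2; exact: cvg_snd.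
have proj_w := cvg_comp _ _ snd_w (@proj_continuous _ _ t w.2).
move=> A [[P Q] /= [nP nQ] PQA].
suff : nbhs w (trunc t.+1 @^-1` A) by [].
apply: (@filterS2 _ (nbhs w) (nbhs_filter w) _ _ _ _ (IH w P nP) (proj_w Q nQ)) => w' Pw' Qw'.
exact: (PQA (trunc t w', w'.2 t)).
Qed.

End Truncation.

Section Histories.
Context (R : realType) (n : nat) (G : game R n).
Hypothesis G_game : is_dynamic_game G.

Lemma act_countable_subbase t i : countable_subbase (act G t i).
Proof. exact: polish_countable_subbase (act_polish G_game t i). Qed.

Lemma act_profile_countable_subbase t : countable_subbase (prod_topology (act G t)).
Proof. by apply: countable_subbase_prod_topology => i; exact: act_countable_subbase. Qed.

Lemma chance_countable_subbase t : countable_subbase (chance G t).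
Proof. exact: polish_countable_subbase (chance_polish G_game t). Qed.

Lemma stage_countable_subbase t : countable_subbase (stage G t).
Proof.
by apply: countable_subbase_pair; [exact: act_profile_countable_subbase|exact:
    chance_countable_subbase].
Qed.

Lemma hist_countable_subbase t : countable_subbase (hist G t).
Proof.
elim: t => [|t IH] /=; apply: countable_subbase_pair => //.
- have [d dT] := act0_metrizable G_game.
  exact: compact_countable_subbase dT (act0_compact G_game).
- exact: polish_countable_subbase (chance0_polish G_game).
- exact: stage_countable_subbase.
Qed.

Lemma act_hausdorff t i : hausdorff_space (act G t i).
Proof. exact: metrizable_hausdorff (polish_metrizable (act_polish G_game t i)). Qed.

Lemma action_closed t i (h : hist G t) : Hist h -> closed (action i h).
Proof.
by move=> Hh; apply: compact_closed; [exact: act_hausdorff|exact: (action_compact G_game)].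
Qed.

(** By induction on the stage: an upper hemicontinuous correspondence with closed values in a metric
    space has a closed graph. *)
Lemma Hist_closed t : closed (@Hist R n G t).
Proof.
elim: t => [|t IH]; first exact: closedT.
rewrite -openC openE => -[h [x s]] /= nH.
have [Hh|nHh] := pselect (Hist h); last first.
  exists (~` @Hist R n G t, setT) => /=; last by move=> p [/= nHp _] [].
  split; last exact: filterT.
  by apply: open_nbhs_nbhs; split => //; exact: closed_openC.
have [i nix] : exists i, ~ action i h (x i).
  by apply: contrapT => /forallNP H; apply: nH; split=> // i; apply: contrapT; exact: H.
have [d dT] := polish_metrizable (act_polish G_game t i).
have [r r0 rA] : exists2 r : R, 0 < r & forall y, d (x i) y < r -> ~ action i h y.
  apply/(metric_nbhsP dT); apply: open_nbhs_nbhs; split => //.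
  exact/closed_openC/action_closed.
(* Actions available at [h] are at distance at least [r] from [x i]. For nearby histories they stay
   in the open set [far], while nearby points stay within [r / 2] of [x i]. *)
pose far := [set y | r / 2 < d (x i) y].
have ofar : open far.
  rewrite openE => y /= ry; apply/(metric_nbhsP dT); exists (d (x i) y - r / 2).
    by rewrite subr_gt0.
  move=> z yz; have := metric_triangle dT (x i) z y; rewrite /far/= (metric_sym dT z y).
  by lra.
have Afar : action i h `<=` far.
  move=> y Ay; rewrite /far/= ltNge; apply/negP => yr; apply: (rA y) => //.
  by lra.
have := @action_uhc _ _ _ G_game t i h Hh far ofar Afar; rewrite near_withinE => near_far.
have near_x : \forall x' \near x, d (x i) (x' i) < r / 2.
  have : \forall y \near x i, d (x i) y < r / 2.
    by apply/(metric_nbhsP dT); exists (r / 2) => //; lra.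
  exact: (@proj_continuous _ _ i x).
exists ([set h' | Hist h' -> action i h' `<=` far],
        [set y : stage G t | d (x i) (y.1 i) < r / 2]) => /=.
  split=> //; exists ([set x' | d (x i) (x' i) < r / 2], setT) => /=; last by move=> y [].
  by split; [exact: near_x|exact: filterT].
move=> [h' y] [/= fh' xy] [Hh' Ay].
by have := fh' Hh' _ (Ay i); rewrite /far/= ltNge (ltW xy).
Qed.

Lemma Hist_measurable t : measurable (@Hist R n G t : set (borel (hist G t))).
Proof. exact: (@borel_closed (hist G t) _ (@Hist_closed t)). Qed.

Lemma Hinf_closed : closed (@Hinf R n G).
Proof.
rewrite (_ : @Hinf R n G = \bigcap_t (@trunc n G t @^-1` @Hist R n G t)).
  apply: closed_bigI => t _; apply: closed_comp; last exact: Hist_closed.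
  by move=> w _; exact: trunc_continuous.
by apply/seteqP; split=> w H t; [move=> _|]; exact: H.
Qed.

Lemma Hist_trunc_le s t (w : play G) : (s <= t)%N -> Hist (trunc t w) -> Hist (trunc s w).
Proof.
move=> /subnKC <-; elim: (t - s)%N => [|k IH]; first by rewrite addn0.
by rewrite addnS => -[/IH].
Qed.

Lemma Hist_extend t (h : hist G t) : Hist h -> exists w, Hinf w /\ trunc t w = h.
Proof.
move=> Hh; have [w0 w0h] := trunc_surj h.
have choice_act m (h' : hist G m) : exists x : prod_topology (act G m),
    Hist h' -> forall i, action i h' (x i).
  have [Hh'|nHh'] := pselect (Hist h'); last by exists point.
  exists (fun i => sval (cid (action_nonempty G_game i Hh'))) => _ i.
  exact: svalP (cid (action_nonempty G_game i Hh')).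
pose a m h' := sval (cid (choice_act m h')).
(* Follows [w0] up to stage [t] and then chosen feasible actions. [Hist] does not constrain Nature's
   coordinates, so [point] serves for them. *)
pose hs := fix hs m : hist G m := match m with
  | 0 => w0.1
  | m'.+1 => (hs m', if (m' < t)%N then w0.2 m' else (a m' (hs m'), point))
  end.
have [//|w wE] := @trunc_lim _ G hs.
have hs_t m : (m <= t)%N -> hs m = trunc m w0.
  by elim: m => //= m IH mt; rewrite mt IH// ltnW.
exists w; split; last by rewrite wE hs_t.
move=> m; rewrite wE; elim: m => //= m IH; split=> //=.
case: ifPn => [mt|_] i; last exact: (svalP (cid (choice_act m (hs m)))).
have : Hist (trunc m.+1 w0) by apply: (Hist_trunc_le mt); rewrite w0h.
by move=> [_ /= /(_ i)]; rewrite hs_t// ltnW.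
Qed.

End Histories.

Lemma lsc_comp (R : realType) (T U : topologicalType) (D : set T) (D' : set U)
    (f : T -> U) (V : U -> R) :
  continuous f -> (forall x, D x -> D' (f x)) -> lsc_on D' V -> lsc_on D (V \o f).
Proof.
move=> cf DD lV x Dx a /(lV _ (DD x Dx)); rewrite !near_withinE => nfx.
have nx : nbhs x (f @^-1` [set y | D' y -> a < V y]) := cf x _ nfx.
by apply: filterS _ nx => y /= H /DD.
Qed.

Lemma prod_topology_finite_box (I : finType) (T : I -> topologicalType)
    (x : prod_topology T) (A : set (prod_topology T)) :
  nbhs x A -> exists V : forall i, set (T i), (forall i, nbhs (x i) (V i)) /\
    forall y : prod_topology T, (forall i, V i (y i)) -> A y.
Proof.
pose F := [set B : set (prod_topology T) | exists V : forall i, set (T i),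
  (forall i, nbhs (x i) (V i)) /\ forall y : prod_topology T, (forall i, V i (y i)) -> B y].
suff FP : F `=>` nbhs x by exact: FP.
have FF : Filter F.
  split; first by exists (fun=> setT); split=> // i; exact: filterT.
    move=> P Q [V [nV VP]] [W [nW WQ]]; exists (fun i => V i `&` W i).
    split=> [i|y VW]; first exact: filterI.
    by split; [apply: VP|apply: WQ] => i; have [] := VW i.
  by move=> P Q PQ [V [nV VP]]; exists V; split=> // y /VP /PQ.
apply/cvg_sup => i P; rewrite nbhsE /= => -[Q [[V oV VQ] Qf] QP].
have Vf : V (x i) by rewrite -VQ in Qf.
exists (dfwith (fun=> setT) i V); split=> [j|y Vy].
  by case: dfwithP => [|j' _]; [exact: open_nbhs_nbhs|exact: filterT].
by apply: QP; rewrite -VQ /=; have := Vy i; rewrite dfwithin.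
Qed.

(** * Neighbourhoods of a play *)

Section PlayNeighborhoods.
Context (n : nat) (E : game_spaces n).

Definition finitely_determined (w0 : play E) (V : set (play E)) : Prop :=
  exists t (B : set (hist E t)), nbhs (trunc t w0) B /\
    forall w, B (trunc t w) -> V w.

Lemma finitely_determined_lift w0 s t (B : set (hist E s)) : (s <= t)%N ->
  nbhs (trunc s w0) B -> exists C : set (hist E t), nbhs (trunc t w0) C /\
    forall w, C (trunc t w) -> B (trunc s w).
Proof.
move=> /subnKC <-; elim: (t - s)%N => [|k IH] nB; first by rewrite addn0; exists B.
rewrite addnS; have [C [nC CB]] := IH nB.
exists [set h | C h.1]; split=> [|w /= /CB//].
by exists (C, setT) => /=; [split=> //; exact: filterT|move=> h []].
Qed.

(** A neighbourhood in the infinite product constrains finitely many stages; this reduces statements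
    about plays to statements about histories of some finite length. *)
Lemma play_nbhs_finitely_determined w0 V : nbhs w0 V -> finitely_determined w0 V.
Proof.
have FF : Filter (finitely_determined w0).
  split; first by exists 0, setT; split=> //; exact: filterT.
    move=> P Q [s [B [nB BP]]] [t [C [nC CQ]]].
    have [B' [nB' BB']] := finitely_determined_lift (leq_maxl s t) nB.
    have [C' [nC' CC']] := finitely_determined_lift (leq_maxr s t) nC.
    exists (maxn s t), (B' `&` C'); split; first exact: filterI.
    by move=> w [/BB'/BP Pw /CC'/CQ Qw].
  by move=> P Q PQ [t [B [nB BP]]]; exists t, B; split=> // w /BP /PQ.
move=> [[P Q] /= [nP nQ] PQV]; apply: (@filterS _ _ FF _ _ PQV); apply: filterI.
  by exists 0, P; split.
pose F := [set Q : set (prod_topology (stage E)) | finitely_determined w0 [set w | Q w.2]].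
suff FQ : F `=>` nbhs w0.2 by exact: FQ.
have F_filter : Filter F.
  split; first by exists 0, setT; split=> //; exact: filterT.
    by move=> A B FA FB; exact: (@filterI _ _ FF _ _ FA FB).
  by move=> A B AB FA; apply: (@filterS _ _ FF _ _ _ FA) => w; exact: AB.
apply/cvg_sup => k A; rewrite nbhsE /= => -[B [[W oW WB] Bw] BA].
exists k.+1, [set h | W h.2]; split=> [|w /= Ww]; last by apply: BA; rewrite -WB.
exists (setT, W) => /=; last by move=> h [].
split; first exact: filterT.
by apply: open_nbhs_nbhs; split=> //; rewrite -WB in Bw.
Qed.

End PlayNeighborhoods.

(** * Continuations of a history and their payoffs *)

Section Continuations.
Context (R : realType) (n : nat) (G : game R n).
Hypothesis G_game : is_dynamic_game G.

Definition continuations t (h : hist G t) : set (play G) :=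
  [set w | Hinf w /\ trunc t w = h].

Lemma continuations_neq0 t (h : hist G t) : Hist h -> continuations h !=set0.
Proof. by move=> /(Hist_extend G_game)[w wh]; exists w. Qed.

(** Induction on [T], starting at [t]: lower hemicontinuity of each action correspondence along [w0]
    lets a play from a nearby history imitate [w0] for one more stage. *)
Lemma continuations_near t T (w0 : play G) (B : set (hist G T)) : (t <= T)%N ->
  Hinf w0 -> nbhs (trunc T w0) B ->
  \forall h \near within (@Hist R n G t) (nbhs (trunc t w0)),
    exists2 w, continuations h w & B (trunc T w).
Proof.
elim: T B => [|T IH] B tT Hw0 nB; move: tT.
  rewrite leqn0 => /eqP tT; subst t; rewrite near_withinE.
  by apply: filterS _ nB => h Bh /(Hist_extend G_game)[w [Hw wh]]; exists w => //; rewrite wh.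
rewrite leq_eqVlt => /orP[/eqP tT|tT].
  subst t; rewrite near_withinE.
  by apply: filterS _ nB => h Bh /(Hist_extend G_game)[w [Hw wh]]; exists w => //; rewrite wh.
have [[P Q] /= [nP [[Qx Qs] /= [nQx nQs] QQ]] PQ] := nB.
have [V [nV VQ]] := prod_topology_finite_box nQx.
have nA : nbhs (trunc T w0) [set h | Hist h -> forall i, action i h `&` (V i)^° !=set0].
  have : \forall h \near trunc T w0, forall i, Hist h -> action i h `&` (V i)^° !=set0.
    apply: filter_forall => i; have := @action_lhc _ _ _ G_game T i (trunc T w0) (Hw0 T) (V i)^°.
    rewrite -near_withinE; apply; first exact: open_interior.
    exists ((w0.2 T).1 i); split; last exact: nV.
    by have [_] := Hw0 T.+1; exact.
  by apply: filterS => h H Hh i; exact: H.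
have := IH _ tT Hw0 (@filterI _ _ (nbhs_filter _) _ _ nP nA); rewrite !near_withinE.
apply: filterS => h IHh /IHh[w [Hw wh] [Pw Aw]].
pose x : prod_topology (act G T) := fun i => sval (cid (Aw (Hw T) i)).
have xP i : action i (trunc T w) (x i) /\ (V i)^° (x i) := svalP (cid (Aw (Hw T) i)).
(* Nature's move is copied from [w0]; only the actions have to be adapted to the new history. *)
have Hwx : @Hist R n G T.+1 (trunc T w, (x, (w0.2 T).2)).
  by split=> [|i] /=; [exact: Hw|have [] := xP i].
have [w' [Hw' w'E]] := Hist_extend G_game Hwx.
exists w'; last first.
  rewrite -[X in B X]/(trunc T.+1 w') w'E; apply: PQ; split => //=; apply: QQ; split=> /=; last
      exact: nbhs_singleton.
  by apply: VQ => i; apply: interior_subset; have [] := xP i.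
split=> //; rewrite -wh; apply: (trunc_le (t := T)) => //.
by move: w'E => /= [].
Qed.

Lemma continuations_lhc t :
  lower_hemicontinuous (@Hist R n G t) (@continuations t).
Proof.
move=> h Hh V oV [w0 [[Hw0 w0h] Vw0]].
have [T [B [nB BV]]] := play_nbhs_finitely_determined (open_nbhs_nbhs (conj oV Vw0)).
have [C [nC CB]] := finitely_determined_lift (leq_maxr t T) nB.
have := continuations_near (leq_maxl t T) Hw0 nC; rewrite w0h.
by rewrite !near_withinE; apply: filterS => h' H /H[w wh' /CB/BV Vw]; exists w.
Qed.

Lemma payoff_uniform_bound :
  exists2 M, 0 <= M & forall i w, Hinf w -> `|payoff_fun G i w| <= M.
Proof.
have : \forall M \near +oo, forall i w, Hinf w -> `|payoff_fun G i w| <= M.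
  by apply: filter_forall => i; exact: (payoff_bounded G_game i).
move=> H; have [M [M0 HM]] := filter_ex (filterI H (nbhs_pinfty_ge (num_real (0 : R)))).
by exists M.
Qed.

(** Equal truncations at [t] mean equal truncations of all orders below [t.+1], whence the index of
    the oscillation. *)
Lemma tail_oscillationP i t (w w' : play G) : Hinf w -> Hinf w' ->
  trunc t w = trunc t w' ->
  `|payoff_fun G i w - payoff_fun G i w'| <= tail_oscillation G t.+1.
Proof.
move=> Hw Hw' ww'; apply: ub_le_sup; last first.
  by exists i, w, w'; split=> // k kt; exact: trunc_le ww'.
have [M M0 uM] := payoff_uniform_bound; exists (M + M).
move=> _ [j [v [v' [Hv Hv' _ ->]]]].
by rewrite (le_trans (ler_normB _ _))// lerD ?uM.
Qed.

(** Settling the tail by a supremum, rather than by a fixed continuation, starts the backward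
    induction from a lower semicontinuous function: continuations depend lower hemicontinuously on
    the history. *)
Definition best_continuation i t (h : hist G t) : R :=
  sup [set payoff_fun G i w | w in continuations h].

Lemma best_continuation_lsc i t : lsc_on (@Hist R n G t) (@best_continuation i t).
Proof.
have [M M0 uM] := payoff_uniform_bound.
apply: (@sup_lsc R _ _ (@Hist R n G t) (@continuations t) (fun p => payoff_fun G i p.2) _ M).
- apply: (@lsc_comp _ _ _ _ (@Hinf R n G) snd (payoff_fun G i)).
  + by move=> [h w]; exact: cvg_snd.
  + by move=> p [_ []].
  + exact: (@continuous_lsc _ _ _ _ (@payoff_continuous _ _ _ G_game i)).
- exact: continuations_lhc.
- by move=> h; exact: continuations_neq0.
- by move=> h w _ [Hw _] /=; rewrite (le_trans (ler_norm _))// uM.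
Qed.

Lemma best_continuation_ge i t (h : hist G t) w : continuations h w ->
  payoff_fun G i w <= best_continuation i h.
Proof.
move=> hw; have [M M0 uM] := payoff_uniform_bound.
apply: ub_le_sup; last by exists w.
by exists M => _ [w' [Hw' _] <-]; rewrite (le_trans (ler_norm _))// uM.
Qed.

Lemma best_continuation_le i t (h : hist G t) r : Hist h ->
  (forall w, continuations h w -> payoff_fun G i w <= r) -> best_continuation i h <= r.
Proof.
move=> Hh ur; apply: ge_sup; last by move=> _ [w hw <-]; exact: ur.
by have [w hw] := continuations_neq0 Hh; exists (payoff_fun G i w), w.
Qed.

Definition stage_value t (V : hist G t.+1 -> R) (h : hist G t)
    (z : prod_topology (act G t)) : R :=
  \int[nature h]_s V (h, (z, s)).

Definition feasible t : set (hist G t * prod_topology (act G t)) :=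
  [set p | Hist p.1 /\ forall i, action i p.1 (p.2 i)].

Lemma stage_value_lsc t (V : hist G t.+1 -> R) M :
  (forall h, Hist h -> `|V h| <= M) -> lsc_on (@Hist R n G t.+1) V ->
  lsc_on (@feasible t) (fun p => stage_value V p.1 p.2).
Proof.
move=> VM lV.
apply: (@integral_lsc R _ _ (@feasible t)
  (fun p => nature p.1) (fun q => V (q.1.1, (q.1.2, q.2))) M).
- exact: polish_metrizable (chance_polish G_game t).
- by apply: countable_subbase_pair; [exact: hist_countable_subbase|exact:
    act_profile_countable_subbase].
- apply/subspace_continuousP => -[h z] [Hh Az] W nW.
  have nh : nbhs h [set h' | Hist h' -> W (nature h')].
    exact: ((subspace_continuousP _ _).1 (@nature_continuous _ _ _ G_game t) h Hh W nW).
  suff H : nbhs (h, z) [set p | @feasible t p -> W (nature p.1)] by exact: H.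
  exists ([set h' | Hist h' -> W (nature h')], setT) => /=.
    by split=> //; exact: filterT.
  by move=> [h' z'] [/= Wh' _] [/= /Wh'].
- by move=> p s [Hp Ap]; apply: VM.
- apply: (@lsc_comp _ _ _ _ (@Hist R n G t.+1) (fun q => (q.1.1, (q.1.2, q.2))) V) => //.
    exact: prodA_continuous.
  by move=> [p s] [[Hp Ap] _].
Qed.

End Continuations.

Lemma prod_topology_continuous (W : topologicalType) (I : Type)
    (T : I -> topologicalType) (f : W -> prod_topology T) :
  (forall i, continuous (fun w => f w i)) -> continuous f.
Proof.
move=> cf w; apply/cvg_sup => i P; rewrite nbhsE /= => -[Q [[V oV VQ] Qf] QP].
have Vf : V (f w i) by rewrite -VQ in Qf.
have nV : nbhs w [set w' | V (f w' i)] := cf i w V (open_nbhs_nbhs (conj oV Vf)).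
by apply: filterS _ nV => w' Vw'; apply: QP; rewrite -VQ.
Qed.

Section StageValue.
Context (R : realType) (n : nat) (G : game R n).

(** The invariant of the backward induction. A single [M] serves at all stages, and semicontinuity
    also supplies the measurability needed to integrate. *)
Definition admissible t (M : R) (V : hist G t -> R) : Prop :=
  (forall h, Hist h -> `|V h| <= M) /\ lsc_on (@Hist R n G t) V.

Context (t : nat) (M : R) (h : hist G t) (z : prod_topology (act G t)).
Hypothesis hz : feasible (h, z).

Let Hist_next s : @Hist R n G t.+1 (h, (z, s)).
Proof. by have [Hh Az] := hz; split. Qed.

Lemma stage_integrable (V : hist G t.+1 -> R) : admissible M V ->
  (nature h).-integrable setT (EFin \o (fun s => V (h, (z, s)))).
Proof.
move=> [VM lV]; apply: (@bounded_integrable _ _ _ _ _ _ M) => //; last first.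
  by move=> s _; exact: VM.
apply: lsc_measurable; apply: (@lsc_comp _ _ _ _ (@Hist R n G t.+1) (fun s => (h, (z, s))) V) =>
    //.
move=> s A [[P Q] /= [nP [[Qz Qs] /= [nQz nQs] QQ]] PQA].
apply: filterS _ nQs => s' Qs'; apply: PQA; split=> /=; first exact: nbhs_singleton.
by apply: QQ; split=> //=; exact: nbhs_singleton.
Qed.

Lemma stage_value_le (V V' : hist G t.+1 -> R) : admissible M V -> admissible M V' ->
  (forall h', Hist h' -> V h' <= V' h') -> stage_value V h z <= stage_value V' h z.
Proof.
move=> aV aV' VV'; apply: le_Rintegral => //; [exact: stage_integrable|exact: stage_integrable|].
by move=> s _; exact: VV'.
Qed.

Lemma stage_value_cst c : stage_value (fun=> c) h z = c.
Proof.
have hT : nature h setT = 1%E by exact: probability_setT.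
by rewrite /stage_value Rintegral_cst// [X in fine X]hT mulr1.
Qed.

Lemma stage_value_bound (V : hist G t.+1 -> R) a b : admissible M V ->
  (forall s, a <= V (h, (z, s)) <= b) -> a <= stage_value V h z <= b.
Proof.
move=> aV Vab; have cst_int c : (nature h).-integrable setT (EFin \o (fun=> c)).
  by apply: (@bounded_integrable _ _ _ _ _ _ `|c|).
rewrite -[X in X <= _](stage_value_cst a) -[X in _ <= _ <= X](stage_value_cst b).
by apply/andP; split; apply: le_Rintegral => //; do ?exact: stage_integrable;
  move=> s _; have /andP[] := Vab s.
Qed.

(** Two-sided bounds instead of an equation, since truncated values of the two players only add up
    to something between 0 and the tail oscillation. *)
Lemma stage_valueD (V V' : hist G t.+1 -> R) a b : admissible M V -> admissible M V' ->
  (forall h', Hist h' -> a <= V h' + V' h' <= b) ->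
  a <= stage_value V h z + stage_value V' h z <= b.
Proof.
move=> aV aV' VV'.
have iV := stage_integrable aV; have iV' := stage_integrable aV'.
have cst_int c : (nature h).-integrable setT (EFin \o (fun=> c)).
  by apply: (@bounded_integrable _ _ _ _ _ _ `|c|).
rewrite -[X in X <= _](stage_value_cst a) -[X in _ <= _ <= X](stage_value_cst b).
rewrite /stage_value -RintegralD//.
by apply/andP; split; apply: le_Rintegral => //; do ?exact: (integrableD measurableT iV iV');
  move=> s _; have /andP[] := VV' _ (Hist_next s).
Qed.

End StageValue.

Section Values.
Context (R : realType) (G : game R 2).

(** Naming the players [i] and [j], in either order, lets each later result serve both of them. *)
Definition joint t (i j : 'I_2) (x : act G t i) (y : act G t j) :
    prod_topology (act G t) :=
  dfwith (dfwith (point : prod_topology (act G t)) i x) j y.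

Lemma ord2_eq (i j k : 'I_2) : i != j -> k = i \/ k = j.
Proof.
have [->|] := eqVneq k i; first by left.
move=> ki ij; right; apply: val_inj; move: ki ij; rewrite -!val_eqE /=.
by case: i j k => i ? [j ?] [k ?] /=; lia.
Qed.

Lemma joint_fst t i j (x : act G t i) (y : act G t j) : i != j -> joint x y i = x.
Proof. by move=> ij; rewrite /joint dfwithout ?dfwithin// eq_sym. Qed.

Lemma joint_snd t i j (x : act G t i) (y : act G t j) : joint x y j = y.
Proof. by rewrite /joint dfwithin. Qed.

Lemma joint_eta t i j (z : prod_topology (act G t)) : i != j ->
  joint (z i) (z j) = z.
Proof.
move=> ij; apply: functional_extensionality_dep => k.
by have [->|->] := ord2_eq k ij; [exact: joint_fst|exact: joint_snd].
Qed.

Lemma jointC t i j (x : act G t i) (y : act G t j) : i != j -> joint y x = joint x y.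
Proof.
by move=> ij; rewrite -(joint_eta (joint x y) (i := j) (j := i)) 1?eq_sym// joint_fst// joint_snd.
Qed.

Lemma joint_feasible t i j (h : hist G t) (x : act G t i) (y : act G t j) : i != j ->
  Hist h -> action i h x -> action j h y -> feasible (h, joint x y).
Proof.
move=> ij Hh Ax Ay; split=> //= k.
by have [->|->] := ord2_eq k ij; [rewrite joint_fst|rewrite joint_snd].
Qed.

Lemma joint_continuous t i j : i != j ->
  continuous (fun p : hist G t * act G t i * act G t j => (p.1.1, joint p.1.2 p.2)).
Proof.
move=> ij [[h x] y].
have c1 : continuous (fun p : hist G t * act G t i * act G t j => p.1.1).
  by move=> [[h' x'] y']; apply: (@cvg_comp _ _ _ fst fst _ (nbhs (h', x'))); exact: cvg_fst.
have c2 : continuous (fun p : hist G t * act G t i * act G t j => joint p.1.2 p.2).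
  apply: prod_topology_continuous => k; have [->|->] := ord2_eq k ij.
    under eq_fun do rewrite joint_fst//.
    by move=> [[h' x'] y']; apply: (@cvg_comp _ _ _ fst snd _ (nbhs (h', x'))); [exact:
        cvg_fst|exact: cvg_snd].
  by under eq_fun do rewrite joint_snd; move=> [p y']; exact: cvg_snd.
move=> A [[P Q] /= [nP nQ] PQA].
suff H : nbhs (h, x, y) [set p | A (p.1.1, joint p.1.2 p.2)] by exact: H.
have n1 : nbhs (h, x, y) [set p | P p.1.1] := c1 (h, x, y) P nP.
have n2 : nbhs (h, x, y) [set p | Q (joint p.1.2 p.2)] := c2 (h, x, y) Q nQ.
move: n1 n2; apply: filterS2 => p Pp Qp.
exact: (PQA (p.1.1, joint p.1.2 p.2)).
Qed.

End Values.

(** * Values of a stage and of the game *)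

Lemma upper_hemicontinuous_fst (Z Y X : topologicalType) (D : set Z) (D' : set (Z * Y))
    (F : Z -> set X) :
  (forall p, D' p -> D p.1) -> upper_hemicontinuous D F ->
  upper_hemicontinuous D' (fun p => F p.1).
Proof.
move=> DD uF [z y] /DD/= Dz V oV FV; have := uF z Dz V oV FV.
rewrite !near_withinE => nz; exists ([set z' | D z' -> F z' `<=` V], setT) => /=.
  by split=> //; exact: filterT.
by move=> [z' y'] [/= H _] /DD/H.
Qed.

Lemma lower_hemicontinuous_fst (Z Y X : topologicalType) (D : set Z) (D' : set (Z * Y))
    (F : Z -> set X) :
  (forall p, D' p -> D p.1) -> lower_hemicontinuous D F ->
  lower_hemicontinuous D' (fun p => F p.1).
Proof.
move=> DD lF [z y] /DD/= Dz V oV FV; have := lF z Dz V oV FV.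
rewrite !near_withinE => nz; exists ([set z' | D z' -> F z' `&` V !=set0], setT) => /=.
  by split=> //; exact: filterT.
by move=> [z' y'] [/= H _] /DD/H.
Qed.

Section Maxmin.
Context (R : realType) (G : game R 2) (M : R) (t : nat) (i j : 'I_2).
Hypothesis G_game : is_dynamic_game G.
Hypothesis ij : i != j.
Implicit Types (V : hist G t.+1 -> R) (h : hist G t).

Definition security V h (x : act G t i) : R :=
  inf [set stage_value V h (joint x y) | y in action j h].

Definition maxmin V h : R := sup [set security V h x | x in action i h].

Lemma joint_stage_value_lsc V : admissible M V ->
  lsc_on (graph_on (graph_on (@Hist R 2 G t) (action i)) (fun p => action j p.1))
    (fun q => stage_value V q.1.1 (joint q.1.2 q.2)).
Proof.
move=> [VM lV].
apply: (@lsc_comp _ _ _ _ (@feasible R 2 G t)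
  (fun p : hist G t * act G t i * act G t j => (p.1.1, joint p.1.2 p.2))
  (fun p => stage_value V p.1 p.2)).
- exact: joint_continuous.
- by move=> [[h x] y] [[/= Hh Ax] Ay]; exact: joint_feasible.
- exact: (stage_value_lsc G_game VM lV).
Qed.

Lemma stage_value_abs V h x y : admissible M V -> Hist h -> action i h x ->
  action j h y -> `|stage_value V h (joint x y)| <= M.
Proof.
move=> aV Hh Ax Ay; have hz := joint_feasible ij Hh Ax Ay.
rewrite ler_norml; apply: (stage_value_bound hz aV) => s.
by rewrite -ler_norml; case: aV => VM _; apply: VM; have [] := hz; split.
Qed.

Lemma security_le V h x y : admissible M V -> Hist h -> action i h x ->
  action j h y -> security V h x <= stage_value V h (joint x y).
Proof.
move=> aV Hh Ax Ay; apply: ge_inf; last by exists y.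
exists (- M) => _ [y' Ay' <-].
by have := stage_value_abs aV Hh Ax Ay'; rewrite ler_norml => /andP[].
Qed.

Lemma le_security V h x r : Hist h ->
  (forall y, action j h y -> r <= stage_value V h (joint x y)) -> r <= security V h x.
Proof.
move=> Hh rV; apply: lb_le_inf; last by move=> _ [y Ay <-]; exact: rV.
have [y Ay] := action_nonempty G_game j Hh.
by exists (stage_value V h (joint x y)), y.
Qed.

Lemma security_le_maxmin V h x : admissible M V -> Hist h -> action i h x ->
  security V h x <= maxmin V h.
Proof.
move=> aV Hh Ax; apply: ub_le_sup; last by exists x.
exists M => _ [x' Ax' <-]; have [y Ay] := action_nonempty G_game j Hh.
apply: le_trans (security_le aV Hh Ax' Ay) _.
by have := stage_value_abs aV Hh Ax' Ay; rewrite ler_norml => /andP[].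
Qed.

Lemma maxmin_le V h r : Hist h ->
  (forall x, action i h x -> security V h x <= r) -> maxmin V h <= r.
Proof.
move=> Hh Vr; apply: ge_sup; last by move=> _ [x Ax <-]; exact: Vr.
have [x Ax] := action_nonempty G_game i Hh.
by exists (security V h x), x.
Qed.

Lemma security_lsc V : admissible M V ->
  lsc_on (graph_on (@Hist R 2 G t) (action i)) (fun p => security V p.1 p.2).
Proof.
move=> aV; apply: (inf_lsc (joint_stage_value_lsc aV)).
- by apply: (upper_hemicontinuous_fst _ (@action_uhc _ _ _ G_game t j)) => p [].
- by move=> p [Hp _]; exact: (action_nonempty G_game).
- by move=> p [Hp _]; exact: (action_compact G_game).
- move=> [h x] [/= Hh Ax]; exists (- M) => _ [y Ay <-].
  by have := stage_value_abs aV Hh Ax Ay; rewrite ler_norml => /andP[].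
Qed.

Lemma maxmin_admissible V : admissible M V -> admissible M (maxmin V).
Proof.
move=> aV; split=> [h Hh|].
  have [x Ax] := action_nonempty G_game i Hh.
  rewrite ler_norml; apply/andP; split.
    apply: le_trans (security_le_maxmin aV Hh Ax); apply: le_security => // y Ay.
    by have := stage_value_abs aV Hh Ax Ay; rewrite ler_norml => /andP[].
  apply: maxmin_le => // x' Ax'; have [y Ay] := action_nonempty G_game j Hh.
  apply: le_trans (security_le aV Hh Ax' Ay) _.
  by have := stage_value_abs aV Hh Ax' Ay; rewrite ler_norml => /andP[].
apply: (@sup_lsc R _ _ (@Hist R 2 G t) (action i) (fun p => security V p.1 p.2) _ M).
- exact: security_lsc.
- exact: (@action_lhc _ _ _ G_game t i).
- by move=> h Hh; exact: (action_nonempty G_game).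
- move=> h x Hh Ax /=; have [y Ay] := action_nonempty G_game j Hh.
  apply: le_trans (security_le aV Hh Ax Ay) _.
  by have := stage_value_abs aV Hh Ax Ay; rewrite ler_norml => /andP[].
Qed.

Lemma le_maxmin V V' h : admissible M V -> admissible M V' -> Hist h ->
  (forall k, Hist k -> V k <= V' k) -> maxmin V h <= maxmin V' h.
Proof.
move=> aV aV' Hh VV'; apply: maxmin_le => // x Ax.
apply: le_trans (security_le_maxmin aV' Hh Ax); apply: le_security => // y Ay.
apply: le_trans (security_le aV Hh Ax Ay) _.
exact: (stage_value_le (joint_feasible ij Hh Ax Ay) aV aV' VV').
Qed.

Lemma maxmin_le_cst V h r : admissible M V -> Hist h ->
  (forall z s, feasible (h, z) -> V (h, (z, s)) <= r) -> maxmin V h <= r.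
Proof.
move=> aV Hh Vr; apply: maxmin_le => // x Ax.
have [y Ay] := action_nonempty G_game j Hh.
apply: le_trans (security_le aV Hh Ax Ay) _.
have hz := joint_feasible ij Hh Ax Ay.
have [] // := andP (@stage_value_bound _ _ _ _ M h _ hz V (- M) r aV _).
move=> s; rewrite Vr// andbT; have [VM _] := aV.
have : `|V (h, (joint x y, s))| <= M by apply: VM; have [] := hz; split.
by rewrite ler_norml => /andP[].
Qed.

End Maxmin.

Section Minimax.
Context (R : realType) (G : game R 2) (M : R) (t : nat) (i j : 'I_2).
Hypothesis G_game : is_dynamic_game G.
Hypothesis G_perfect : perfect_information G.
Hypothesis ij : i != j.

(** When [l] has the single action [y0], one term is a supremum and the other an infimum over the
    same actions of [k], of functions whose sum lies pointwise between [a] and [b]. *)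
Let maxmin_singleton (k l : 'I_2) (V V' : hist G t.+1 -> R) h a b : k != l ->
  admissible M V -> admissible M V' -> Hist h ->
  (forall h', Hist h' -> a <= V h' + V' h' <= b) -> is_singleton (action l h) ->
  a <= maxmin k l V h + maxmin l k V' h <= b.
Proof.
move=> kl aV aV' Hh VV' [y0 Al]; have lk : l != k by rewrite eq_sym.
have Ay0 : action l h y0 by rewrite Al.
have sum x : action k h x ->
    a <= stage_value V h (joint x y0) + stage_value V' h (joint y0 x) <= b.
  move=> Ax; rewrite (jointC x y0)//.
  exact: (stage_valueD (joint_feasible kl Hh Ax Ay0) aV aV' VV').
have secV x : action k h x -> security l V h x = stage_value V h (joint x y0).
  by move=> Ax; rewrite /security Al image_set1 inf1.
have -> : maxmin l k V' h = security k V' h y0 by rewrite /maxmin Al image_set1 sup1.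
apply/andP; split.
  rewrite -lerBlDl; apply: (le_security G_game) => // x Ax.
  have /andP[+ _] := sum x Ax; rewrite -lerBlDl; apply: le_trans.
  rewrite lerD2l lerN2 -secV//; exact: (security_le_maxmin G_game kl aV Hh Ax).
rewrite -lerBrDr; apply: (maxmin_le G_game) => // x Ax; rewrite secV//.
have /andP[_] := sum x Ax; rewrite -lerBrDr => /le_trans; apply.
rewrite lerD2l lerN2; exact: (security_le lk aV').
Qed.

Lemma maxmin_minimax (V V' : hist G t.+1 -> R) h a b :
  admissible M V -> admissible M V' -> Hist h ->
  (forall h', Hist h' -> a <= V h' + V' h' <= b) ->
  a <= maxmin i j V h + maxmin j i V' h <= b.
Proof.
(* If [j] has a real choice, perfect information leaves [i] a single action and the roles are
   exchanged. *)
move=> aV aV' Hh VV'; have [sj|/(G_perfect Hh).1[si _]] := pselect (is_singleton (action j h)).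
  exact: maxmin_singleton.
rewrite addrC; apply: maxmin_singleton => //; first by rewrite eq_sym.
  by move=> h' /VV'; rewrite addrC.
exact: si.
Qed.

End Minimax.

Lemma tail_oscillation_small (R : realType) n (G : game R n) (G_game : is_dynamic_game G)
  t e : 0 < e -> exists m, tail_oscillation G (t + m).+1 < e.
Proof.
move=> e0; have /cvgrPdist_lt/(_ e e0)[N _ NP] := game_continuous_at_infinity G_game.
exists N; have := NP (t + N).+1; rewrite /= sub0r normrN => H.
by apply: le_lt_trans (ler_norm _) (H _); rewrite leqW// leq_addl.
Qed.

(** * The value of the game *)

Section Value.
Context (R : realType) (G : game R 2).
Hypothesis G_game : is_dynamic_game G.
Hypothesis G_perfect : perfect_information G.
Hypothesis G_zero_sum : zero_sum G.
Context (M : R).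
Hypothesis payoffM : forall i w, Hinf w -> `|payoff_fun G i w| <= M.

Lemma zero_sum_payoff i j w : i != j -> Hinf w ->
  payoff_fun G i w + payoff_fun G j w = 0.
Proof.
move=> ij /G_zero_sum; move: ij; have o : ord0 != ord_max :> 'I_2 by [].
by have [->|->] := ord2_eq i o; have [->|->] := ord2_eq j o; rewrite ?eqxx// addrC.
Qed.

(* Value for player [i] of the game truncated [m] stages after [t], the tail
   being replaced by its best continuation. *)
Fixpoint upper_value (i j : 'I_2) (m t : nat) : hist G t -> R :=
  if m is m'.+1 then maxmin i j (@upper_value i j m' t.+1)
  else @best_continuation R 2 G i t.

Lemma best_continuation_admissible i t : admissible M (@best_continuation R 2 G i t).
Proof.
split; last exact: best_continuation_lsc.
move=> h Hh; rewrite ler_norml; apply/andP; split.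
  have [w hw] := continuations_neq0 G_game Hh.
  apply: le_trans (best_continuation_ge G_game i hw).
  by have := payoffM i hw.1; rewrite ler_norml => /andP[].
apply: (best_continuation_le G_game) => // w [Hw _].
by have := payoffM i Hw; rewrite ler_norml => /andP[].
Qed.

Lemma upper_value_admissible i j m t : i != j -> admissible M (@upper_value i j m t).
Proof.
move=> ij; elim: m t => [|m IH] t; first exact: best_continuation_admissible.
exact: (maxmin_admissible G_game ij).
Qed.

Lemma upper_value_sum i j m t (h : hist G t) : i != j -> Hist h ->
  0 <= upper_value i j m h + upper_value j i m h <= tail_oscillation G (t + m).+1.
Proof.
move=> ij; elim: m t h => [|m IH] t h Hh.
  rewrite addn0; apply/andP; split.
    have [w hw] := continuations_neq0 G_game Hh.
    rewrite -(zero_sum_payoff ij hw.1).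
    by apply: lerD; exact: (best_continuation_ge G_game).
  rewrite -lerBrDr; apply: (best_continuation_le G_game) => // w [Hw wh].
  rewrite lerBrDr addrC -lerBrDr; apply: (best_continuation_le G_game) => // w' [Hw' w'h].
  (* As the payoff of [i] at [w] is minus that of [j], the sum is a difference of the payoffs of [j]
     at two plays through [h]. *)
  have := @tail_oscillationP _ _ _ G_game j t w' w Hw' Hw; rewrite wh w'h => /(_ erefl).
  by have := zero_sum_payoff ij Hw; rewrite ler_norml => E /andP[_]; lra.
have ji : j != i by rewrite eq_sym.
apply: (maxmin_minimax G_game G_perfect ij (upper_value_admissible m t.+1 ij)
  (upper_value_admissible m t.+1 ji) Hh).
by move=> h' Hh'; rewrite addnS -addSn; exact: IH.
Qed.

(** Continuations of a longer history are among those of [h], so playing one more stage lowers the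
    best continuation; monotonicity of [maxmin] propagates this to all horizons. *)
Lemma upper_value_decr i j m t (h : hist G t) : i != j -> Hist h ->
  upper_value i j m.+1 h <= upper_value i j m h.
Proof.
move=> ij; elim: m t h => [|m IH] t h Hh.
  apply: (maxmin_le_cst G_game ij (best_continuation_admissible i t.+1) Hh).
  move=> z s [_ Az]; apply: (best_continuation_le G_game); first by split.
  move=> w [Hw wh]; apply: (best_continuation_ge G_game); split=> //.
  by move: wh => /= [].
apply: (le_maxmin G_game ij (upper_value_admissible m.+1 t.+1 ij)
  (upper_value_admissible m t.+1 ij) Hh).
by move=> h' Hh'; exact: IH.
Qed.

Lemma upper_value_le i j m m' t (h : hist G t) : i != j -> Hist h -> (m <= m')%N ->
  upper_value i j m' h <= upper_value i j m h.
Proof.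
move=> ij Hh /subnKC <-; elim: (m' - m)%N => [|k IH]; first by rewrite addn0.
by rewrite addnS; apply: le_trans IH; exact: upper_value_decr.
Qed.

(** Both sides are compared at the common horizon [maxn m m'], where the sum of the two values is
    nonnegative. *)
Lemma upper_value_ge i j m m' t (h : hist G t) : i != j -> Hist h ->
  - upper_value j i m' h <= upper_value i j m h.
Proof.
move=> ij Hh; have ji : j != i by rewrite eq_sym.
apply: le_trans (upper_value_le ij Hh (leq_maxl m m')).
rewrite lerNl; apply: le_trans (upper_value_le ji Hh (leq_maxr m m')).
by rewrite lerNl -subr_ge0 opprK; have /andP[] := upper_value_sum (maxn m m') ij Hh.
Qed.

Definition value (i j : 'I_2) t (h : hist G t) : R :=
  inf (range (fun m => upper_value i j m h)).

Lemma value_le i j m t (h : hist G t) : i != j -> Hist h ->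
  value i j h <= upper_value i j m h.
Proof.
move=> ij Hh; apply: ge_inf; last by exists m.
by exists (- upper_value j i 0 h) => _ [k _ <-]; exact: upper_value_ge.
Qed.

Lemma value_ge i j m t (h : hist G t) : i != j -> Hist h ->
  - upper_value j i m h <= value i j h.
Proof.
move=> ij Hh; apply: lb_le_inf; first by exists (upper_value i j 0 h), 0.
by move=> _ [k _ <-]; exact: upper_value_ge.
Qed.

Lemma value_zero_sum i j t (h : hist G t) : i != j -> Hist h ->
  value i j h + value j i h = 0.
Proof.
move=> ij Hh; have ji : j != i by rewrite eq_sym.
apply/eqP; rewrite eq_le; apply/andP; split.
  apply/ler_addgt0Pl => e /(tail_oscillation_small G_game t)[m me]; rewrite addr0.
  apply: le_trans (ltW me); have /andP[_] := upper_value_sum m ij Hh.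
  by apply: le_trans; apply: lerD; exact: value_le.
rewrite -lerBlDr sub0r lerNl; apply: lb_le_inf; first by exists (upper_value j i 0 h), 0.
by move=> _ [m _ <-]; rewrite lerNl; exact: value_ge.
Qed.

(** Infima need not preserve lower semicontinuity. Here the value is within the tail oscillation of
    [upper_value], uniformly in the history, so it is a uniform limit. *)
Lemma value_admissible i j t : i != j -> admissible M (@value i j t).
Proof.
move=> ij; have ji : j != i by rewrite eq_sym.
split=> [h Hh|].
  rewrite ler_norml; apply/andP; split.
    apply: le_trans (value_ge 0 ij Hh); rewrite lerN2.
    by have := (upper_value_admissible 0 t ji).1 h Hh; rewrite ler_norml => /andP[].
  apply: (le_trans (value_le 0 ij Hh)).
  by have := (upper_value_admissible 0 t ij).1 h Hh; rewrite ler_norml => /andP[].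
(* Half of the gap [value i j h - a] absorbs the truncation error at nearby histories; [upper_value]
   stays above the midpoint there. *)
move=> h Hh a av; have d0 : 0 < (value i j h - a) / 2 by rewrite divr_gt0// subr_gt0.
have [m md] := tail_oscillation_small G_game t d0.
have := (upper_value_admissible m t ij).2 h Hh (a + (value i j h - a) / 2).
have vu := value_le m ij Hh.
have -> : a + (value i j h - a) / 2 < upper_value i j m h by lra.
move=> /(_ isT); rewrite !near_withinE; apply: filterS => h' uh' Hh'.
have := uh' Hh'; have := value_ge m ij Hh'.
by have /andP[_] := upper_value_sum m ij Hh'; lra.
Qed.

(** Limits are not exchanged with [maxmin]. Monotonicity gives one inequality for each player, and
    since the two stage values have sum 0, as do the two values, both are equalities. *)
Lemma value_maxmin i j t (h : hist G t) : i != j -> Hist h ->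
  maxmin i j (@value i j t.+1) h = value i j h.
Proof.
have maxmin_le_value k l : k != l -> Hist h -> maxmin k l (@value k l t.+1) h <= value k l h.
  move=> kl Hh; apply: lb_le_inf; first by exists (upper_value k l 0 h), 0.
  move=> _ [m _ <-]; apply: (@le_trans _ _ (upper_value k l m.+1 h)).
    apply: (le_maxmin G_game kl (value_admissible t.+1 kl) (upper_value_admissible m t.+1 kl) Hh).
    by move=> h' Hh'; exact: value_le.
  exact: upper_value_decr.
move=> ij Hh; have ji : j != i by rewrite eq_sym.
have := maxmin_minimax (a := 0) (b := 0) G_game G_perfect ij (value_admissible t.+1 ij)
  (value_admissible t.+1 ji) Hh.
have zs (h' : hist G t.+1) : Hist h' -> 0 <= value i j h' + value j i h' <= 0.
  by move=> Hh'; rewrite value_zero_sum ?lexx.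
move=> /(_ zs) /andP[s0 _].
apply/eqP; rewrite eq_le maxmin_le_value//=.
have := maxmin_le_value j i ji Hh; have := value_zero_sum ij Hh; lra.
Qed.

(** At horizon 0 the upper values are best continuations, which exceed the payoffs at [w] by at most
    the oscillation; the zero sum turns the bound for the opponent into a lower bound. *)
Lemma payoff_value i j t w : i != j -> Hinf w ->
  `|payoff_fun G i w - value i j (trunc t w)| <= tail_oscillation G t.+1.
Proof.
move=> ij Hw; have ji : j != i by rewrite eq_sym.
have hw : continuations (trunc t w) w by [].
have best_le k : best_continuation k (trunc t w) <= payoff_fun G k w + tail_oscillation G t.+1.
  apply: (best_continuation_le G_game); first exact: Hw.
  move=> w' [Hw' w'w]; rewrite -lerBlDl.
  by apply: le_trans (tail_oscillationP G_game k Hw' Hw w'w); exact: ler_norm.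
have := best_le i; have := best_le j; have := zero_sum_payoff ij Hw.
have := value_le 0 ij (Hw t); have := value_ge 0 ij (Hw t) => /=.
by rewrite ler_norml => *; apply/andP; split; lra.
Qed.

End Value.

Lemma lsc_sublevel_compact (R : realType) (X : topologicalType) (K : set X)
    (V : X -> R) (a : R) :
  compact K -> closed K -> lsc_on K V -> compact [set x | K x /\ V x <= a].
Proof.
move=> cK clK lV; apply: (subclosed_compact _ cK); last by move=> x [].
rewrite -openC openE => x /= nx; have [Kx|nKx] := pselect (K x); last first.
  apply: filterS _ (open_nbhs_nbhs (conj (closed_openC clK) nKx)) => y nKy [].
  by move=> /nKy.
have aV : a < V x by rewrite ltNge; apply/negP => Va; apply: nx.
have := lV x Kx a aV; rewrite near_withinE; apply: filterS => y ay [Ky].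
by rewrite leNgt ay.
Qed.

(** * Optimal actions and their measurable selection *)

Section Saddle.
Context (R : realType) (G : game R 2).
Hypothesis G_game : is_dynamic_game G.
Hypothesis G_perfect : perfect_information G.
Hypothesis G_zero_sum : zero_sum G.
Context (M : R).
Hypothesis payoffM : forall i w, Hinf w -> `|payoff_fun G i w| <= M.
Context (i j : 'I_2) (t : nat).
Hypothesis ij : i != j.

(** Optimality is phrased through the opponent's value so that the player minimizes a lower
    semicontinuous function: minimizers exist and sublevel sets are closed. Maximizing [security],
    only known to be lower semicontinuous, would give neither directly. *)
Definition reply (h : hist G t) (x : act G t i) : R :=
  sup [set stage_value (@value R G j i t.+1) h (joint x y) | y in action j h].

(* As [value j i = - value i j], such an action guarantees [value i j h] to [i]. *)
Definition optimal (h : hist G t) : set (act G t i) :=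
  [set x | action i h x /\ reply h x <= value j i h].

Let ji : j != i. Proof. by rewrite eq_sym. Qed.

Let admissible_j : admissible M (@value R G j i t.+1).
Proof. exact: value_admissible. Qed.

Let admissible_i : admissible M (@value R G i j t.+1).
Proof. exact: value_admissible. Qed.

Lemma reply_ge h x y : Hist h -> action i h x -> action j h y ->
  stage_value (@value R G j i t.+1) h (joint x y) <= reply h x.
Proof.
move=> Hh Ax Ay; apply: ub_le_sup; last by exists y.
exists M => _ [y' Ay' <-].
by have := stage_value_abs ij admissible_j Hh Ax Ay'; rewrite ler_norml => /andP[].
Qed.

Lemma reply_lsc :
  lsc_on (graph_on (@Hist R 2 G t) (action i)) (fun p => reply p.1 p.2).
Proof.
apply: (sup_lsc (M := M) (joint_stage_value_lsc G_game ij admissible_j)).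
- by apply: (lower_hemicontinuous_fst _ (@action_lhc _ _ _ G_game t j)) => p [].
- by move=> p [Hp _]; exact: (action_nonempty G_game).
- move=> [h x] y [/= Hh Ax] Ay.
  by have := stage_value_abs ij admissible_j Hh Ax Ay; rewrite ler_norml => /andP[].
Qed.

Lemma reply_section_lsc h : Hist h -> lsc_on (action i h) (reply h).
Proof.
move=> Hh; apply: (@lsc_comp _ _ _ _ (graph_on (@Hist R 2 G t) (action i))
  (fun x => (h, x)) (fun p => reply p.1 p.2)) => //; last exact: reply_lsc.
by move=> x A [[P Q] /= [nP nQ] PQA]; apply: filterS _ nQ => y Qy;
  apply: PQA; split=> //=; exact: nbhs_singleton.
Qed.

(** Stage values of the two players are opposite, so [reply h x'] is at most minus the security
    level of [x']. A minimizer of [reply] is thus below minus the [maxmin], which is the opponent's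
    value. *)
Lemma optimal_neq0 h : Hist h -> optimal h !=set0.
Proof.
move=> Hh; have [x Ax xmin] := lsc_attains_min (@action_compact _ _ _ G_game t i h Hh)
  (action_nonempty G_game i Hh) (reply_section_lsc Hh).
exists x; split=> //.
have -> : value j i h = - value i j h.
  by have := value_zero_sum G_game G_perfect G_zero_sum payoffM ij Hh; lra.
rewrite -(value_maxmin G_game G_perfect G_zero_sum payoffM ij Hh) lerNr.
apply: (maxmin_le G_game Hh) => x' Ax'; rewrite lerNr; apply: (le_trans (xmin x' Ax')).
apply: ge_sup.
  have [y Ay] := action_nonempty G_game j Hh.
  by exists (stage_value (@value R G j i t.+1) h (joint x' y)), y.
move=> _ [y Ay <-]; rewrite lerNr.
apply: (le_trans (security_le ij admissible_i Hh Ax' Ay)).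
have := stage_valueD (a := 0) (b := 0) (joint_feasible ij Hh Ax' Ay) admissible_i admissible_j.
have zs (h' : hist G t.+1) : Hist h' -> 0 <= value i j h' + value j i h' <= 0.
  by move=> Hh'; rewrite (value_zero_sum G_game G_perfect G_zero_sum payoffM ij Hh') lexx.
by move=> /(_ zs) /andP[_]; lra.
Qed.

Lemma optimal_compact h : Hist h -> compact (optimal h).
Proof.
move=> Hh; apply: lsc_sublevel_compact; [exact: (action_compact G_game)|exact: action_closed|].
exact: reply_section_lsc.
Qed.

(** The set is in fact closed relative to [Hist]: missing [C] persists nearby, because [reply] is
    lower and the opponent's value upper semicontinuous, uniformly over the compact action set by
    the tube lemma. *)
Lemma optimal_measurable (C : set (act G t i)) : closed C ->
  measurable ((@Hist R 2 G t `&` [set h | optimal h `&` C !=set0]) : set (borel (hist G t))).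
Proof.
move=> cC; pose miss := [set h | @Hist R 2 G t h -> optimal h `&` C = set0].
have -> : @Hist R 2 G t `&` [set h | optimal h `&` C !=set0] = @Hist R 2 G t `\` miss^°.
  apply/seteqP; split=> h [Hh hC]; split=> //.
    by move=> /interior_subset /(_ Hh) C0; move: hC; rewrite /= C0 => -[].
  apply/set0P/eqP => C0; apply: hC.
  have : \forall h' \near within (@Hist R 2 G t) (nbhs h), forall x, action i h' x ->
      ~ C x \/ value j i h' < reply h' x.
    apply: (uhc_tube (P := [set p | ~ C p.2 \/ value j i p.1 < reply p.1 p.2])
      (@action_uhc _ _ _ G_game t i) Hh (@action_compact _ _ _ G_game t i h Hh)).
    move=> x Ax; have [Cx|nCx] := pselect (C x); last first.
      rewrite near_withinE; exists (setT, ~` C) => /=.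
        by split; [exact: filterT|apply: open_nbhs_nbhs; split=> //; exact: closed_openC].
      by move=> [h' x'] [_ /= nCx'] _; left.
    have vr : value j i h < reply h x.
      rewrite ltNge; apply/negP => rv.
      by have : (optimal h `&` C) x by []; rewrite C0.
    pose b := (value j i h + reply h x) / 2.
    have br : b < reply h x by rewrite /b; lra.
    have vb : value j i h < b by rewrite /b; lra.
    have := reply_lsc (conj Hh Ax : graph_on (@Hist R 2 G t) (action i) (h, x)) br.
    (* Lower semicontinuity of the value of [i] at level [- b] is upper semicontinuity of the value
       of [j] at level [b]. *)
    have vi : - b < value i j h.
      by have := value_zero_sum G_game G_perfect G_zero_sum payoffM ij Hh; lra.
    have := (value_admissible G_game G_perfect G_zero_sum payoffM t ij).2 h Hh _ vi.
    rewrite !near_withinE => nv nr.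
    have nv1 : nbhs (h, x) [set p | @Hist R 2 G t p.1 -> - b < value i j p.1].
      exists ([set h' | @Hist R 2 G t h' -> - b < value i j h'], setT) => /=.
        by split=> //; exact: filterT.
      by move=> p [].
    move: nv1 nr; apply: filterS2 => p pv pr pg; right; apply: lt_trans (pr pg).
    have Hp : Hist p.1 by case: pg.
    have := value_zero_sum G_game G_perfect G_zero_sum payoffM ij Hp.
    by have := pv Hp; lra.
  rewrite near_withinE /interior/=; apply: filterS => h' H Hh'.
  apply/seteqP; split=> // x [[Ax rx] Cx].
  by have [//|] := H Hh' x Ax; rewrite ltNge rx.
apply: measurableD; first exact: Hist_measurable.
exact: (@borel_open (hist G t) _ (@open_interior _ _)).
Qed.

Lemma optimal_selection : exists s : hist G t -> act G t i,
  measurable_fun (@Hist R 2 G t : set (borel (hist G t)))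
    (s : borel (hist G t) -> borel (act G t i)) /\
  forall h, Hist h -> optimal h (s h).
Proof.
apply: (@measurable_selection R _ (borel (hist G t))).
- exact: (act_hausdorff G_game).
- exact: (act_countable_subbase G_game).
- exact: optimal_neq0.
- exact: optimal_compact.
- exact: optimal_measurable.
Qed.

End Saddle.

Section SaddleProfile.
Context (R : realType) (G : game R 2).
Hypothesis G_game : is_dynamic_game G.
Hypothesis G_perfect : perfect_information G.
Hypothesis G_zero_sum : zero_sum G.

Definition saddle_value (i : 'I_2) t (h : hist G t) : R := value i (rev_ord i) h.

Lemma neq_rev_ord2 (i : 'I_2) : i != rev_ord i.
Proof. by case: i => -[|[|m]] Hm. Qed.

(** The last clause is the one-stage supermartingale inequality: while the opponent follows the
    selection, no feasible action of [i] raises the expected value of [i]. *)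
Lemma saddle_profile : exists s : forall (i : 'I_2) t, hist G t -> act G t i,
  [/\ forall i t, measurable_fun (@Hist R 2 G t : set (borel (hist G t)))
        (s i t : borel (hist G t) -> borel (act G t i)),
      forall i t h, Hist h -> action i h (s i t h) &
      forall i t h z, feasible (h, z) -> (forall k, k != i -> z k = s k t h) ->
        stage_value (@saddle_value i t.+1) h z <= saddle_value i h].
Proof.
have [M M0 uM] := payoff_uniform_bound G_game.
have sel i t : exists s : hist G t -> act G t i,
  measurable_fun (@Hist R 2 G t : set (borel (hist G t)))
    (s : borel (hist G t) -> borel (act G t i)) /\
  forall j h, i != j -> Hist h -> optimal j h (s h).
  have [s [ms sP]] := optimal_selection G_game G_perfect G_zero_sum uM t (neq_rev_ord2 i).
  exists s; split=> // j h ij Hh; have [ji|->] := ord2_eq j (neq_rev_ord2 i).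
    by rewrite ji eqxx in ij.
  exact: sP.
pose s i t := sval (cid (sel i t)); have sP i t := svalP (cid (sel i t)).
exists s; split=> [i t|i t h Hh|i t h z hz zs]; first exact: (sP i t).1.
  exact: ((sP i t).2 _ _ (neq_rev_ord2 i) Hh).1.
pose o := rev_ord i; have io : i != o := neq_rev_ord2 i.
have oi : o != i by rewrite eq_sym.
have [Hh Az] := hz; have [As rv] := (sP o t).2 i h oi Hh.
apply: le_trans rv; rewrite -(joint_eta z oi) zs//.
exact: (reply_ge G_game G_perfect G_zero_sum uM oi Hh As (Az i)).
Qed.

End SaddleProfile.

Local Open Scope ereal_scope.

(** * Probability kernels from strategies and Nature's moves *)

Section ProbabilityKernel.
Context d d' (X : measurableType d) (Y : measurableType d') (R : realType).
Context (f : X -> {measure set Y -> \bar R}).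
Hypothesis mf : forall U, measurable U -> measurable_fun setT (f ^~ U).
Hypothesis f1 : forall x, f x setT = 1.

Definition unit_kernel of (forall U, measurable U -> measurable_fun setT (f ^~ U))
  & (forall x, f x setT = 1) : X -> {measure set Y -> \bar R} := f.

HB.instance Definition _ := isKernel.Build _ _ _ _ _ (unit_kernel mf f1) mf.

HB.instance Definition _ := Kernel_isProbability.Build _ _ _ _ _ (unit_kernel mf f1) f1.

Lemma probability_kernelP : exists k : R.-pker X ~> Y, forall x, k x = f x.
Proof. by exists (unit_kernel mf f1). Qed.

End ProbabilityKernel.

Lemma measurable_fun_patch d d' (W : measurableType d) (T : measurableType d')
    (D : set W) (f : W -> T) (c : T) :
  measurable D -> measurable_fun D f ->
  measurable_fun setT (fun w => if w \in D then f w else c).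
Proof.
move=> mD mf _ B mB.
have -> : setT `&` (fun w => if w \in D then f w else c) @^-1` B =
    (D `&` f @^-1` B) `|` (~` D `&` cst c @^-1` B).
  apply/seteqP; split=> w /=.
    by case=> _; case: ifPn; [rewrite inE; left|rewrite notin_setE; right].
  by case=> -[Dw Bw]; split=> //; [rewrite mem_set|rewrite memNset].
apply: measurableU; first exact: mf.
by apply: measurableI; [exact: measurableC|rewrite preimage_cst; case: ifP].
Qed.

(** Kernels are total while strategies are meaningful on [D] only; off [D] the kernel is the Dirac
    mass at [point]. *)
Lemma weak_kernel (R : realType) (S : ptopologicalType) d (W : measurableType d)
    (D : set W) (f : W -> weak_prob R S) :
  metrizable R S -> measurable D ->
  measurable_fun D (f : W -> borel (weak_prob R S)) ->
  exists k : R.-pker W ~> borel S, forall w, D w -> forall U, k w U = (f w : borel_prob R S) U.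
Proof.
move=> mS mD mf.
pose F (w : W) : {measure set (borel S) -> \bar R} :=
  if w \in D then (f w : borel_prob R S) else (\d_(point : borel S))%R.
have [|w|k kE] := @probability_kernelP _ _ W (borel S) R F.
- move=> U mU.
  have -> : F ^~ U = fun w => if w \in D then (f w : borel_prob R S) U else \d_(point : borel S)
      U.
    by apply/funext => w; rewrite /F; case: ifP.
  apply: measurable_fun_patch => //; exact: weak_measure_measurable mf.
- by rewrite /F; case: ifP => _; [exact: probability_setT|rewrite /= /dirac indicE in_setT].
- by exists k => w Dw U; rewrite kE /F mem_set.
Qed.

(** * Outcomes of a play against pure strategies *)

Lemma mixture_measure d d' (X : measurableType d) (Z : measurableType d') (R : realType)
    (m : probability X R) (k : R.-pker X ~> Z) :
  exists m2 : {measure set Z -> \bar R}, forall B, m2 B = \int[m]_x k x B.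
Proof.
(* Reading [m] as a constant kernel on [unit] lets kernel composition supply the measure structure
   of the mixture. *)
have [|x|l lE] := @probability_kernelP _ _ unit X R (fun=> m).
- by move=> U mU; exact: measurable_cst.
- exact: probability_setT.
have [|x|k' k'E] := @probability_kernelP _ _ (unit * X)%type Z R (fun ux => k ux.2).
- by move=> U mU; exact: measurableT_comp (measurable_kernel k _ mU) _.
- exact: prob_kernel.
exists (mkcomp l k' tt) => B; rewrite /mkcomp/= /kcomp lE.
by apply: eq_integral => x _; rewrite k'E.
Qed.

(** Draws [a] and [s] independently given [w] and maps the result by [e]. Each composite is
    repackaged so as to be again a probability kernel. *)
Lemma transition_kernel d1 d2 d3 d4 (W : measurableType d1) (A : measurableType d2)
    (S : measurableType d3) (Z : measurableType d4) (R : realType)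
    (kg : R.-pker W ~> A) (kn : R.-pker W ~> S) (e : (W * A) * S -> Z) :
  measurable_fun setT e ->
  exists k : R.-pker W ~> Z, forall w (f : Z -> \bar R), (forall z, 0 <= f z) ->
    measurable_fun setT f ->
    \int[k w]_z f z = \int[kg w]_a \int[kn w]_s f (e ((w, a), s)).
Proof.
move=> me.
have [|x|kn' kn'E] := @probability_kernelP _ _ (W * A)%type S R (fun wa => kn wa.1).
- by move=> U mU; exact: measurableT_comp (measurable_kernel kn _ mU) _.
- exact: prob_kernel.
pose k1 := mkcomp kn' (kdirac me : R.-pker _ ~> _).
have k1E wa f : (forall z, 0 <= f z) -> measurable_fun setT f ->
    \int[k1 wa]_z f z = \int[kn wa.1]_s f (e (wa, s)).
  move=> f0 mf; rewrite integral_kcomp//= kn'E; apply: eq_integral => s _.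
  by rewrite integral_dirac// diracT mul1e.
have [|wa|k2 k2E] := @probability_kernelP _ _ (W * A)%type Z R k1.
- by move=> U mU; exact: measurable_kernel.
- rewrite -[LHS]mul1e -(integral_cst (k1 wa) measurableT 1) k1E//.
  by rewrite integral_cst// mul1e prob_kernel.
pose k3 := mkcomp kg k2.
have k3E w f : (forall z, 0 <= f z) -> measurable_fun setT f ->
    \int[k3 w]_z f z = \int[kg w]_a \int[kn w]_s f (e ((w, a), s)).
  move=> f0 mf; rewrite integral_kcomp//.
  by apply: eq_integral => a _; rewrite /= k2E k1E.
have [|w|k kE] := @probability_kernelP _ _ W Z R k3.
- by move=> U mU; exact: measurable_kernel.
- rewrite -[LHS]mul1e -(integral_cst (k3 w) measurableT 1) k3E//.
  under eq_integral do rewrite integral_cst// mul1e prob_kernel.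
  by rewrite integral_cst// mul1e prob_kernel.
by exists k => w f f0 mf; rewrite kE k3E.
Qed.

Local Close Scope ereal_scope.

Lemma within_continuous_borel_measurable (T U : ptopologicalType) (D : set T) (f : T -> U) :
  measurable (D : set (borel T)) -> {within D, continuous f} ->
  measurable_fun (D : set (borel T)) (f : borel T -> borel U).
Proof.
move=> mD /continuousP cf.
apply: (measurability (@open U : set (set (borel U)))) => // _ [V oV <-].
have /open_subspaceP [P oP PE] := cf _ oV.
have -> : D `&` f @^-1` V = P `&` D by rewrite setIC -PE.
by apply: measurableI => //; exact: borel_open.
Qed.

Section GameKernel.
Context (R : realType) (n : nat) (G : game R n).
Hypothesis G_game : is_dynamic_game G.
Context (s : forall (i : 'I_n) t, hist G t -> act G t i).
Hypothesis s_measurable : forall i t, measurable_fun (@Hist R n G t : set (borel (hist G t)))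
  (@s i t : borel (hist G t) -> borel (act G t i)).
Context (i : 'I_n) (g : strategy G i).
Hypothesis g_mixed : is_mixed_strategy g.

Definition next_hist t (h : hist G t) (x : act G t i) (c : chance G t) : hist G t.+1 :=
  (h, (dfwith (fun j => s j h) i x, c)).

Local Open Scope ereal_scope.

(** All players but [i] act deterministically, so the product of the stage laws reduces to two
    integrals. The fibre clause is required for every [h], in or out of [Hist], to feed the
    Ionescu-Tulcea theorem. *)
Lemma game_kernel t : exists K : R.-pker borel (hist G t) ~> borel (hist G t.+1),
  (forall h (B : set (borel (hist G t.+1))), measurable B ->
    (forall z : hist G t.+1, z.1 = h -> B z) -> K h B = 1) /\
  forall h, Hist h -> forall f : borel (hist G t.+1) -> \bar R, (forall z, 0 <= f z) ->
    measurable_fun setT f ->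
    \int[K h]_z f z = \int[g h]_x \int[nature h]_c f (next_hist h x c).
Proof.
have mH := @Hist_measurable _ _ _ G_game t.
have [kg kgE] := weak_kernel (polish_metrizable (act_polish G_game t i)) mH (g_mixed t).1.
have [kn knE] := weak_kernel (polish_metrizable (chance_polish G_game t)) mH
  (within_continuous_borel_measurable mH (@nature_continuous _ _ _ G_game t)).
(* The default [point] off [Hist] makes the pure actions measurable on the whole space. *)
pose s' j (h : hist G t) : act G t j := if h \in @Hist R n G t then s j h else point.
pose e (w : (borel (hist G t) * borel (act G t i)) * borel (chance G t)) :
    borel (hist G t.+1) :=
  (w.1.1, (dfwith (fun j => s' j w.1.1) i w.1.2, w.2)).
have me : measurable_fun setT e.
  apply: (measurable_fun_borel_pair (hist_countable_subbase G_game t)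
    (stage_countable_subbase G_game t)).
    exact: measurableT_comp measurable_fst measurable_fst.
  apply: (measurable_fun_borel_pair (act_profile_countable_subbase G_game t)
    (chance_countable_subbase G_game t)); last exact: measurable_snd.
  apply: (measurable_fun_borel_prod_topology (act_countable_subbase G_game t)) => j.
  have [<-{j}|ij] := eqVneq i j.
    apply: (eq_measurable_fun (fun w => w.1.2)) => [w _|]; first by rewrite dfwithin.
    exact: measurableT_comp measurable_snd measurable_fst.
  apply: (eq_measurable_fun
    (fun w : (borel (hist G t) * borel (act G t i)) * borel (chance G t) =>
      s' j w.1.1 : borel (act G t j))) => [w _|]; first by rewrite dfwithout.
  apply: (measurableT_comp (f := fun h : borel (hist G t) => s' j h : borel (act G t j))).
    exact: measurable_fun_patch.
  exact: measurableT_comp measurable_fst measurable_fst.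
have [K KE] := transition_kernel kg kn me.
exists K; split=> [h B mB hB|h Hh f f0 mf].
  have -> : K h B = \int[K h]_z (\1_B z)%:E by rewrite integral_indic// setIT.
  rewrite KE => [|z|]; last 2 first.
  - by rewrite lee_fin.
  - exact/measurable_EFinP/measurable_indic.
  rewrite (_ : (fun _ => _) = fun=> \int[kn h]_c 1); last first.
    by apply/funext => x; apply: eq_integral => c _; rewrite indicE mem_set//; exact: hB.
  under eq_integral do rewrite integral_cst// mul1e prob_kernel.
  by rewrite integral_cst// mul1e prob_kernel.
rewrite KE//.
rewrite (eq_measure_integral (g h)) => [|A _ _]; last exact: kgE.
apply: eq_integral => x _; rewrite (eq_measure_integral (nature h)) => [|A _ _]; last exact: knE.
apply: eq_integral => c _; congr f.
rewrite /e/= /next_hist; congr (_, (_, _)); apply/functional_extensionality_dep => j.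
have [<-|ij] := eqVneq i j; first by rewrite !dfwithin.
by rewrite !dfwithout// /s' mem_set.
Qed.

End GameKernel.

Local Open Scope ereal_scope.

Lemma probability_bigcap1 d (T : measurableType d) (R : realType) (m : probability T R)
    (F : (set T)^nat) :
  (forall k, measurable (F k)) -> (forall k, m (F k) = 1) -> m (\bigcap_k F k) = 1.
Proof.
move=> mF F1; have mI : measurable (\bigcap_k F k) by exact: bigcap_measurableType.
rewrite -(setCK (\bigcap_k F k)) probability_setC; last exact: measurableC.
rewrite (_ : m _ = 0) ?sube0//; apply/negligibleP; first exact: measurableC.
rewrite setC_bigcap; apply: negligible_bigcup => k.
have Fk0 : m (~` F k) = 0 by rewrite probability_setC// F1 subee.
by apply/negligibleP => //; exact: measurableC.
Qed.

Lemma probability_ge1 d (T : measurableType d) (R : realType) (m : probability T R)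
    (A B : set T) :
  measurable A -> measurable B -> A `<=` B -> m A = 1 -> m B = 1.
Proof.
move=> mA mB AB A1; apply/eqP; rewrite eq_le probability_le1//= -A1.
by apply: le_measure; rewrite ?inE.
Qed.

Lemma integral_full d (T : measurableType d) (R : realType) (m : probability T R)
    (D : set T) (f : T -> \bar R) :
  measurable D -> m D = 1 -> (forall x, 0 <= f x) -> measurable_fun setT f ->
  \int[m]_x f x = \int[m]_(x in D) f x.
Proof.
move=> mD D1 f0 mf; have D0 : m (~` D) = 0 by rewrite probability_setC// D1 subee.
rewrite (@ge0_negligible_integral _ _ _ m setT (~` D))//.
- by rewrite setTD setCK.
- exact: measurableC.
Qed.

Lemma indic_forall (R : realType) n (T : 'I_n -> Type) (C : forall i, set (T i))
    (x : forall i, T i) :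
  \1_[set x : forall i, T i | forall i, C i (x i)] x = (\prod_(i < n) \1_(C i) (x i) : R)%R.
Proof.
rewrite indicE; case: (pselect (forall i, C i (x i))) => [H|H].
  by rewrite mem_set// big1// => i _; rewrite indicE mem_set.
rewrite memNset//; have /existsNP [i nC] := H.
by rewrite (bigD1 i)//= indicE memNset// mul0r.
Qed.

(** * Measurable boxes *)

Section Boxes.
Context (R : realType) (n : nat) (G : game R n).
Hypothesis G_game : is_dynamic_game G.

Definition box t (B : set (hist G t)) (C : forall i, set (act G t i)) (D : set (chance G t)) :
    set (hist G t.+1) :=
  B `*` ([set x | forall i, C i (x i)] `*` D).

Definition measurable_box t : set (set (hist G t.+1)) :=
  [set A | exists B C D, [/\ measurable (B : set (borel (hist G t))),
    forall i, measurable (C i : set (borel (act G t i))),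
    measurable (D : set (borel (chance G t))) & A = box B C D]].

Lemma box_measurable t : @measurable_box t `<=` (@measurable _ (borel (hist G t.+1))).
Proof.
move=> _ [B [C [D [mB mC mD ->]]]].
have c1 : continuous (fst : hist G t.+1 -> hist G t) by move=> x; exact: cvg_fst.
have c2 : continuous (snd : hist G t.+1 -> stage G t) by move=> x; exact: cvg_snd.
have c3 : continuous (fst : stage G t -> prod_topology (act G t)) by move=> x; exact: cvg_fst.
have c4 : continuous (snd : stage G t -> chance G t) by move=> x; exact: cvg_snd.
have -> : box B C D = (fst @^-1` B) `&`
    (snd @^-1` ((fst @^-1` (\bigcap_(i in setT) (@proj _ _ i) @^-1` C i)) `&` snd @^-1` D)).
  apply/seteqP; split=> -[h [x c]] /= [Bh [Cx Dc]]; (split=> //; split=> // i).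
    by move=> _; exact: Cx.
  exact: (Cx i).
have mm (T U : ptopologicalType) (f : T -> U) (A : set (borel U)) : continuous f ->
    measurable A -> measurable (f @^-1` A : set (borel T)).
  by move=> cf mA; have := continuous_borel_measurable cf measurableT mA; rewrite setTI.
apply: measurableI; first exact: mm.
apply: (mm _ _ _ _ c2); apply: measurableI; last exact: mm.
apply: (mm _ _ _ _ c3); apply: fin_bigcap_measurable => // i _.
by apply: mm => //; exact: proj_continuous.
Qed.

Lemma box_setI t : setI_closed (@measurable_box t).
Proof.
move=> _ _ [B [C [D [mB mC mD ->]]]] [B' [C' [D' [mB' mC' mD' ->]]]].
exists (B `&` B'), (fun i => C i `&` C' i), (D `&` D'); split.
- exact: measurableI.
- by move=> i; exact: measurableI.
- exact: measurableI.
apply/seteqP; split=> -[h [x c]] /=.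
  by move=> [[Bh [Cx Dc]] [Bh' [Cx' Dc']]]; do !split=> //; exact: Cx.
by move=> [[Bh Bh'] [Cx [Dc Dc']]]; do !split=> //; move=> i; case: (Cx i).
Qed.

(** The identity from the sigma-algebra of boxes to the Borel one is measurable coordinate by
    coordinate, hence measurable by second countability. Boxes thus determine the marginals of an
    outcome. *)
Lemma box_generates t :
  @measurable _ (borel (hist G t.+1)) = <<s @measurable_box t >>.
Proof.
apply/seteqP; split=> [A mA|]; last first.
  by apply: smallest_sub; [exact: sigma_algebra_measurable|exact: box_measurable].
have gT B C D : @measurable_box t (box B C D) ->
  measurable (box B C D : set (g_sigma_algebraType (@measurable_box t))).
  exact: sub_sigma_algebra.
have idE : measurable_fun setT
    (id : g_sigma_algebraType (@measurable_box t) -> borel (hist G t.+1)).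
  pose W := g_sigma_algebraType (@measurable_box t).
  apply: (eq_measurable_fun (fun w : W => (w.1, w.2) : borel (hist G t.+1))) => [[]//|].
  apply: (measurable_fun_borel_pair (hist_countable_subbase G_game t)
    (stage_countable_subbase G_game t)).
    move=> _ B mB; rewrite setTI.
    rewrite (_ : _ @^-1` B = box B (fun=> setT) setT); last first.
      by apply/seteqP; split=> -[h [x c]]//= [].
    by apply: gT; exists B, (fun=> setT), setT; split.
  apply: (eq_measurable_fun (fun w : W => (w.2.1, w.2.2) : borel (stage G t))) => [[?[]]//|].
  apply: (measurable_fun_borel_pair (act_profile_countable_subbase G_game t)
    (chance_countable_subbase G_game t)); last first.
    move=> _ B mB; rewrite setTI.
    rewrite (_ : _ @^-1` B = box setT (fun=> setT) B); last first.
      by apply/seteqP; split=> -[h [x c]]//= [_ []].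
    by apply: gT; exists setT, (fun=> setT), B; split.
  apply: (measurable_fun_borel_prod_topology (act_countable_subbase G_game t)) => i.
  move=> _ B mB; rewrite setTI; pose C := dfwith (fun j => [set: act G t j]) i B.
  rewrite (_ : _ @^-1` B = box setT C setT); last first.
    apply/seteqP; split=> -[h [x c]]/=.
      by move=> Bx; do !split=> //; rewrite /C => j; case: dfwithP.
    by move=> [_ [Cx _]]; have := Cx i; rewrite /C dfwithin.
  apply: gT; exists setT, C, setT; split=> // j.
  by rewrite /C; case: dfwithP => // j' _; exact: measurableT.
by have := idE measurableT A mA; rewrite setTI.
Qed.

End Boxes.

Lemma integral_scaled_indic d (T : measurableType d) (R : realType) (m : probability T R)
    (a : R) (D : set T) : (0 <= a)%R -> measurable D ->
  \int[m]_x (a * \1_D x)%:E = (a * fine (m D))%:E.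
Proof.
move=> a0 mD; under eq_integral do rewrite EFinM.
rewrite ge0_integralZl//=.
  by rewrite integral_indic// setIT EFinM fineK// fin_num_measure.
exact/measurable_EFinP/measurable_indic.
Qed.

Lemma indic_setX (R : realType) (T U : Type) (A : set T) (B : set U) (z : T * U) :
  (\1_(A `*` B) z = \1_A z.1 * \1_B z.2 :> R)%R.
Proof. by rewrite !indicE in_setX; case: (_ \in A); rewrite ?mul1r ?mul0r. Qed.

(** * Existence of outcomes *)

Section OutcomeExists.
Context (R : realType) (n : nat) (G : game R n).
Hypothesis G_game : is_dynamic_game G.
Context (s : forall (i : 'I_n) t, hist G t -> act G t i).
Hypothesis s_measurable : forall i t, measurable_fun (@Hist R n G t : set (borel (hist G t)))
  (@s i t : borel (hist G t) -> borel (act G t i)).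
Hypothesis s_action : forall i t h, @Hist R n G t h -> action i h (s i h).

Definition pure_profile : profile G := fun i t h => dirac (s i h : borel (act G t i)).

Context (i : 'I_n) (g : strategy G i).
Hypothesis g_mixed : is_mixed_strategy g.

Local Notation f := (deviate pure_profile g).

Definition box_probability t (h : hist G t) C D : R :=
  ((\prod_(j < n) fine (f j h (C j))) * fine (nature h D))%R.

Lemma kernel_box t (K : R.-pker borel (hist G t) ~> borel (hist G t.+1)) h B C D :
  (forall f : borel (hist G t.+1) -> \bar R, (forall z, 0 <= f z) ->
    measurable_fun setT f ->
    \int[K h]_z f z = \int[g h]_x \int[nature h]_c f (next_hist s h x c)) ->
  measurable (B : set (borel (hist G t))) ->
  (forall j, measurable (C j : set (borel (act G t j)))) ->
  measurable (D : set (borel (chance G t))) ->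
  K h (box B C D) = (\1_B h * box_probability h C D)%:E.
Proof.
move=> KE mB mC mD.
have mbox : measurable (box B C D : set (borel (hist G t.+1))).
  by apply: (box_measurable (G := G)); exists B, C, D.
have -> : K h (box B C D) = \int[K h]_z (\1_(box B C D) z)%:E.
  by rewrite integral_indic// setIT.
rewrite KE => [|z|]; last 2 first.
- by rewrite lee_fin.
- exact/measurable_EFinP/measurable_indic.
pose r : R := (\1_B h * \prod_(j < n | j != i) \1_(C j) (s j h))%R.
have r0 : (0 <= r)%R by rewrite mulr_ge0// prodr_ge0.
have E x c : \1_(box B C D) (next_hist s h x c) = (r * \1_(C i) x * \1_D c)%R.
  rewrite /box !indic_setX /=.
  rewrite (indic_forall R C (dfwith (fun j => s j h) i x)) (bigD1 i)//= dfwithin.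
  rewrite (eq_bigr (fun j => \1_(C j) (s j h))) => [|j ji]; last by rewrite dfwithout 1?eq_sym.
  by rewrite /r; ring.
under eq_integral => x _.
  under eq_integral do rewrite E.
  rewrite integral_scaled_indic//; last by rewrite mulr_ge0.
  rewrite -mulrA (mulrC (\1_(C i) x)) mulrA; over.
rewrite integral_scaled_indic//; last by rewrite mulr_ge0// fine_ge0.
congr EFin; rewrite /box_probability (bigD1 i)//= /deviate dfwithin.
rewrite (eq_bigr (fun j => \1_(C j) (s j h))) => [|j ji]; last by rewrite dfwithout 1?eq_sym.
by rewrite /r; ring.
Qed.

(** The definition constrains only the topological support; that the support has full mass comes
    from the countable subbase. *)
Lemma mixed_strategy_action t h : Hist h -> @g t h (action i h) = 1.
Proof.
move=> Hh; apply: (@probability_ge1 _ (borel (act G t i)) R (g h) (msupport (g h))).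
- by apply: borel_closed; apply: closed_bigI => C [].
- by apply: borel_closed; exact: (action_closed G_game).
- exact: (g_mixed t).2.
- exact/msupport_full/(act_countable_subbase G_game).
Qed.

Lemma kernel_Hist t (K : R.-pker borel (hist G t) ~> borel (hist G t.+1)) h :
  Hist h ->
  (forall f : borel (hist G t.+1) -> \bar R, (forall z, 0 <= f z) ->
    measurable_fun setT f ->
    \int[K h]_z f z = \int[g h]_x \int[nature h]_c f (next_hist s h x c)) ->
  K h (@Hist R n G t.+1) = 1.
Proof.
move=> Hh KE; have mH : measurable (@Hist R n G t.+1 : set (borel _)) by exact: Hist_measurable.
have -> : K h (@Hist R n G t.+1) = \int[K h]_z (\1_(@Hist R n G t.+1) z)%:E.
  by rewrite integral_indic// setIT.
rewrite KE => [|z|]; last 2 first.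
- by rewrite lee_fin.
- exact/measurable_EFinP/measurable_indic.
have hT : nature h setT = 1 by exact: probability_setT.
transitivity (\int[g h]_x (\1_(action i h) x)%:E).
  apply: eq_integral => x _; transitivity (\int[nature h]_c (\1_(action i h) x)%:E).
    apply: eq_integral => c _; rewrite !indicE.
    have [Ax|nAx] := pselect (action i h x).
      rewrite !mem_set//; split=> // j /=.
      by case: dfwithP => // j' _; exact: s_action.
    by rewrite !memNset// => -[_ /(_ i)]; rewrite /= dfwithin.
  rewrite integral_cst// -[RHS]mule1; congr (_ * _); exact: hT.
have mA : measurable (action i h : set (borel (act G t i))).
  by apply: borel_closed; exact: (action_closed G_game).
by rewrite integral_indic// setIT; exact: mixed_strategy_action.
Qed.

Lemma cylinder_generates A : measurable (A : set (borel (play G))) ->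
  <<s cylinder (fun t => (@trunc n G t : borel (play G) -> borel (hist G t))) >> A.
Proof.
pose Cyl := cylinder (fun t => (@trunc n G t : borel (play G) -> borel (hist G t))).
have gT t (B : set (borel (hist G t))) : measurable B ->
    measurable (@trunc n G t @^-1` B : set (g_sigma_algebraType Cyl)).
  by move=> mB; apply: sub_sigma_algebra; exists t, B.
have mt t : measurable_fun setT (@trunc n G t : g_sigma_algebraType Cyl -> borel (hist G t)).
  by move=> _ B mB; rewrite setTI; exact: gT.
have idE : measurable_fun setT (id : g_sigma_algebraType Cyl -> borel (play G)).
  pose W := g_sigma_algebraType Cyl.
  apply: (eq_measurable_fun (fun w : W => (w.1, w.2) : borel (play G))) => [[]//|].
  apply: (measurable_fun_borel_pair (hist_countable_subbase G_game 0)).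
  - exact: countable_subbase_prod_topology (stage_countable_subbase G_game).
  - exact: mt 0%N.
  apply: (measurable_fun_borel_prod_topology (stage_countable_subbase G_game)) => t.
  apply: (measurableT_comp (f := snd : borel (hist G t.+1) -> borel (stage G t)) _ (mt t.+1)).
  by apply: continuous_borel_measurable => x; exact: cvg_snd.
by move=> mA; have := idE measurableT A mA; rewrite setTI.
Qed.

Lemma Hinf_ge t : @Hinf R n G = \bigcap_k (@trunc n G (t + k) @^-1` @Hist R n G (t + k)).
Proof.
apply/seteqP; split=> [w Hw k _|w Hw m]; first exact: Hw.
by apply: (@Hist_trunc_le _ _ _ m (t + m)); [exact: leq_addl|exact: (Hw m Logic.I)].
Qed.

Lemma trunc_measurable t :
  measurable_fun setT (@trunc n G t : borel (play G) -> borel (hist G t)).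
Proof. by apply: continuous_borel_measurable; exact: trunc_continuous. Qed.

Lemma marginal_probability (tau : borel_prob R (play G)) t :
  exists P : probability (borel (hist G t)) R,
    (P : set (borel (hist G t)) -> \bar R) = @marginal R n G tau t.
Proof.
have [m mE] := pushforward_measure tau (trunc_measurable (t := t)).
have [|P PE] := @measure_probability _ _ _ m; last by exists P; rewrite PE mE.
by rewrite mE; exact: probability_setT.
Qed.

(** The subgame starts at [t0] but the measure is built from stage 0: before [t0] the kernels append
    the moves of a fixed play [w0] through [h0], so the law at [t0] is the Dirac mass at [h0]. *)
Theorem outcome_exists t0 (h0 : hist G t0) : Hist h0 -> exists tau, is_outcome f h0 tau.
Proof.
move=> Hh0; have [w0 [Hw0 w0h0]] := Hist_extend G_game Hh0.
have kernels m : exists K : R.-pker borel (hist G m) ~> borel (hist G m.+1),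
  [/\ forall h (B : set (borel (hist G m.+1))), measurable B ->
        (forall z : hist G m.+1, z.1 = h -> B z) -> K h B = 1,
      (m < t0)%N -> forall h B, K h B = \d_((h, w0.2 m) : borel (hist G m.+1)) B &
      (t0 <= m)%N -> forall h, Hist h ->
        forall f : borel (hist G m.+1) -> \bar R, (forall z, 0 <= f z) ->
        measurable_fun setT f ->
        \int[K h]_z f z = \int[g h]_x \int[nature h]_c f (next_hist s h x c)].
  have [mt0|t0m] := ltnP m t0.
    pose e (h : borel (hist G m)) : borel (hist G m.+1) := (h, w0.2 m).
    have me : measurable_fun setT e.
      apply: (measurable_fun_borel_pair (hist_countable_subbase G_game m)
        (stage_countable_subbase G_game m)) => //.
    exists (kdirac me); split=> // h B mB hB.
    by rewrite /= /kdirac diracE mem_set//; exact: hB.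
  by have [K [K1 K2]] := game_kernel G_game s_measurable g_mixed m; exists K; split.
pose K m := sval (cid (kernels m)); have KP m := svalP (cid (kernels m)).
have q_measurable m : measurable_fun setT (fst : borel (hist G m.+1) -> borel (hist G m)).
  by apply: continuous_borel_measurable => x; exact: cvg_fst.
have [tau [tau0 tauS]] := @ionescu_tulcea R _ (borel (play G)) _ (fun m => borel (hist G m))
  (fun m => @trunc n G m) (fun m => fst) K w0.1 q_measurable (fun m w => erefl)
  (@trunc_surj _ _) (@trunc_lim _ _) (fun m => let: And3 H _ _ := KP m in H)
  trunc_measurable cylinder_generates.
have tau_dirac m : (m <= t0)%N -> forall B : set (borel (hist G m)), measurable B ->
    marginal tau B = \d_(trunc m w0 : borel (hist G m)) B.
  elim: m => [_|m IH mt0] B mB; first exact: tau0.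
  have [P PE] := marginal_probability tau m.
  rewrite [LHS]tauS// -[pushforward _ _]PE.
  rewrite (eq_measure_integral (\d_(trunc m w0 : borel (hist G m)))%R) => [|A mA _]; last first.
    transitivity (marginal tau A); first by rewrite -PE.
    exact: (IH (ltnW mt0) A mA).
  rewrite integral_dirac//; last exact: measurable_kernel.
  have [_ /(_ mt0) KE _] := KP m.
  by rewrite diracT mul1e; exact: KE.
have tau_t0 B : measurable (B : set (borel (hist G t0))) -> marginal tau B = \d_(h0 : borel (hist
    G t0)) B.
  by rewrite -w0h0; exact: tau_dirac.
have mH m : measurable (@Hist R n G m : set (borel (hist G m))) by exact: Hist_measurable.
have tau_int m B : measurable (B : set (borel (hist G m.+1))) ->
    marginal tau (@Hist R n G m) = 1 ->
    marginal tau B = \int[@marginal R n G tau m]_(h in @Hist R n G m) K m h B.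
  move=> mB H1; have [P PE] := marginal_probability tau m.
  rewrite [LHS]tauS// -[pushforward _ _]PE -PE; apply: integral_full => //.
  - by rewrite -H1 -PE.
  - exact: measurable_kernel.
have tau_Hist k : marginal tau (@Hist R n G (t0 + k)) = 1.
  elim: k => [|k IH].
    by rewrite addn0 tau_t0// diracE mem_set.
  rewrite addnS tau_int//.
  have [P PE] := marginal_probability tau (t0 + k)%N.
  rewrite -PE (eq_integral (cst 1)) => [|h /[!inE] Hh].
    by rewrite integral_cst// mul1e -IH -PE.
  have [_ _ /(_ (leq_addr _ _) h Hh) KE] := KP (t0 + k)%N.
  exact: kernel_Hist.
exists tau; split=> // [|k t0k B C D mB mC mD].
  rewrite (Hinf_ge t0); apply: probability_bigcap1 => // k.
  by have := trunc_measurable measurableT (mH (t0 + k)%N); rewrite setTI.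
rewrite tau_int//; last first.
- by rewrite -(subnKC t0k).
- by apply: (box_measurable (G := G)); exists B, C, D.
have [P PE] := marginal_probability tau k.
rewrite -PE setIC integral_mkcondr. apply: eq_integral => h /[!inE] Hh.
have [_ _ /(_ t0k h Hh) KE] := KP k.
rewrite [LHS](kernel_box KE mB mC mD) /patch indicE; case: ifPn => _.
  by rewrite mul1r.
by rewrite mul0r.
Qed.

End OutcomeExists.

(** * The supermartingale of values *)

Section OutcomeTransition.
Context (R : realType) (n : nat) (G : game R n).
Hypothesis G_game : is_dynamic_game G.
Context (s : forall (i : 'I_n) t, hist G t -> act G t i).
Context (i : 'I_n) (g : strategy G i).
Context (t0 : nat) (h0 : hist G t0) (tau : borel_prob R (play G)).
Hypothesis tau_outcome : is_outcome (deviate (pure_profile s) g) h0 tau.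

Lemma Hinf_measurable : measurable (@Hinf R n G : set (borel (play G))).
Proof. by apply: borel_closed; exact: Hinf_closed. Qed.

Lemma outcome_Hist t : marginal tau (@Hist R n G t) = 1.
Proof.
have [tH _ _] := tau_outcome.
apply: (@probability_ge1 _ (borel (play G)) R tau (@Hinf R n G)).
- exact: Hinf_measurable.
- by have := trunc_measurable measurableT (Hist_measurable G_game (t := t)); rewrite setTI.
- by move=> w /(_ t).
- exact: tH.
Qed.

(** Both sides are measures in [A]. They agree on boxes by [is_outcome], and boxes are stable under
    intersection and generate. *)
Lemma outcome_transition t (K : R.-pker borel (hist G t) ~> borel (hist G t.+1)) :
  (t0 <= t)%N ->
  (forall h, Hist h -> forall f : borel (hist G t.+1) -> \bar R, (forall z, 0 <= f z) ->
    measurable_fun setT f ->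
    \int[K h]_z f z = \int[g h]_x \int[nature h]_c f (next_hist s h x c)) ->
  forall A, measurable A -> @marginal R n G tau t.+1 A = \int[@marginal R n G tau t]_h K h A.
Proof.
move=> t0t KE A mA; have [_ _ tau_box] := tau_outcome.
have [P PE] := marginal_probability tau t.
have [P' P'E] := marginal_probability tau t.+1.
have [Q QE] := mixture_measure P K.
rewrite -PE -P'E -QE.
have boxT : @measurable_box R n G t setT.
  exists setT, (fun=> setT), setT; split=> //.
  by apply/seteqP; split=> -[? []].
apply: (@measure_unique _ R (borel (hist G t.+1)) (@measurable_box R n G t) (fun=> setT)
  _ _ _ _ P' Q) => //.
- exact: box_generates.
- exact: box_setI.
- by rewrite bigcup_const//; exists 0%N.
- move=> _ [B [C [D [mB mC mD ->]]]].
  have mbox : measurable (box B C D : set (borel (hist G t.+1))).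
    by apply: (box_measurable (G := G)); exists B, C, D.
  rewrite QE (@integral_full _ _ _ P (@Hist R n G t)) => //; last 3 first.
  - exact: Hist_measurable.
  - by rewrite -[RHS](outcome_Hist t) -PE.
  - exact: measurable_kernel.
  transitivity (@marginal R n G tau t.+1 (box B C D)); first by rewrite -P'E.
  rewrite [LHS]tau_box// -PE setIC integral_mkcondr; apply: eq_integral => h /[!inE] Hh.
  rewrite [RHS](kernel_box (KE h Hh) mB mC mD) /patch indicE; case: ifPn => _.
    by rewrite mul1r.
  by rewrite mul0r.
- by move=> _; rewrite [X in X < _](_ : _ = 1) ?ltry//; exact: probability_setT.
Qed.

Hypothesis s_measurable : forall i t, measurable_fun (@Hist R n G t : set (borel (hist G t)))
  (@s i t : borel (hist G t) -> borel (act G t i)).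
Hypothesis s_action : forall i t h, @Hist R n G t h -> action i h (s i h).
Hypothesis g_mixed : is_mixed_strategy g.
Context (M : R) (V : forall t, hist G t -> R).
Hypothesis V_admissible : forall t, admissible M (@V t).
Hypothesis V_super : forall t h x, Hist h -> action i h x ->
  (stage_value (@V t.+1) h (dfwith (fun j => s j h) i x) <= V h)%R.

(* Shifted to be nonnegative, so that all the integrals below make sense. *)
Definition shifted t (h : borel (hist G t)) : \bar R :=
  if h \in @Hist R n G t then (V h + M)%:E else 0.

Lemma shifted_ge0 t h : 0 <= @shifted t h.
Proof.
rewrite /shifted; case: ifPn => // /[!inE] Hh; rewrite lee_fin.
by have := (V_admissible t).1 _ Hh; rewrite ler_norml => /andP[]; lra.
Qed.

Lemma shifted_measurable t : measurable_fun setT (@shifted t).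
Proof.
apply: measurable_fun_patch; first exact: Hist_measurable.
apply/measurable_EFinP; apply: measurable_funD; last exact: measurable_cst.
exact: lsc_measurable (V_admissible t).2.
Qed.

Lemma next_hist_measurable t (h : hist G t) :
  measurable_fun setT (fun w : borel (act G t i) * borel (chance G t) =>
    next_hist s h w.1 w.2 : borel (hist G t.+1)).
Proof.
apply: (measurable_fun_borel_pair (hist_countable_subbase G_game t)
  (stage_countable_subbase G_game t)); first exact: measurable_cst.
apply: (measurable_fun_borel_pair (act_profile_countable_subbase G_game t)
  (chance_countable_subbase G_game t)); last exact: measurable_snd.
apply: (measurable_fun_borel_prod_topology (act_countable_subbase G_game t)) => j.
have [<-{j}|ij] := eqVneq i j.
  apply: (eq_measurable_fun (fun w => w.1)) => [w _|]; first by rewrite dfwithin.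
  exact: measurable_fst.
apply: (eq_measurable_fun
  (fun w : borel (act G t i) * borel (chance G t) =>
    s j h : borel (act G t j))) => [w _|]; first by rewrite dfwithout.
exact: measurable_cst.
Qed.

Lemma shifted_super t (h : hist G t) : Hist h ->
  \int[g h]_x \int[nature h]_c shifted (next_hist s h x c) <= shifted h.
Proof.
move=> Hh; pose F (x : act G t i) := \int[nature h]_c shifted (next_hist s h x c).
have mA : measurable (action i h : set (borel (act G t i))).
  by apply: borel_closed; exact: (action_closed G_game).
have F0 x : 0 <= F x by apply: integral_ge0 => c _; exact: shifted_ge0.
have mF : measurable_fun setT (F : borel (act G t i) -> \bar R).
  apply: (@measurable_fun_fubini_tonelli_F _ _ (borel (act G t i)) (borel (chance G t)) R
    (nature h) (fun w => shifted (next_hist s h w.1 w.2))).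
    exact: (measurableT_comp (@shifted_measurable t.+1) (@next_hist_measurable t h)).
  by move=> w; exact: shifted_ge0.
rewrite (@integral_full _ _ _ (g h) (action i h))//; last exact: mixed_strategy_action.
have gA : g h (action i h) = 1 by exact: mixed_strategy_action.
apply: (@le_trans _ _ (\int[g h]_(x in action i h) shifted h)).
  apply: ge0_le_integral => //.
    by move=> x _; exact: F0.
    exact: measurable_funS mF.
  move=> x Ax; pose z : prod_topology (act G t) := dfwith (fun j => s j h) i x.
  have hz : feasible (h, z).
    by split=> // j /=; rewrite /z; case: dfwithP => // j' _; exact: s_action.
  rewrite /F /shifted mem_set//.
  have VI := stage_integrable hz (V_admissible t.+1).
  rewrite (eq_integral (fun c : borel (chance G t) => (V (next_hist s h x c))%:E + M%:E)); last
      first.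
    move=> c _; rewrite mem_set//; split=> //; exact: hz.2.
  rewrite integralD//; last first.
    by apply: (@bounded_integrable _ _ _ _ _ _ `|M|%R).
  rewrite integral_cst// [X in _ + _ * X](_ : _ = 1); last exact: probability_setT.
  rewrite mule1 EFinD leeD2r// -(fineK (integrable_fin_num _ VI))// lee_fin.
  exact: V_super.
by rewrite integral_cst// [X in _ * X](_ : _ = 1) ?mule1.
Qed.

Lemma shifted_decr t : (t0 <= t)%N ->
  \int[@marginal R n G tau t.+1]_h shifted h <= \int[@marginal R n G tau t]_h shifted h.
Proof.
move=> t0t; have [P PE] := marginal_probability tau t.
have [P' P'E] := marginal_probability tau t.+1.
have [K [_ KE]] := game_kernel G_game s_measurable g_mixed t.
have KP : forall B, measurable B -> P' B = \int[P]_h K h B.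
  move=> B mB; transitivity (@marginal R n G tau t.+1 B); first by rewrite -P'E.
  by rewrite PE; exact: outcome_transition.
rewrite -PE -P'E (integral_mixture KP) => [|z|]; last 2 first.
- exact: shifted_ge0.
- exact: shifted_measurable.
have mH : measurable (@Hist R n G t : set (borel (hist G t))) by exact: Hist_measurable.
have PH : P (@Hist R n G t) = 1 by rewrite -[RHS](outcome_Hist t) -PE.
have mKs : measurable_fun setT (fun h => \int[K h]_z shifted z).
  apply: measurable_fun_integral_kernel => //; first by move=> U mU; exact: measurable_kernel.
    exact: shifted_ge0.
  exact: shifted_measurable.
rewrite (integral_full mH PH)// => [|h]; last first.
  by apply: integral_ge0 => z _; exact: shifted_ge0.
rewrite [leRHS](integral_full mH PH); [|exact: shifted_ge0|exact: shifted_measurable].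
apply: ge0_le_integral => //.
- by move=> h _; apply: integral_ge0 => z _; exact: shifted_ge0.
- exact: measurable_funS mKs.
- exact: measurable_funS (@shifted_measurable t).
- move=> h Hh; rewrite KE//; [exact: shifted_super|exact: shifted_ge0|exact: shifted_measurable].
Qed.

Lemma shifted_le k : Hist h0 ->
  \int[@marginal R n G tau (t0 + k)]_h shifted h <= (V h0 + M)%:E.
Proof.
move=> Hh0; elim: k => [|k]; last first.
  by apply: le_trans; rewrite addnS; apply: shifted_decr; exact: leq_addr.
rewrite addn0; have [_ tau0 _] := tau_outcome; have [P PE] := marginal_probability tau t0.
rewrite -PE (eq_measure_integral (\d_(h0 : borel (hist G t0)))%R) => [|A mA _]; last first.
  by transitivity (marginal tau A); [rewrite -PE|exact: (tau0 A mA)].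
rewrite integral_dirac//; last exact: shifted_measurable.
by rewrite diracT mul1e /shifted mem_set.
Qed.

(** Late enough, the payoff differs from [V] along the play by less than [e], while the mean of [V]
    at that stage is at most [V h0]. *)
Lemma outcome_payoff_le j : Hist h0 ->
  (forall w, Hinf w -> `|payoff_fun G j w| <= M)%R ->
  (forall t w, Hinf w -> `|payoff_fun G j w - V (trunc t w)| <= tail_oscillation G t.+1)%R ->
  (\int[tau]_(w in @Hinf R n G) payoff_fun G j w <= V h0)%R.
Proof.
move=> Hh0 uM uV; have mI := Hinf_measurable.
have [tH _ _] := tau_outcome.
have uI : tau.-integrable (@Hinf R n G : set (borel (play G))) (EFin \o payoff_fun G j).
  apply: (@bounded_integrable _ _ _ _ _ _ M) => //.
  by apply: lsc_measurable => //; exact: continuous_lsc (@payoff_continuous _ _ _ G_game j).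
have cstI c : tau.-integrable (@Hinf R n G : set (borel (play G))) (EFin \o cst c).
  by apply: (@bounded_integrable _ _ _ _ _ _ `|c|%R).
apply/ler_addgt0Pr => e e0; have [m om] := tail_oscillation_small G_game t0 e0.
apply: (@le_trans _ _ (V h0 + tail_oscillation G (t0 + m).+1)%R); last by rewrite lerD2l ltW.
rewrite -(lerD2r M) -lee_fin addrAC.
have -> : (\int[tau]_(w in @Hinf R n G) payoff_fun G j w + M)%:E =
    \int[tau]_(w in (@Hinf R n G : set (borel (play G)))) (payoff_fun G j w + M)%:E.
  rewrite (eq_integral (fun w : borel (play G) => (payoff_fun G j w)%:E + M%:E))//.
  rewrite integralD//; last exact: cstI.
  rewrite integral_cst// [X in _ + _ * X](_ : _ = 1) ?mule1// EFinD fineK//.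
  exact: integrable_fin_num.
set c := tail_oscillation _ _ in om *.
(* Integrals of nonnegative functions are added below; the sign follows since the oscillation bounds
   an absolute value along some play. *)
have c0 : (0 <= c)%R.
  have [w [Hw _]] := Hist_extend G_game Hh0.
  exact: le_trans (normr_ge0 _) (uV (t0 + m)%N w Hw).
have mW : measurable_fun setT (fun w : borel (play G) => shifted (trunc (t0 + m) w)).
  exact: (measurableT_comp (@shifted_measurable (t0 + m)) (@trunc_measurable _ _ _ (t0 + m))).
apply: (@le_trans _ _ (\int[tau]_(w in (@Hinf R n G : set (borel (play G)))) (shifted (trunc (t0
    + m) w) + c%:E))).
  apply: ge0_le_integral => //.
  - move=> w Hw; rewrite lee_fin; have := uM w Hw; rewrite ler_norml => /andP[]; lra.
  - apply/measurable_EFinP; apply: measurable_funD => //.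
    by apply: lsc_measurable => //; exact: continuous_lsc (@payoff_continuous _ _ _ G_game j).
  - by apply: emeasurable_funD => //; exact: measurable_funS mW.
  - move=> w Hw; rewrite /shifted mem_set; last exact: Hw.
    rewrite -EFinD lee_fin; have := uV (t0 + m)%N w Hw; rewrite ler_norml -/c => /andP[_]; lra.
rewrite ge0_integralD//; last 2 first.
- by move=> w _; exact: shifted_ge0.
- exact: measurable_funS mW.
rewrite integral_cst// [X in _ + _ * X](_ : _ = 1) ?mule1// [leRHS]EFinD leeD2r//.
apply: le_trans (shifted_le m Hh0).
rewrite -(integral_full mI tH)//; last by move=> w; exact: shifted_ge0.
have := @ge0_integral_pushforward _ _ (borel (play G)) (borel (hist G (t0 + m)%N)) R
  (@trunc n G (t0 + m)) (@trunc_measurable _ _ _ (t0 + m)) tau setT (@shifted (t0 + m))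
  measurableT (@shifted_measurable (t0 + m)) (fun h _ => @shifted_ge0 (t0 + m) h).
by rewrite preimage_setT => ->.
Qed.

End OutcomeTransition.

Local Close Scope ereal_scope.

(** Composed with measurable selections, this makes pure strategies Borel maps into the space of
    measures. *)
Lemma dirac_continuous (R : realType) (T : ptopologicalType) :
  continuous (fun x : T => dirac (x : borel T) : weak_prob R T).
Proof.
move=> x; apply/cvg_sup => -[phi [cphi bphi]] P; rewrite nbhsE /= => -[Q [[V oV VQ] Qx] QP].
have phiE y : \int[dirac (y : borel T)]_z phi z = phi y.
  rewrite /Rintegral integral_dirac//; first by rewrite diracT mul1e.
  by apply/measurable_EFinP; apply: lsc_measurable => //; apply: continuous_lsc; exact:
      continuous_subspaceT.
have Vx : V (phi x) by move: Qx; rewrite -VQ /= phiE.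
have : nbhs x (phi @^-1` V) by apply: cphi; exact: open_nbhs_nbhs.
by apply: filterS => y Vy; apply: QP; rewrite -VQ /= phiE.
Qed.

(** * Pure profiles and equilibrium *)

Section PureProfile.
Context (R : realType) (n : nat) (G : game R n).
Hypothesis G_game : is_dynamic_game G.
Context (s : forall (i : 'I_n) t, hist G t -> act G t i).
Hypothesis s_measurable : forall i t, measurable_fun (@Hist R n G t : set (borel (hist G t)))
  (@s i t : borel (hist G t) -> borel (act G t i)).
Hypothesis s_action : forall i t h, @Hist R n G t h -> action i h (s i h).

Lemma pure_profile_mixed i : is_mixed_strategy (pure_profile s i).
Proof.
move=> t; split=> [|h Hh].
  have c := continuous_borel_measurable (@dirac_continuous R (act G t i)).
  have : measurable_fun (@Hist R n G t : set (borel (hist G t)))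
      ((fun x : borel (act G t i) => dirac x : borel (weak_prob R (act G t i))) \o @s i t).
    exact: (measurableT_comp c (@s_measurable i t)).
  exact.
move=> x; apply; split; first exact: (action_closed G_game).
transitivity (dirac (s i h : borel (act G t i)) (action i h) : \bar R)%E => //.
by rewrite diracE mem_set//; exact: s_action.
Qed.

Lemma pure_profile_pure i : is_pure_strategy (pure_profile s i).
Proof.
by split=> [|t h Hh]; [exact: pure_profile_mixed|exists (s i h)].
Qed.

End PureProfile.

(** The profile itself is a deviation to one's own strategy, so bounds proved for deviations also
    apply to it, for each player. *)
Lemma deviate_id (R : realType) n (G : game R n) (f : profile G) i : deviate f (f i) = f.
Proof.
apply/functional_extensionality_dep => j; rewrite /deviate.
by have [<-|ij] := eqVneq i j; [rewrite dfwithin|rewrite dfwithout].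
Qed.

Theorem proposition1 (R : realType) (G : game R 2)
    (G_game : is_dynamic_game G)
    (G_perfect : perfect_information G)
    (G_zero_sum : zero_sum G) :
  exists f : profile G, pure_subgame_perfect f.
Proof.
have [M M0 uM] := payoff_uniform_bound G_game.
have [s [ms sA saddle]] := saddle_profile G_game G_perfect G_zero_sum.
have mixed := pure_profile_mixed G_game ms sA.
pose f := pure_profile s.
have outcomeP i t (h : hist G t) (g : strategy G i) : Hist h -> is_mixed_strategy g ->
    is_outcome (deviate f g) h (outcome (deviate f g) h).
  move=> Hh mg; apply: getPex; exact: outcome_exists.
have payoff_le i t (h : hist G t) (g : strategy G i) : Hist h -> is_mixed_strategy g ->
    payoff i (deviate f g) h <= saddle_value i h.
  move=> Hh mg; have io := neq_rev_ord2 i.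
  apply: (@outcome_payoff_le R 2 G G_game s i g t h _ (outcomeP i t h g Hh mg) ms sA mg M
    (@saddle_value R G i)) => //.
  - by move=> m; exact: value_admissible.
  - move=> m h' x Hh' Ax; apply: saddle => [|k ki]; last by rewrite dfwithout// eq_sym.
    by split=> // j /=; case: dfwithP => // j' _; exact: sA.
  - by move=> w Hw; exact: uM.
  - by move=> m w Hw; exact: (payoff_value G_game G_perfect G_zero_sum uM m io Hw).
exists f; split; last by move=> i; exact: pure_profile_pure.
split; first exact: mixed.
move=> i t h Hh g mg; apply: (le_trans (payoff_le i t h g Hh mg)).
pose o := rev_ord i; have io : i != o := neq_rev_ord2 i.
have payoff_f j : payoff j f h <= saddle_value j h.
  by have := payoff_le j t h (f j) Hh (mixed j); rewrite deviate_id.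
have fP : is_outcome f h (outcome f h).
  by have := outcomeP i t h (f i) Hh (mixed i); rewrite deviate_id.
(* Both payoffs are integrals against the same measure [outcome f h], so the zero sum holds under
   the integral. *)
have payoff_sum : payoff i f h + payoff o f h = 0.
  have mI := Hinf_measurable G_game.
  have uI j : (outcome f h).-integrable (@Hinf R 2 G : set (borel (play G)))
      (EFin \o payoff_fun G j).
    apply: (@bounded_integrable _ _ _ _ _ _ M) => //; last by move=> w; exact: uM.
    by apply: lsc_measurable => //; exact: continuous_lsc (@payoff_continuous _ _ _ G_game j).
  rewrite /payoff -RintegralD//.
  rewrite (_ : Rintegral _ _ _ = \int[outcome f h]_(w in @Hinf R 2 G) 0).
    by rewrite Rintegral_cst// mul0r.
  by apply: eq_Rintegral => w /[!inE] Hw; exact: (zero_sum_payoff G_zero_sum io Hw).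
have vo : payoff o f h <= value o i h by have := payoff_f o; rewrite /saddle_value rev_ordK.
have v0 := value_zero_sum G_game G_perfect G_zero_sum uM io Hh.
(* Adding the opponent's payoff to both sides turns the lower bound for [i] into the upper bound
   already known for [o]. *)
rewrite -(lerD2r (payoff o f h)) payoff_sum -v0; exact: lerD.
Qed.
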